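(* Let $Y$ be the bounded strong solution of the call-side obstacle problem on $(-\infty,\ln k_1)\times(0,T]$, with free boundaries $A$ and $B$ on $(0,T]$. Let $V$ be the strong solution of the capped stationary call-side problem, let $a$ be its lower free boundary, and let $b_{k_1}$ be its upper boundary level, all as defined in the context. Then $$\begin{cases}Y(x,\tau)\le V(x),&(x,\tau)\in(-\infty,\ln k_1]\times[0,T],\\ a\le A(\tau)<\ln K_1,&\tau\in(0,T],\\ \min\{\xi,\ln k_1\}\le B(\tau)\le b_{k_1},&\tau\in(0,T],\end{cases}$$ where $\xi:=\max\left\{\ln K_1,\ \ln\frac{r(K_1+k_1-K_2)}{q}\right\}$, the second term being understood as $-\infty$ if $q=0$ or $K_1+k_1\le K_2$. In particular $A(\tau)\searrow A(T)\ge a$ and $B(\tau)\nearrow B(T)\le b_{k_1}$ as $\tau\nearrow T$, and the limits of $A(T)$ and $B(T)$ as $T\to\infty$ exist.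
   Context: Constants: $0<K_1<k_1<k_2<K_2$, $\sigma>0$, $r>0$, $q\ge0$, $T>0$. Put $\mathcal Lu:=\frac{\sigma^2}{2}\partial_{xx}u+\left(r-q-\frac{\sigma^2}{2}\right)\partial_xu-ru$ and $\psi_1(x):=(e^x-K_1)^++K_2-k_1$. $n_1<0<n_2$ are the roots of $\frac{\sigma^2}{2}n^2+\left(r-q-\frac{\sigma^2}{2}\right)n-r=0$. Evolution problem. Let $Q=(-\infty,\ln k_1)\times(0,T]$. For $1<p<\infty$, $\mathcal W_p(Q)$ is the set of $u\in C((-\infty,\ln k_1]\times[0,T])$ such that, for all $R,\rho>0$, $u,\partial_xu,\partial_{xx}u,\partial_\tau u$ (weak derivatives) belong to $L^p$ of $\left(((-\infty,\ln k_1)\cap(-R,R))\times(0,T)\right)\setminus B_\rho(\ln K_1,0)$ ($B_\rho$: open disc of radius $\rho$). A strong solution of the call-side obstacle problem is $Y\in\mathcal W_p(Q)$ with $Y\ge\psi_1$ in $Q$, $\partial_\tau Y-\mathcal LY\ge0$ a.e. in $Q$, $\partial_\tau Y-\mathcal LY=0$ a.e. on $\{Y>\psi_1\}$, $Y(x,0)=\psi_1(x)$ for $x<\ln k_1$, and $Y(\ln k_1,\tau)=K_2-K_1$ for $\tau\in[0,T]$. For every $p$ there is exactly one bounded strong solution, independent of $p$, and solutions for a larger horizon $T$ restrict to those for a smaller one. Free boundaries, for $\tau\in(0,T]$: $A(\tau)=\max\{x\le\ln K_1:Y(x,\tau)=K_2-k_1\}$ and $B(\tau)=\min\{x\in[\ln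 K_1,\ln k_1]:Y(x,\tau)=e^x-K_1+K_2-k_1\}$ (both attained). Stationary problem. A strong solution of the capped stationary call-side problem is a bounded $V\in C((-\infty,\ln k_1])\cap W^2_{p,\mathrm{loc}}((-\infty,\ln k_1))$ with $V\ge\psi_1$, $-\mathcal LV\ge0$ a.e., $-\mathcal LV=0$ a.e. on $\{V>\psi_1\}$ and $V(\ln k_1)=K_2-K_1$; it is unique. Let $G(u):=\frac{K_2-k_1}{n_2-n_1}\left[n_2e^{n_1u}-n_1e^{n_2u}\right]$. If $q>0$, or $q=0$ and $K_1+k_1<K_2$, let $y_\infty>1$ be the unique root in $(1,\infty)$ of $f(z)=\frac{K_2-k_1}{n_2-n_1}\left[n_2(1-n_1)z^{n_1}+n_1(n_2-1)z^{n_2}\right]+(K_1+k_1-K_2)$ and $e^b=\frac{(K_2-k_1)n_1n_2}{n_2-n_1}\left[y_\infty^{n_1}-y_\infty^{n_2}\right]$; if $q=0$ and $K_1+k_1\ge K_2$, put $b=+\infty$. Case (i), $b\le\ln k_1$: $e^a:=e^b/y_\infty$, $b_{k_1}:=b$, and $V(x)=K_2-k_1$ for $x<a$, $V(x)=G(x-a)$ for $a\le x\le b$, $V(x)=e^x-K_1+K_2-k_1$ for $b<x\le\ln k_1$. Case (ii), $b>\ln k_1$: $e^a:=k_1/y$, where $y$ is the unique root in $(1,\infty)$ of $g(z)=\frac{K_2-k_1}{n_2-n_1}\left[n_2z^{n_1}-n_1z^{n_2}\right]-(K_2-K_1)$, $b_{k_1}:=\ln k_1$, and $V(x)=K_2-k_1$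 for $x<a$, $V(x)=G(x-a)$ for $a\le x\le\ln k_1$. *)

(* Defs.v *)
From HB Require Import structures.
From mathcomp Require Import all_boot all_order all_algebra.
From mathcomp Require Import all_classical all_reals all_analysis.

Set Implicit Arguments.
Unset Strict Implicit.
Unset Printing Implicit Defensive.

Import Order.TTheory GRing.Theory Num.Theory.
Import numFieldNormedType.Exports.

Local Open Scope classical_set_scope.
Local Open Scope ring_scope.

(* On a finite-dimensional [E] this is C^oo: all iterated directional
   derivatives exist and are differentiable, hence continuous. *)
Definition smooth (R : realType) (E : normedModType R) (phi : E -> R) : Prop :=
  forall (vs : seq E) (z : E),
    differentiable (foldr (fun v f => 'D_v f) phi vs) z.

Definition test_function (R : realType) (E : normedModType R) (Omega : set E)
    (phi : E -> R) : Prop :=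
  smooth phi /\
  exists K : set E, [/\ compact K, K `<=` Omega & forall z, ~ K z -> phi z = 0].

Definition lebesgue2 (R : realType) :
    {measure set (measurableTypeR R * measurableTypeR R) -> \bar R} :=
  (@lebesgue_measure R \x @lebesgue_measure R)%E.

Definition loc_integrable1 (R : realType) (I : set R) (u : R -> R) : Prop :=
  forall K : set R, compact K -> K `<=` I ->
    (@lebesgue_measure R).-integrable K (EFin \o u).

Definition loc_integrable2 (R : realType) (Omega : set (R * R))
    (u : R * R -> R) : Prop :=
  forall K : set (R * R), compact K -> K `<=` Omega ->
    (@lebesgue2 R).-integrable K (EFin \o u).

(* [I] is meant to be open; local integrability of [u] and [w] makes both
   integrals below converge absolutely. *)
Definition weak_derivative1 (R : realType) (I : set R) (u w : R -> R) : Prop :=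
  [/\ loc_integrable1 I u, loc_integrable1 I w &
   forall phi : R -> R, test_function I phi ->
     \int[@lebesgue_measure R]_(x in I) (u x * 'D_1 phi x) =
     - \int[@lebesgue_measure R]_(x in I) (w x * phi x)].

(* Distributional derivative along [v]: (1, 0) gives d/dx, (0, 1) gives d/dtau. *)
Definition weak_derivative2 (R : realType) (v : R * R) (Omega : set (R * R))
    (u w : R * R -> R) : Prop :=
  [/\ loc_integrable2 Omega u, loc_integrable2 Omega w &
   forall phi : R * R -> R, test_function Omega phi ->
     \int[@lebesgue2 R]_(z in Omega) (u z * 'D_v phi z) =
     - \int[@lebesgue2 R]_(z in Omega) (w z * phi z)].

Definition in_Lp d (T : measurableType d) (R : realType)
    (mu : {measure set T -> \bar R}) (p : R) (D : set T) (f : T -> R) : Prop :=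
  measurable_fun D f /\ (\int[mu]_(x in D) (`|f x| `^ p)%:E < +oo)%E.

Definition is_max (R : realType) (S : set R) (m : R) : Prop :=
  S m /\ ubound S m.

Definition is_min (R : realType) (S : set R) (m : R) : Prop :=
  S m /\ lbound S m.

(* The value of L u at a point where u, u_x, u_xx take the values
   [u0], [u1], [u2]. *)
Definition opL (R : realType) (sigma r q u0 u1 u2 : R) : R :=
  sigma ^+ 2 / 2 * u2 + (r - q - sigma ^+ 2 / 2) * u1 - r * u0.

Definition psi1 (R : realType) (K1 k1 K2 x : R) : R :=
  Num.max (expR x - K1) 0 + K2 - k1.

(* Points of the plane are pairs (x, tau). *)
Definition Qdom (R : realType) (k1 T : R) : set (R * R) :=
  [set z | z.1 < ln k1 /\ 0 < z.2 <= T].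

Definition Qint (R : realType) (k1 T : R) : set (R * R) :=
  [set z | z.1 < ln k1 /\ 0 < z.2 < T].

Definition Qclosure (R : realType) (k1 T : R) : set (R * R) :=
  [set z | z.1 <= ln k1 /\ 0 <= z.2 <= T].

(* The removed disc is Euclidean, whereas [ball] on R * R is a sup-norm ball. *)
Definition Qtrunc (R : realType) (K1 k1 T M rho : R) : set (R * R) :=
  [set z | [/\ z.1 < ln k1, `|z.1| < M, 0 < z.2 < T &
            rho ^+ 2 <= (z.1 - ln K1) ^+ 2 + z.2 ^+ 2]].

(* [ux], [uxx], [ut] are determined by [u] only up to a null set; the strong
   formulation below uses them only almost everywhere. *)
Definition in_Wp (R : realType) (K1 k1 p T : R)
    (u ux uxx ut : R * R -> R) : Prop :=
  [/\ {within Qclosure k1 T, continuous u},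
      weak_derivative2 (1, 0) (Qint k1 T) u ux,
      weak_derivative2 (1, 0) (Qint k1 T) ux uxx,
      weak_derivative2 (0, 1) (Qint k1 T) u ut &
      forall M rho : R, 0 < M -> 0 < rho ->
        [/\ in_Lp (@lebesgue2 R) p (Qtrunc K1 k1 T M rho) u,
            in_Lp (@lebesgue2 R) p (Qtrunc K1 k1 T M rho) ux,
            in_Lp (@lebesgue2 R) p (Qtrunc K1 k1 T M rho) uxx &
            in_Lp (@lebesgue2 R) p (Qtrunc K1 k1 T M rho) ut]].

Definition strong_solution (R : realType) (K1 k1 K2 sigma r q p T : R)
    (Y : R * R -> R) : Prop :=
  exists Yx Yxx Yt : R * R -> R,
  [/\ in_Wp K1 k1 p T Y Yx Yxx Yt,
      (forall z, Qdom k1 T z -> psi1 K1 k1 K2 z.1 <= Y z),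
      {ae @lebesgue2 R, forall z, Qdom k1 T z ->
        0 <= Yt z - opL sigma r q (Y z) (Yx z) (Yxx z)},
      {ae @lebesgue2 R, forall z, Qdom k1 T z -> psi1 K1 k1 K2 z.1 < Y z ->
        Yt z - opL sigma r q (Y z) (Yx z) (Yxx z) = 0} &
      (forall x, x < ln k1 -> Y (x, 0) = psi1 K1 k1 K2 x) /\
      (forall tau, 0 <= tau <= T -> Y (ln k1, tau) = K2 - K1)].

Definition bounded_strong_solution (R : realType) (K1 k1 K2 sigma r q p T : R)
    (Y : R * R -> R) : Prop :=
  strong_solution K1 k1 K2 sigma r q p T Y /\
  exists M : R, forall z, Qclosure k1 T z -> `|Y z| <= M.

Definition lower_free_boundary (R : realType) (K1 k1 K2 T : R)
    (Y : R * R -> R) (A : R -> R) : Prop :=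
  forall tau, 0 < tau <= T ->
    is_max [set x | x <= ln K1 /\ Y (x, tau) = K2 - k1] (A tau).

Definition upper_free_boundary (R : realType) (K1 k1 K2 T : R)
    (Y : R * R -> R) (B : R -> R) : Prop :=
  forall tau, 0 < tau <= T ->
    is_min [set x | ln K1 <= x <= ln k1 /\
                    Y (x, tau) = expR x - K1 + K2 - k1] (B tau).

Definition stationary_strong_solution (R : realType)
    (K1 k1 K2 sigma r q p : R) (V : R -> R) : Prop :=
  (exists M : R, forall x, x <= ln k1 -> `|V x| <= M) /\
  {within [set x | x <= ln k1], continuous V} /\
  exists V1 V2 : R -> R,
  [/\ weak_derivative1 [set x | x < ln k1] V V1 /\
      weak_derivative1 [set x | x < ln k1] V1 V2,
      (forall K : set R, compact K -> K `<=` [set x | x < ln k1] ->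
        [/\ in_Lp (@lebesgue_measure R) p K V,
            in_Lp (@lebesgue_measure R) p K V1 &
            in_Lp (@lebesgue_measure R) p K V2]),
      (forall x, x < ln k1 -> psi1 K1 k1 K2 x <= V x),
      {ae @lebesgue_measure R, forall x, x < ln k1 ->
        0 <= - opL sigma r q (V x) (V1 x) (V2 x)} /\
      {ae @lebesgue_measure R, forall x, x < ln k1 -> psi1 K1 k1 K2 x < V x ->
        - opL sigma r q (V x) (V1 x) (V2 x) = 0} &
      V (ln k1) = K2 - K1].

Definition characteristic_root (R : realType) (sigma r q n : R) : Prop :=
  sigma ^+ 2 / 2 * n ^+ 2 + (r - q - sigma ^+ 2 / 2) * n - r = 0.

Definition f_stat (R : realType) (K1 k1 K2 n1 n2 z : R) : R :=
  (K2 - k1) / (n2 - n1) *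
    (n2 * (1 - n1) * z `^ n1 + n1 * (n2 - 1) * z `^ n2) + (K1 + k1 - K2).

Definition g_stat (R : realType) (K1 k1 K2 n1 n2 z : R) : R :=
  (K2 - k1) / (n2 - n1) * (n2 * z `^ n1 - n1 * z `^ n2) - (K2 - K1).

(* The point b in (-oo, +oo] and, when b is finite, the ratio y_oo of e^b to
   e^a for the uncapped problem; [y] is unconstrained when b = +oo. *)
Definition uncapped_level (R : realType) (K1 k1 K2 q n1 n2 y : R)
    (b : \bar R) : Prop :=
  if (0 < q) || (K1 + k1 < K2) then
    [/\ 1 < y, f_stat K1 k1 K2 n1 n2 y = 0 &
     exists2 b0 : R, b = b0%:E &
       expR b0 = (K2 - k1) * n1 * n2 / (n2 - n1) * (y `^ n1 - y `^ n2)]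
  else b = +oo%E.

Definition capped_levels (R : realType) (K1 k1 K2 q n1 n2 a bk1 : R) : Prop :=
  exists (y : R) (b : \bar R), uncapped_level K1 k1 K2 q n1 n2 y b /\
  if (b <= (ln k1)%:E)%E then
    expR a = expR (fine b) / y /\ bk1 = fine b
  else
    exists z : R, [/\ 1 < z, g_stat K1 k1 K2 n1 n2 z = 0,
                      expR a = k1 / z & bk1 = ln k1].

Definition xi_level (R : realType) (K1 k1 K2 r q : R) : R :=
  if (0 < q) && (K2 < K1 + k1)
  then Num.max (ln K1) (ln (r * (K1 + k1 - K2) / q))
  else ln K1.

(* Main.v *)
(* Let P = d/dtau - L. Where Y exceeds a supersolution W >= psi_1 it also exceeds
   psi_1, so there P(Y - W) <= 0, a priori only in the sense of distributions.
   Mollifying Y - W gives smooth subsolutions converging locally uniformly, so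
   that every quadratic polynomial touching Y - W from above satisfies the same
   inequality at the contact point; a penalised maximum principle for such
   viscosity subsolutions then yields Y <= W.

   With W = V this is Y <= V. With W a later time slice of another solution,
   Y(., tau) <= Y'(., tau + h): this gives monotonicity in time, and at h = 0 it
   identifies solutions with different horizons. With W the explicit stationary
   profile built from G, it gives a <= A and B <= b_{k1}. Touching Y from
   below at a contact point gives the remaining bounds: at ln K1 the convex kink of
   psi_1 admits arbitrarily curved parabolas, so contact is impossible, and at a
   contact point x < ln k1 with the payoff e^x - K1 + K2 - k1 the inequality
   P Y >= 0 reads q e^x >= r (K1 + k1 - K2). Monotone bounded boundaries have
   limits, and the limit at tau = T is a contact point by continuity of Y. *)
Require Import Defs.
From HB Require Import structures.
From mathcomp Require Import all_boot all_order all_algebra.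
From mathcomp Require Import all_classical all_reals all_analysis.
From mathcomp Require Import measurable_realfun ring lra.

Set Implicit Arguments.
Unset Strict Implicit.
Unset Printing Implicit Defensive.

Import Order.TTheory GRing.Theory Num.Theory.
Import numFieldNormedType.Exports.

Local Open Scope classical_set_scope.
Local Open Scope ring_scope.

(** * Mollifiers *)

(** The obstacle is low regularity: the second derivatives of [Y] exist only weakly, so the
    differential inequalities cannot be evaluated at a maximum point of Y - W. Two notions share the
    work. At the distributional level subtraction is linear, and Y - W inherits its sign by adding
    two test inequalities; subtracting viscosity sub- and supersolutions would require doubling the
    variables. At the viscosity level a penalty can be added and a maximum point examined with
    continuity alone. The explicit profile, only piecewise smooth, enters at that second level
    through upper expansions at single points.

    Two stationary comparisons are made because [V] is given by its variational problem while [a]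
    and [bk1] are given by algebraic equations, and the proof does not identify [V] with the
    explicit profile. The comparison with [V] gives the pointwise bound. The comparison with the
    profile locates the free boundaries: where the profile meets the obstacle, [Y] is squeezed
    between the two. Whether the cap binds is recorded by the sign of a single function,
    [tangency]. *)

Section flat_functions.
Context {R : realType}.
Implicit Types (p : {poly R}) (x : R).

(* For x <= 0 the value is 0; the family is stable under differentiation since
   (p(1/x) e^(-1/x))' = (X^2 (p - p'))(1/x) e^(-1/x). *)
Definition flat p x : R := if 0 < x then p.[x^-1] * expR (- x^-1) else 0.

Definition flat_next p : {poly R} := 'X^2 * (p - p^`()).

Lemma flat_le0 p x : x <= 0 -> flat p x = 0.
Proof. by move=> x0; rewrite /flat ltNge x0. Qed.

Lemma flat_ge0 x : 0 <= flat 1 x.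
Proof. by rewrite /flat; case: ifP => // _; rewrite hornerC mul1r expR_ge0. Qed.

Lemma flat_gt0 x : 0 < x -> 0 < flat 1 x.
Proof. by move=> x0; rewrite /flat x0 hornerC mul1r expR_gt0. Qed.

(** With s = 1/x this is s^(n+1) <= (n+1)! e^s, a single term of the exponential series; the spare
    power of s becomes the factor x. *)
Lemma monomial_flat_le n x : 0 < x -> x^-1 ^+ n * expR (- x^-1) <= n.+1`!%:R * x.
Proof.
move=> x0; have s0 : 0 < x^-1 by rewrite invr_gt0.
have h := expR_ge1Dxn n (ltW s0).
have f0 : 0 < (n.+1`!%:R : R) by rewrite ltr0n fact_gt0.
have {}h : x^-1 ^+ n.+1 <= expR x^-1 * n.+1`!%:R.
  by rewrite -ler_pdivrMr//; apply: le_trans h; rewrite lerDr.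
rewrite expRN ler_pdivrMr ?expR_gt0//.
have -> : x^-1 ^+ n = x * x^-1 ^+ n.+1 by rewrite exprS mulrA divff ?mul1r ?gt_eqF.
rewrite (_ : _ * x * _ = x * (expR x^-1 * n.+1`!%:R)); last by ring.
by rewrite ler_pM2l.
Qed.

(** A linear bound suffices at the origin: applied to ['X * p] it controls the difference quotients
    of [flat p] at 0. *)
Lemma flat_linear_bound p :
  exists2 C, 0 <= C & forall x, 0 < x -> `|flat p x| <= C * x.
Proof.
(* The factor ['X^n] is carried along so that the induction step, where [p] becomes [p * 'X + c],
   moves the extra ['X] into the exponent. *)
suff H : forall n, exists2 C, 0 <= C &
    forall x, 0 < x -> `|flat ('X^n * p) x| <= C * x.
  by have := H 0%N; rewrite expr0 mul1r.
elim/poly_ind: p => [|p c IH] n.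
  by exists 0 => // x _; rewrite mulr0 /flat horner0 mul0r if_same normr0 mul0r.
have [C C0 HC] := IH n.+1.
have f0 : 0 <= (n.+1`!%:R : R) by rewrite ler0n.
exists (C + `|c| * n.+1`!%:R) => [|x x0]; first by rewrite addr_ge0// mulr_ge0.
have -> : 'X^n * (p * 'X + c%:P) = 'X^(n.+1) * p + c *: 'X^n.
  by rewrite mulrDr mulrCA -exprSr mulrC -mul_polyC [_ * c%:P]mulrC.
rewrite {1}/flat x0 hornerD mulrDl mulrDl.
apply: le_trans (ler_normD _ _) _; apply: lerD.
  by have := HC x x0; rewrite /flat x0.
rewrite hornerZ hornerXn -mulrA normrM -mulrA ler_wpM2l//.
rewrite ger0_norm; first exact: monomial_flat_le.
by rewrite mulr_ge0 ?expR_ge0 ?exprn_ge0 ?invr_ge0 ?ltW.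
Qed.

Lemma is_derive_flat p x : is_derive x 1 (flat p) (flat (flat_next p) x).
Proof.
have [x0|x0|->] := ltgtP x 0.
- rewrite flat_le0 ?ltW//.
  apply: (@near_eq_is_derive _ _ _ (cst 0)) => //.
  near=> y; rewrite flat_le0// ltW//; near: y.
  exact: lt_nbhsl.
- have -> : flat (flat_next p) x =
      (p^`().[x^-1] * (- (x ^- 2))) * expR (- x^-1) +
      p.[x^-1] * (expR (- x^-1) * x ^- 2).
    by rewrite /flat x0 /flat_next hornerM hornerXn hornerD hornerN exprVn; ring.
  apply: (@near_eq_is_derive _ _ _
      (fun y : R => p.[y^-1] * expR (- y^-1))).
    by near=> y; rewrite /flat ifT//; near: y; exact: lt_nbhsr.
  have x1 : x != 0 by rewrite gt_eqF.
  have dV : is_derive x 1 (fun y : R => y^-1) (- x ^- 2).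
    by apply: is_derive_eq; first exact: (@is_deriveV _ id _ _ _ x1 (is_derive_id _ _)); rewrite scaler1.
  have dp := is_derive1_comp (is_derive_poly p x^-1) dV.
  have dN : is_derive x 1 (fun y : R => - y^-1) (- - x ^- 2) := is_deriveN dV.
  have de := @is_derive1_comp R expR (fun y : R => - y^-1) x _ _ (is_derive_expR _) dN.
  apply: (is_derive_eq (is_deriveM dp de)).
  by rewrite /= /GRing.scale /= opprK; ring.
- rewrite flat_le0//.
  (* For h > 0 the difference quotient at 0 is h^-1 p(h^-1) e^(-1/h), again a flat function, and the
     bound C h makes it tend to 0. *)
  have [C C0 HC] := flat_linear_bound ('X * p).
  have H : h^-1 *: (flat p (h *: 1 + 0) - flat p 0) @[h --> 0^'] --> (0 : R).
    apply/cvgr0Pnorm_le => e e0.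
    have C1 : 0 < C + 1 by rewrite ltr_wpDl.
    near=> h.
    rewrite (flat_le0 p (lexx 0)) subr0 addr0 /GRing.scale /= mulr1.
    have [h0|h0] := leP h 0; first by rewrite flat_le0// mulr0 normr0 ltW.
    have -> : h^-1 * flat p h = flat ('X * p) h.
      by rewrite /flat h0 hornerM hornerX mulrA.
    apply: le_trans (HC h h0) _.
    have hC : h <= e / (C + 1).
      apply: ltW; apply: le_lt_trans (ler_norm _) _; near: h.
      by apply: dnbhs0_lt; rewrite divr_gt0.
    apply: le_trans (ler_wpM2l C0 hC) _.
    by rewrite mulrCA ler_piMr ?ltW// ltr_pdivrMr// mul1r ltrDl.
  apply: DeriveDef; first by apply/cvg_ex; exists 0.
  exact: cvg_lim H.
Unshelve. all: by end_near. Qed.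

End flat_functions.

Section smooth_class.
Context {R : realType} {E : normedModType R}.

(** [smooth] asks for iterated directional derivatives of every order, so smoothness is proved for a
    class stable under them. Requiring 'D_v l to be independent of the point restricts [l] to affine
    maps, which keeps the chain rule inside the class. *)
Inductive flat_gen : (E -> R) -> Prop :=
| flat_gen_flat p (l m : E -> R) :
    (forall z, differentiable l z) -> (forall v z, 'D_v l z = m v) ->
    flat_gen (fun z => flat p (l z))
| flat_gen_mul f g : flat_gen f -> flat_gen g -> flat_gen (fun z => f z * g z)
| flat_gen_add f g : flat_gen f -> flat_gen g -> flat_gen (fun z => f z + g z)
| flat_gen_scale (a : R) f : flat_gen f -> flat_gen (fun z => a * f z).

Lemma flat_gen_derive f : flat_gen f ->
  (forall z, differentiable f z) /\ (forall v, flat_gen ('D_v f)).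
Proof.
elim=> {f} [p l m dl Dl|f g Sf [df Df] Sg [dg Dg]|f g _ [df Df] _ [dg Dg]|a f _ [df Df]].
- have dF y : differentiable (flat p) y.
    by apply/derivable1_diffP; case: (is_derive_flat p y).
  have dc z : differentiable (fun z => flat p (l z)) z.
    by apply: (@differentiable_comp _ _ _ _ l (flat p)).
  split=> // v.
  have -> : 'D_v (fun z => flat p (l z)) = fun z => m v * flat (flat_next p) (l z).
    apply/funext => z; rewrite deriveE//.
    rewrite (@diff_comp _ _ _ _ l (flat p))//= -(Dl v z) deriveE//.
    set h := 'd l z v.
    have {1}-> : h = h *: (1 : R^o) by rewrite /GRing.scale /= mulr1.
    rewrite linearZ -deriveE//.
    by have [_ ->] := is_derive_flat p (l z).
  by apply: flat_gen_scale; apply: flat_gen_flat Dl.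
- split=> [z|v]; first exact: differentiableM.
  have -> : 'D_v (fun z => f z * g z) = fun z => f z * 'D_v g z + g z * 'D_v f z.
    apply/funext => z; rewrite (@deriveM _ _ f g)//; exact: diff_derivable.
  by apply: flat_gen_add; apply: flat_gen_mul.
- split=> [z|v]; first exact: differentiableD.
  have -> : 'D_v (fun z => f z + g z) = fun z => 'D_v f z + 'D_v g z.
    apply/funext => z; rewrite (@deriveD _ _ _ f g)//; exact: diff_derivable.
  by apply: flat_gen_add.
- split=> [z|v]; first exact: differentiableZ.
  have -> : 'D_v (fun z => a * f z) = fun z => a * 'D_v f z.
    apply/funext => z; rewrite (@deriveZ _ _ _ f)//; exact: diff_derivable.
  by apply: flat_gen_scale.
Qed.

Lemma flat_gen_smooth f : flat_gen f -> smooth f.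
Proof.
move=> Sf vs z; suff : flat_gen (foldr (fun v f => 'D_v f) f vs).
  by move=> /flat_gen_derive[].
by elim: vs => //= v vs IH; have [_] := flat_gen_derive IH.
Qed.

End smooth_class.

Section cutoff.
Context {R : realType}.
Variable d : R.
Implicit Types (p q : {poly R}) (x : R).

(** The two polynomials are left free because differentiation changes them one at a time; the
    derivatives of the bump [cutoff 1 1] then vanish off [-d, d] and are bounded for the same reason
    as the bump itself. *)
Definition cutoff p q x : R := flat p (d + x) * flat q (d - x).

Lemma cutoff_out p q x : d <= `|x| -> cutoff p q x = 0.
Proof.
move=> dx; rewrite /cutoff; have [x0|x0] := leP 0 x.
  by rewrite [X in _ * X]flat_le0 ?mulr0// subr_le0 -(ger0_norm x0).
by rewrite flat_le0 ?mul0r// -(opprK x) subr_le0 -(ltr0_norm x0).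
Qed.

Lemma is_derive_cutoff p q x :
  is_derive x 1 (cutoff p q) (cutoff (flat_next p) q x - cutoff p (flat_next q) x).
Proof.
have d1 : is_derive x 1 (fun y : R => d + y) 1.
  by have := is_deriveD (is_derive_cst d x 1) (is_derive_id x 1); rewrite add0r.
have d2 : is_derive x 1 (fun y : R => d - y) (- 1).
  by have := is_deriveB (is_derive_cst d x 1) (is_derive_id x 1); rewrite add0r.
have := is_deriveM (is_derive1_comp (is_derive_flat p (d + x)) d1)
  (@is_derive1_comp R (flat q) (fun y : R => d - y) x _ _ (is_derive_flat q _) d2).
move=> H; apply: (is_derive_eq H); rewrite /cutoff /GRing.scale /=; ring.
Qed.

Lemma continuous_cutoff p q : continuous (cutoff p q).
Proof.
move=> x; apply: differentiable_continuous; apply/derivable1_diffP.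
by case: (is_derive_cutoff p q x).
Qed.

Lemma cutoff_bounded p q : exists2 C, 0 <= C & forall x, `|cutoff p q x| <= C.
Proof.
have [d0|d0] := leP d 0.
  by exists 0 => // x; rewrite cutoff_out ?normr0// (le_trans d0).
have dd : - d <= d by lra.
have cn : {within `[- d, d], continuous (fun x => `|cutoff p q x|)}.
  apply: continuous_subspaceT => x.
  by apply: continuous_comp; [exact: continuous_cutoff|exact: norm_continuous].
have [c _ hc] := EVT_max dd cn.
exists `|cutoff p q c| => // x; have [xd|xd] := leP d `|x|.
  by rewrite cutoff_out// normr0.
by apply: hc; rewrite in_itv/= -ler_norml ltW.
Qed.

Definition mol x : R := cutoff 1 1 x.
Definition mol1 x : R := cutoff (flat_next 1) 1 x - cutoff 1 (flat_next 1) x.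
Definition mol2 x : R :=
  cutoff (flat_next (flat_next 1)) 1 x - 2 * cutoff (flat_next 1) (flat_next 1) x
  + cutoff 1 (flat_next (flat_next 1)) x.

Lemma mol_ge0 x : 0 <= mol x.
Proof. by rewrite mulr_ge0// flat_ge0. Qed.

Lemma mol_out x : d <= `|x| -> mol x = 0.
Proof. exact: cutoff_out. Qed.
Lemma mol1_out x : d <= `|x| -> mol1 x = 0.
Proof. by move=> dx; rewrite /mol1 !cutoff_out// subrr. Qed.
Lemma mol2_out x : d <= `|x| -> mol2 x = 0.
Proof. by move=> dx; rewrite /mol2 !cutoff_out//; ring. Qed.

Lemma is_derive_mol x : is_derive x 1 mol (mol1 x).
Proof. exact: is_derive_cutoff. Qed.

Lemma is_derive_mol1 x : is_derive x 1 mol1 (mol2 x).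
Proof.
have := is_deriveB (is_derive_cutoff (flat_next 1) 1 x) (is_derive_cutoff 1 (flat_next 1) x).
by move=> H; apply: (is_derive_eq H); rewrite /mol2; ring.
Qed.

Lemma continuous_mol : continuous mol.
Proof. exact: continuous_cutoff. Qed.
Lemma continuous_mol1 : continuous mol1.
Proof. by move=> x; apply: cvgB; exact: continuous_cutoff. Qed.
Lemma continuous_mol2 : continuous mol2.
Proof.
move=> x; apply: cvgD; last exact: continuous_cutoff.
by apply: cvgB; [|apply: cvgM; [exact: cvg_cst|]]; exact: continuous_cutoff.
Qed.

Lemma mol_bounded : exists2 C, 0 <= C & forall x, `|mol x| <= C.
Proof. exact: cutoff_bounded. Qed.
Lemma mol1_bounded : exists2 C, 0 <= C & forall x, `|mol1 x| <= C.
Proof.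
have [C C0 HC] := cutoff_bounded (flat_next 1) 1.
have [D D0 HD] := cutoff_bounded 1 (flat_next 1).
exists (C + D) => [|x]; first exact: addr_ge0.
by apply: le_trans (ler_normB _ _) _; exact: lerD.
Qed.
Lemma mol2_bounded : exists2 C, 0 <= C & forall x, `|mol2 x| <= C.
Proof.
have [C C0 HC] := cutoff_bounded (flat_next (flat_next 1)) 1.
have [D D0 HD] := cutoff_bounded (flat_next 1) (flat_next 1).
have [E E0 HE] := cutoff_bounded 1 (flat_next (flat_next 1)).
exists (C + 2 * D + E) => [|x]; first by rewrite !addr_ge0// mulr_ge0.
apply: le_trans (ler_normD _ _) _; apply: lerD => //.
apply: le_trans (ler_normB _ _) _; apply: lerD => //.
by rewrite normrM ger0_norm// ler_pM2l.
Qed.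

End cutoff.

Section mol_test_functions.
Context {R : realType}.
Variable d : R.

Lemma derive_comp1 (E : normedModType R) (l : E -> R) (f f1 : R -> R) (v z : E) :
  differentiable l z -> (forall x : R, is_derive x 1 f (f1 x)) ->
  differentiable (fun z => f (l z)) z /\
  'D_v (fun z => f (l z)) z = 'D_v l z * f1 (l z).
Proof.
move=> dl df.
have dF y : differentiable f y by apply/derivable1_diffP; case: (df y).
split; first exact: (@differentiable_comp _ _ _ _ l f).
rewrite deriveE; last exact: (@differentiable_comp _ _ _ _ l f).
rewrite (@diff_comp _ _ _ _ l f)//= deriveE//.
set h := 'd l z v.
have {1}-> : h = h *: (1 : R^o) by rewrite /GRing.scale /= mulr1.
by rewrite linearZ -deriveE//; have [_ ->] := df (l z).
Qed.

Lemma differentiable_fst (z : R * R) : differentiable (fst : R * R -> R) z.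
Proof.
by apply: (@linear_differentiable R (R^o * R^o)%type R^o fst); move=> ?; exact: cvg_fst.
Qed.
Lemma differentiable_snd (z : R * R) : differentiable (snd : R * R -> R) z.
Proof.
by apply: (@linear_differentiable R (R^o * R^o)%type R^o snd); move=> ?; exact: cvg_snd.
Qed.

Lemma derive_fst (v z : R * R) : 'D_v (fst : R * R -> R) z = v.1.
Proof.
rewrite deriveE; last exact: differentiable_fst.
by rewrite (@diff_lin R (R^o * R^o)%type R^o fst)//; move=> ?; exact: cvg_fst.
Qed.
Lemma derive_snd (v z : R * R) : 'D_v (snd : R * R -> R) z = v.2.
Proof.
rewrite deriveE; last exact: differentiable_snd.
by rewrite (@diff_lin R (R^o * R^o)%type R^o snd)//; move=> ?; exact: cvg_snd.
Qed.

Lemma flat_gen_comp (E : normedModType R) (l m : E -> R) (c : R) :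
  (forall z, differentiable l z) -> (forall v z, 'D_v l z = m v) ->
  flat_gen (fun z => mol d (l z - c)).
Proof.
move=> dl Dl.
have s1 (x : R) : is_derive x 1 (fun x : R => d + (x - c)) 1.
  have := is_deriveD (is_derive_cst d x 1) (is_deriveB (is_derive_id x 1) (is_derive_cst c x 1)).
  by rewrite add0r subr0.
have s2 (x : R) : is_derive x 1 (fun x : R => d - (x - c)) (- 1).
  have := is_deriveB (is_derive_cst d x 1) (is_deriveB (is_derive_id x 1) (is_derive_cst c x 1)).
  by rewrite add0r subr0.
apply: flat_gen_mul.
- apply: (@flat_gen_flat _ _ 1 (fun z => d + (l z - c)) m) => [z|v z].
    by have [] := derive_comp1 z (dl z) s1.
  by have [_ ->] := derive_comp1 v (dl z) s1; rewrite mulr1.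
- apply: (@flat_gen_flat _ _ 1 (fun z => d - (l z - c)) (fun v => - m v)) => [z|v z].
    by have [] := derive_comp1 z (dl z) s2.
  by have [_ ->] := derive_comp1 v (dl z) s2; rewrite mulrN1 Dl.
Qed.

Lemma smooth_mol1 (c : R) : smooth (fun x : R => mol d (x - c)).
Proof.
apply: flat_gen_smooth; apply: (@flat_gen_comp _ id id) => [z|v z] //.
by rewrite derive_id.
Qed.

Lemma smooth_mol2 (y : R * R) :
  smooth (fun z : R * R => mol d (z.1 - y.1) * mol d (z.2 - y.2)).
Proof.
apply: flat_gen_smooth; apply: flat_gen_mul.
  exact: (flat_gen_comp _ differentiable_fst derive_fst).
exact: (flat_gen_comp _ differentiable_snd derive_snd).
Qed.

Lemma derive_prod (f f1 g g1 : R -> R) (y v z : R * R) :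
  (forall x : R, is_derive x 1 f (f1 x)) -> (forall x : R, is_derive x 1 g (g1 x)) ->
  'D_v (fun z : R * R => f (z.1 - y.1) * g (z.2 - y.2)) z =
  v.1 * (f1 (z.1 - y.1) * g (z.2 - y.2)) + v.2 * (f (z.1 - y.1) * g1 (z.2 - y.2)).
Proof.
move=> df dg.
have s (c x : R) : is_derive x 1 (fun x : R => x - c) 1.
  by have := is_deriveB (is_derive_id x 1) (is_derive_cst c x 1); rewrite subr0.
have [d1 D1] := derive_comp1 v (differentiable_fst z) (s y.1).
have [d2 D2] := derive_comp1 v (differentiable_snd z) (s y.2).
have [F DF] := derive_comp1 v d1 df.
have [G DG] := derive_comp1 v d2 dg.
have := @deriveM _ _ (fun z => f (z.1 - y.1)) (fun z => g (z.2 - y.2)) z v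
  (diff_derivable F) (diff_derivable G).
rewrite DF DG D1 D2 derive_fst derive_snd => ->.
by rewrite /GRing.scale /=; ring.
Qed.

End mol_test_functions.

(** * Distributional subsolutions *)

Section translation.
Context {R : realType}.
Local Notation mR := (measurableTypeR R).
Local Notation mR2 := (mR * mR)%type.

Lemma measurable_shift1 (a : R) : measurable_fun [set: mR] (fun x : mR => x + a : mR).
Proof. by apply: measurable_funD. Qed.

Lemma lebesgue_measure_shift (a : R) (A : set mR) : measurable A ->
  pushforward (@lebesgue_measure R) (fun x : mR => x + a : mR) A = @lebesgue_measure R A.
Proof.
move=> mA; apply/esym.
have := @lebesgue_measure_unique R (pushforward (@lebesgue_measure R) (fun x : mR => x + a : mR)).
move=> /(_ (measurable_shift1 a)); apply => // X [[x y] _ <-].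
transitivity (@lebesgue_measure R (`]x - a, y - a]%classic : set mR)); last first.
  congr (@lebesgue_measure R _).
  by apply/seteqP; split => z /=; rewrite !in_itv/= ltrBlDr lerBrDr.
rewrite !lebesgue_measure_itv/= !lte_fin ltrD2r; case: ifP => // _.
by rewrite -!EFinB; congr EFin; ring.
Qed.

Lemma measurable_shift2 (a : R * R) :
  measurable_fun [set: mR2] (fun z : mR2 => z + a : mR2).
Proof.
apply/measurable_fun_pair => /=.
  by apply: measurable_funD => //; exact: measurable_fst.
by apply: measurable_funD => //; exact: measurable_snd.
Qed.

Lemma lebesgue2_shift (a : R * R) (A : set mR2) : measurable A ->
  pushforward (@lebesgue2 R) (fun z : mR2 => z + a : mR2) A = @lebesgue2 R A.
Proof.
move=> mA; apply/esym.
have := @product_measure_unique _ _ _ _ R (@lebesgue_measure R) (@lebesgue_measure R) (pushforward (@lebesgue2 R) (fun z : mR2 => z + a : mR2)).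
move=> /(_ (measurable_shift2 a)); apply => // X Y mX mY.
transitivity (@lebesgue2 R (((fun x : mR => x + a.1 : mR) @^-1` X) `*`
    ((fun x : mR => x + a.2 : mR) @^-1` Y))) => //.
rewrite [LHS]product_measure1E; last 2 first.
- by rewrite -[X in measurable X]setTI; exact: measurable_shift1.
- by rewrite -[X in measurable X]setTI; exact: measurable_shift1.
by congr (_ * _)%E; exact: lebesgue_measure_shift.
Qed.

(** Needed to compare [Y] with a time shift of another solution, and to see that the kernel mass
    does not depend on the centre. Extension by zero outside [D] lets the push-forward be taken over
    the whole plane. *)
Lemma integrable_shift (a : R * R) (D : set mR2) (f : mR2 -> R) : measurable D ->
  (@lebesgue2 R).-integrable D (EFin \o f) ->
  (@lebesgue2 R).-integrable ((fun z : mR2 => z + a : mR2) @^-1` D) (EFin \o (fun z => f (z + a))) /\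
  \int[@lebesgue2 R]_(z in (fun z : mR2 => z + a : mR2) @^-1` D) f (z + a) =
  \int[@lebesgue2 R]_(z in D) f z.
Proof.
move=> mD fi.
set h := (fun z : mR2 => z + a : mR2).
have mh : measurable_fun setT h := measurable_shift2 a.
have mhD : measurable (h @^-1` D) by rewrite -[X in measurable X]setTI; exact: mh.
pose g : mR2 -> \bar R := (EFin \o f) \_ D.
have gi : (@lebesgue2 R).-integrable setT g by apply/(integrable_mkcond _ mD).
have mg : measurable_fun setT g by exact: measurable_int gi.
have ghE : g \o h = (EFin \o (fun z => f (z + a))) \_ (h @^-1` D).
  by apply/funext => z; rewrite /g /= /patch /=; congr (if _ then _ else _); apply/idP/idP; rewrite !inE.
have E (k : mR2 -> \bar R) :
    (\int[pushforward (@lebesgue2 R) h]_x k x = \int[@lebesgue2 R]_x k x)%E.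
  by apply: eq_measure_integral => A mA _; exact: lebesgue2_shift.
have ghi : (@lebesgue2 R).-integrable setT (g \o h).
  apply/integrableP; split; first exact: measurableT_comp.
  have /integrableP[_] := gi.
  have mag : measurable_fun setT (fun z => `|g z|%E) by exact: measurableT_comp.
  have := @ge0_integral_pushforward _ _ _ _ R h mh (@lebesgue2 R) setT _ measurableT mag.
  rewrite preimage_setT E => H.
  have {}H := H (fun z _ => abse_ge0 _).
  by rewrite H.
split; first by apply/(integrable_mkcond _ mhD); rewrite -ghE.
rewrite /Rintegral; congr fine.
rewrite integral_mkcond [RHS]integral_mkcond -ghE -/g.
have H := @integral_pushforward _ _ _ _ R h mh (@lebesgue2 R) setT g mg.
rewrite preimage_setT in H.
transitivity (\int[pushforward (@lebesgue2 R) h]_x g x)%E; last exact: E.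
exact/esym/(H ghi measurableT).
Qed.

End translation.

Section boxes.
Context {R : realType}.
Local Notation mR := (measurableTypeR R).
Local Notation mR2 := (mR * mR)%type.

(** Closed sup-norm boxes: compact, measurable as rectangles, and the natural supports of product
    kernels. *)
Definition cbox (z : R * R) (rho : R) : set (R * R) :=
  [set` `[z.1 - rho, z.1 + rho]] `*` [set` `[z.2 - rho, z.2 + rho]].

Lemma cboxP z rho s : cbox z rho s <-> `|s.1 - z.1| <= rho /\ `|s.2 - z.2| <= rho.
Proof.
rewrite /cbox /= /setX /mkset !in_itv /= !ler_distl; split=> [] [/andP[a b] /andP[c e]];
  by split; apply/andP.
Qed.

Lemma cbox_center z rho : 0 <= rho -> cbox z rho z.
Proof. by move=> r0; apply/cboxP; rewrite !subrr normr0. Qed.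

Lemma sub_cbox z y rho d : `|y.1 - z.1| <= rho -> `|y.2 - z.2| <= rho ->
  cbox y d `<=` cbox z (rho + d).
Proof.
move=> h1 h2 s /cboxP[s1 s2]; apply/cboxP; split.
  rewrite (_ : _ - _ = (y.1 - z.1) + (s.1 - y.1)); last by ring.
  by apply: le_trans (ler_normD _ _) _; exact: lerD.
rewrite (_ : _ - _ = (y.2 - z.2) + (s.2 - y.2)); last by ring.
by apply: le_trans (ler_normD _ _) _; exact: lerD.
Qed.

Lemma measurable_cbox z rho : measurable (cbox z rho : set mR2).
Proof. by apply: measurableX; exact: measurable_itv. Qed.

Lemma compact_cbox z rho : compact (cbox z rho).
Proof. by apply: compact_setX; exact: segment_compact. Qed.

Lemma shift_cbox z rho a :
  (fun s : R * R => s + a) @^-1` (cbox z rho) = cbox (z - a) rho.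
Proof.
apply/seteqP; split=> s /=; rewrite !cboxP /= => -[h1 h2]; split.
- by rewrite (_ : _ - _ = s.1 + a.1 - z.1)//; ring.
- by rewrite (_ : _ - _ = s.2 + a.2 - z.2)//; ring.
- by rewrite (_ : _ - _ = s.1 - (z.1 - a.1))//; ring.
- by rewrite (_ : _ - _ = s.2 - (z.2 - a.2))//; ring.
Qed.

End boxes.

Section integral_lemmas.
Context d (T : measurableType d) (R : realType) (mu : {measure set T -> \bar R}).
Implicit Types (D N : set T) (f u k : T -> R).

Lemma integrable_bounded_mul N u k (C : R) : measurable N ->
  mu.-integrable N (EFin \o u) -> measurable_fun setT k ->
  (forall z, `|k z| <= C) -> mu.-integrable N (EFin \o (fun z => u z * k z)).
Proof.
move=> mN ui mk kC.
have := @integrableMl _ _ _ mu N mN (EFin \o u) k ui.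
rewrite (_ : ((EFin \o u) \* (EFin \o k))%E = EFin \o (fun z => u z * k z)); last first.
  by apply/funext => z /=; rewrite EFinM.
apply; first exact: measurable_funTS.
exists C; split; first by rewrite num_real.
by move=> M CM z _ /=; apply: le_trans (kC z) (ltW CM).
Qed.

Lemma integrable_scale N (a : R) f : measurable N -> mu.-integrable N (EFin \o f) ->
  mu.-integrable N (EFin \o (fun z => a * f z)).
Proof. by move=> mN fi; exact: (integrableZl mN a fi). Qed.

Lemma integrable_add N f u : measurable N -> mu.-integrable N (EFin \o f) ->
  mu.-integrable N (EFin \o u) -> mu.-integrable N (EFin \o (fun z => f z + u z)).
Proof. by move=> mN fi ui; exact: (integrableD mN fi ui). Qed.

Lemma Rintegral_lin4 N (a1 a2 a3 a4 : R) f1 f2 f3 f4 : measurable N ->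
  mu.-integrable N (EFin \o f1) -> mu.-integrable N (EFin \o f2) ->
  mu.-integrable N (EFin \o f3) -> mu.-integrable N (EFin \o f4) ->
  mu.-integrable N (EFin \o (fun z => a1 * f1 z + (a2 * f2 z + (a3 * f3 z + a4 * f4 z)))) /\
  \int[mu]_(z in N) (a1 * f1 z + (a2 * f2 z + (a3 * f3 z + a4 * f4 z))) =
  a1 * (\int[mu]_(z in N) f1 z) + a2 * (\int[mu]_(z in N) f2 z) +
  a3 * (\int[mu]_(z in N) f3 z) + a4 * (\int[mu]_(z in N) f4 z).
Proof.
move=> mN i1 i2 i3 i4.
have j1 := integrable_scale a1 mN i1; have j2 := integrable_scale a2 mN i2.
have j3 := integrable_scale a3 mN i3; have j4 := integrable_scale a4 mN i4.
have j34 := integrable_add mN j3 j4; have j234 := integrable_add mN j2 j34.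
split; first exact: integrable_add.
by rewrite !RintegralD// !RintegralZl// !addrA.
Qed.

Lemma Rintegral_supp D N f : N `<=` D -> (forall z, D z -> ~ N z -> f z = 0) ->
  \int[mu]_(z in D) f z = \int[mu]_(z in N) f z.
Proof.
move=> ND f0; rewrite Rintegral_mkcond [RHS]Rintegral_mkcond.
congr Rintegral; apply/funext => z; rewrite /patch.
case: ifPn => zD; case: ifPn => zN //.
- by apply: f0; [rewrite inE in zD|rewrite notin_setE in zN].
- by move: zD; rewrite notin_setE => zD; exfalso; apply/zD/ND; rewrite inE in zN.
Qed.

Lemma Rintegral_ae_le0 D f : measurable D -> mu.-integrable D (EFin \o f) ->
  {ae mu, forall z, D z -> f z <= 0} -> \int[mu]_(z in D) f z <= 0.
Proof.
move=> mD fi f0.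
have mf : measurable_fun D f by apply/measurable_EFinP; exact: measurable_int fi.
(* Truncating at 0 turns the almost-everywhere sign into a pointwise one without changing the
   integral. *)
have mg : measurable_fun D (fun z => Num.min (f z) 0) by exact: measurable_minr.
have gi : mu.-integrable D (EFin \o (fun z => Num.min (f z) 0)).
  apply: le_integrable fi => //; first exact/measurable_EFinP.
  move=> z _ /=; rewrite lee_fin minEle; case: ifP => // _.
  by rewrite normr0.
have -> : \int[mu]_(z in D) f z = \int[mu]_(z in D) Num.min (f z) 0.
  congr fine; apply: ae_eq_integral => //; [exact/measurable_EFinP|exact/measurable_EFinP|].
  by apply: filterS f0 => z H Dz /=; rewrite min_l// H.
apply: fine_le0; rewrite -(integral0 mu D); apply: le_integral => //.
  exact: integrable0.
by move=> z _; rewrite lee_fin ge_min lexx orbT.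
Qed.

End integral_lemmas.

Section kernels.
Context {R : realType}.
Local Notation mR := (measurableTypeR R).
Local Notation mR2 := (mR * mR)%type.
Implicit Types (f g : R -> R) (y : R * R).

Lemma measurable_prod_shift f g y : continuous f -> continuous g ->
  measurable_fun [set: mR2] (fun z : mR2 => f (z.1 - y.1) * g (z.2 - y.2)).
Proof.
move=> cf cg; apply: measurable_funM.
- apply: (@measurableT_comp _ _ _ _ _ _ (fun x : mR => f (x - y.1))).
    apply: continuous_measurable_fun => x.
    by apply: (@continuous_comp _ _ _ (fun x => x - y.1) f); [by apply: cvgB; [exact: cvg_id|exact: cvg_cst]|exact: cf].
  exact: measurable_fst.
- apply: (@measurableT_comp _ _ _ _ _ _ (fun x : mR => g (x - y.2))).
    apply: continuous_measurable_fun => x.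
    by apply: (@continuous_comp _ _ _ (fun x => x - y.2) g); [by apply: cvgB; [exact: cvg_id|exact: cvg_cst]|exact: cg].
  exact: measurable_snd.
Qed.

Lemma integrable_prod_shift N (u : mR2 -> R) f g y : measurable N ->
  (@lebesgue2 R).-integrable N (EFin \o u) ->
  continuous f -> continuous g ->
  (exists2 C, 0 <= C & forall x, `|f x| <= C) ->
  (exists2 C, 0 <= C & forall x, `|g x| <= C) ->
  (@lebesgue2 R).-integrable N (EFin \o (fun z => u z * (f (z.1 - y.1) * g (z.2 - y.2)))).
Proof.
move=> mN ui cf cg [C C0 HC] [D D0 HD].
apply: (@integrable_bounded_mul _ _ _ _ _ _ _ (C * D)) => //.
  exact: measurable_prod_shift.
by move=> z; rewrite normrM ler_pM.
Qed.

(* The formal adjoint of d/dtau - (m d^2/dx^2 + c d/dx - r), applied to the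
   product mol of radius d centred at y. *)
Definition adj_mol (m c r d : R) y (z : R * R) : R :=
  - (mol d (z.1 - y.1) * mol1 d (z.2 - y.2))
  - m * (mol2 d (z.1 - y.1) * mol d (z.2 - y.2))
  + c * (mol1 d (z.1 - y.1) * mol d (z.2 - y.2))
  + r * (mol d (z.1 - y.1) * mol d (z.2 - y.2)).

Section adj_integral.
Variables (m c r d : R) (y : R * R) (N : set mR2) (u : mR2 -> R).
Hypothesis mN : measurable N.
Hypothesis ui : (@lebesgue2 R).-integrable N (EFin \o u).

Let k0 z := mol d (z.1 - y.1) * mol1 d (z.2 - y.2).
Let k2 z := mol2 d (z.1 - y.1) * mol d (z.2 - y.2).
Let k1 z := mol1 d (z.1 - y.1) * mol d (z.2 - y.2).
Let k z := mol d (z.1 - y.1) * mol d (z.2 - y.2).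

Let i0 : (@lebesgue2 R).-integrable N (EFin \o (fun z => u z * k0 z)).
Proof. by apply: integrable_prod_shift => //; [exact: continuous_mol|exact: continuous_mol1|exact: mol_bounded|exact: mol1_bounded]. Qed.
Let i1 : (@lebesgue2 R).-integrable N (EFin \o (fun z => u z * k1 z)).
Proof. by apply: integrable_prod_shift => //; [exact: continuous_mol1|exact: continuous_mol|exact: mol1_bounded|exact: mol_bounded]. Qed.
Let i2 : (@lebesgue2 R).-integrable N (EFin \o (fun z => u z * k2 z)).
Proof. by apply: integrable_prod_shift => //; [exact: continuous_mol2|exact: continuous_mol|exact: mol2_bounded|exact: mol_bounded]. Qed.
Let i3 : (@lebesgue2 R).-integrable N (EFin \o (fun z => u z * k z)).
Proof. by apply: integrable_prod_shift => //; [exact: continuous_mol|exact: continuous_mol|exact: mol_bounded|exact: mol_bounded]. Qed.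

Lemma adj_molE :
  (@lebesgue2 R).-integrable N (EFin \o (fun z => u z * adj_mol m c r d y z)) /\
  \int[@lebesgue2 R]_(z in N) (u z * adj_mol m c r d y z) =
  - (\int[@lebesgue2 R]_(z in N) (u z * k0 z))
  - m * (\int[@lebesgue2 R]_(z in N) (u z * k2 z))
  + c * (\int[@lebesgue2 R]_(z in N) (u z * k1 z))
  + r * (\int[@lebesgue2 R]_(z in N) (u z * k z)).
Proof.
have E : (fun z => u z * adj_mol m c r d y z) =
   (fun z => (-1) * (u z * k0 z) + ((- m) * (u z * k2 z) + (c * (u z * k1 z) + r * (u z * k z)))).
  by apply/funext => z; rewrite /adj_mol /k0 /k1 /k2 /k; ring.
have [H1 H2] := Rintegral_lin4 (-1) (- m) c r mN i0 i2 i1 i3.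
by rewrite E; split => //; rewrite H2; ring.
Qed.

End adj_integral.

(* Testing on translates and dilates of one product mollifier is enough. *)
Definition dist_sub (m c r : R) (N : set mR2) (u : mR2 -> R) : Prop :=
  [/\ measurable N, (@lebesgue2 R).-integrable N (EFin \o u) &
   forall d y, 0 < d -> cbox y d `<=` N ->
     \int[@lebesgue2 R]_(z in N) (u z * adj_mol m c r d y z) <= 0].

Definition dist_super (m c r : R) (N : set mR2) (u : mR2 -> R) : Prop :=
  dist_sub m c r N (fun z => - u z).

Lemma dist_subB m c r N u v : dist_sub m c r N u -> dist_super m c r N v ->
  dist_sub m c r N (fun z => u z - v z).
Proof.
move=> [mN ui Hu] [_ vi Hv]; split => //; first exact: (integrableD mN ui vi).
move=> d y d0 yN.
have -> : (fun z => (u z - v z) * adj_mol m c r d y z) =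
   (fun z => u z * adj_mol m c r d y z + - v z * adj_mol m c r d y z).
  by apply/funext => z; rewrite mulrDl.
rewrite RintegralD//; [|exact: (adj_molE _ _ _ _ _ mN ui).1|exact: (adj_molE _ _ _ _ _ mN vi).1].
by rewrite -[leRHS]addr0 lerD ?Hu ?Hv.
Qed.

End kernels.

Lemma smooth_derive (R : realType) (E : normedModType R) (phi : E -> R) (v : E) :
  smooth phi -> smooth ('D_v phi).
Proof.
move=> sphi vs z; have := sphi (rcons vs v) z.
by rewrite foldr_rcons.
Qed.

(** * Integration by parts: from weak derivatives to test inequalities *)

Section weak_to_dist.
Context {R : realType}.
Local Notation mR := (measurableTypeR R).
Local Notation mR2 := (mR * mR)%type.
Implicit Types (f g : R -> R) (y : R * R).

Lemma prod_out (d : R) f g y (z : R * R) :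
  (forall x, d <= `|x| -> f x = 0) -> (forall x, d <= `|x| -> g x = 0) ->
  ~ cbox y d z -> f (z.1 - y.1) * g (z.2 - y.2) = 0.
Proof.
move=> f0 g0; rewrite cboxP => zy.
have [z1|z1] := leP d `|z.1 - y.1|; first by rewrite f0// mul0r.
have [z2|z2] := leP d `|z.2 - y.2|; first by rewrite g0// mulr0.
by exfalso; apply: zy; split; exact: ltW.
Qed.

Lemma mol_prod_derive (d : R) y :
  [/\ 'D_(0, 1) (fun z : R * R => mol d (z.1 - y.1) * mol d (z.2 - y.2)) =
      (fun z => mol d (z.1 - y.1) * mol1 d (z.2 - y.2)),
      'D_(1, 0) (fun z : R * R => mol d (z.1 - y.1) * mol d (z.2 - y.2)) =
      (fun z => mol1 d (z.1 - y.1) * mol d (z.2 - y.2)) &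
      'D_(1, 0) (fun z : R * R => mol1 d (z.1 - y.1) * mol d (z.2 - y.2)) =
      (fun z => mol2 d (z.1 - y.1) * mol d (z.2 - y.2))].
Proof.
split; apply/funext => z.
- rewrite (derive_prod _ _ _ (@is_derive_mol R d) (@is_derive_mol R d)) /=; ring.
- rewrite (derive_prod _ _ _ (@is_derive_mol R d) (@is_derive_mol R d)) /=; ring.
- rewrite (derive_prod _ _ _ (@is_derive_mol1 R d) (@is_derive_mol R d)) /=; ring.
Qed.

(** The second kernel is needed because [uxx] is reached only through [ux]: the x-derivative is
    moved in two stages. *)
Lemma mol_test_function (Om : set (R * R)) (d : R) y : cbox y d `<=` Om ->
  test_function Om (fun z : R * R => mol d (z.1 - y.1) * mol d (z.2 - y.2)) /\
  test_function Om (fun z : R * R => mol1 d (z.1 - y.1) * mol d (z.2 - y.2)).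
Proof.
move=> yOm.
have [_ Dx _] := mol_prod_derive d y.
split; split; [exact: smooth_mol2| |rewrite -Dx; exact/smooth_derive/smooth_mol2|];
  exists (cbox y d); split => //; try exact: compact_cbox.
- by move=> z; apply: prod_out; exact: mol_out.
- by move=> z; apply: prod_out; [exact: mol1_out|exact: mol_out].
Qed.

Section weak.
Variables (Om N : set mR2) (u ux uxx ut : mR2 -> R) (m c r : R).
Hypotheses (wx : weak_derivative2 (1, 0) Om u ux)
  (wxx : weak_derivative2 (1, 0) Om ux uxx) (wt : weak_derivative2 (0, 1) Om u ut).
Hypotheses (cN : compact N) (mN : measurable N) (NOm : N `<=` Om).

Let F z := ut z - (m * uxx z + c * ux z - r * u z).

(** Integration by parts once in time, once in x for the drift and twice in x for the diffusion,
    where [u] against [mol2] passes through [ux] against [mol1]. The support of the kernel lets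
    integrals over [Om] be replaced by integrals over [N]. *)
Lemma weak_adjoint (d : R) y : cbox y d `<=` N ->
  let k z := mol d (z.1 - y.1) * mol d (z.2 - y.2) in
  (@lebesgue2 R).-integrable N (EFin \o (fun z => F z * k z)) /\
  \int[@lebesgue2 R]_(z in N) (u z * adj_mol m c r d y z) =
  \int[@lebesgue2 R]_(z in N) (F z * k z).
Proof.
move=> yN k.
have [li lix Wx] := wx; have [_ lixx Wxx] := wxx; have [_ lit Wt] := wt.
have ui := li N cN NOm; have uxi := lix N cN NOm.
have uxxi := lixx N cN NOm; have uti := lit N cN NOm.
have [tk tk1] := @mol_test_function Om d y (subset_trans yN NOm).
have ik (v : mR2 -> R) : (@lebesgue2 R).-integrable N (EFin \o v) ->
    (@lebesgue2 R).-integrable N (EFin \o (fun z => v z * k z)).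
  by move=> vi; apply: integrable_prod_shift => //; [exact: continuous_mol|exact: continuous_mol|exact: mol_bounded|exact: mol_bounded].
have toN (v : mR2 -> R) f g : (forall x, d <= `|x| -> f x = 0) -> (forall x, d <= `|x| -> g x = 0) ->
    \int[@lebesgue2 R]_(z in Om) (v z * (f (z.1 - y.1) * g (z.2 - y.2))) =
    \int[@lebesgue2 R]_(z in N) (v z * (f (z.1 - y.1) * g (z.2 - y.2))).
  move=> f0 g0; apply: Rintegral_supp => // z _ zN.
  by rewrite (prod_out f0 g0) ?mulr0//; apply: contra_not zN; exact: yN.
have m0 := @mol_out R d; have m1 := @mol1_out R d; have m2 := @mol2_out R d.
have [Dt Dx Dxx] := mol_prod_derive d y.
have chg (v f g : mR2 -> R) : f = g ->
    \int[@lebesgue2 R]_(z in Om) (v z * f z) = \int[@lebesgue2 R]_(z in Om) (v z * g z).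
  by move=> ->.
have := Wt _ tk; rewrite (chg _ _ _ Dt) (toN _ _ _ m0 m1) (toN _ _ _ m0 m0) => Et.
have := Wx _ tk; rewrite (chg _ _ _ Dx) (toN _ _ _ m1 m0) (toN _ _ _ m0 m0) => Ex.
have := Wx _ tk1; rewrite (chg _ _ _ Dxx) (toN _ _ _ m2 m0) (toN _ _ _ m1 m0) => Ex1.
have := Wxx _ tk; rewrite (chg _ _ _ Dx) (toN _ _ _ m1 m0) (toN _ _ _ m0 m0) => Exx.
have [H1 H2] := Rintegral_lin4 1 (- m) (- c) r mN (ik _ uti) (ik _ uxxi) (ik _ uxi) (ik _ ui).
have E : (fun z => F z * k z) = (fun z => 1 * (ut z * k z) +
    (- m * (uxx z * k z) + (- c * (ux z * k z) + r * (u z * k z)))).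
  by apply/funext => z; rewrite /F; ring.
rewrite E; split => //; rewrite H2 (adj_molE _ _ _ _ _ mN ui).2 Et Ex Ex1 Exx /k.
by ring.
Qed.

Lemma mol_prod_ge0 (d : R) y (z : R * R) : 0 <= mol d (z.1 - y.1) * mol d (z.2 - y.2).
Proof. by rewrite mulr_ge0// mol_ge0. Qed.

Lemma weak_dist_sub : {ae @lebesgue2 R, forall z, N z -> F z <= 0} ->
  dist_sub m c r N u.
Proof.
move=> F0; have [li _ _] := wx; split => //; first exact: li.
move=> d y d0 yN; have [Fi ->] := weak_adjoint yN.
apply: Rintegral_ae_le0 => //; apply: filterS F0 => z H Nz.
by rewrite mulr_le0_ge0 ?H// mol_prod_ge0.
Qed.

Lemma weak_dist_super : {ae @lebesgue2 R, forall z, N z -> 0 <= F z} ->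
  dist_super m c r N u.
Proof.
move=> F0; have [li _ _] := wx; have ui := li N cN NOm.
have iN (v : mR2 -> R) : (fun z => - v z) = (fun z => (-1) * v z).
  by apply/funext => z; rewrite mulN1r.
split => //; first by rewrite iN; exact: integrable_scale.
move=> d y d0 yN; have [Fi E] := weak_adjoint yN.
have -> : (fun z => - u z * adj_mol m c r d y z) = (fun z => (-1) * (u z * adj_mol m c r d y z)).
  by apply/funext => z; ring.
rewrite RintegralZl//; last exact: (adj_molE _ _ _ _ _ mN ui).1.
rewrite E -RintegralZl//.
apply: Rintegral_ae_le0 => //; first exact: integrable_scale.
apply: filterS F0 => z H Nz.
by rewrite mulN1r oppr_le0 mulr_ge0 ?H// mol_prod_ge0.
Qed.

End weak.

Lemma adj_mol_shift (m c r d : R) y (a z : R * R) :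
  adj_mol m c r d (y + a) (z + a) = adj_mol m c r d y z.
Proof.
rewrite /adj_mol /=.
have -> : z.1 + a.1 - (y.1 + a.1) = z.1 - y.1 by ring.
by have -> : z.2 + a.2 - (y.2 + a.2) = z.2 - y.2 by ring.
Qed.

(** The coefficients are constant, so shifting the function and the kernel together leaves the test
    inequality unchanged. *)
Lemma dist_sub_shift (m c r : R) (N : set mR2) (u : mR2 -> R) (a : R * R) :
  dist_sub m c r N u ->
  dist_sub m c r ((fun z : mR2 => z + a : mR2) @^-1` N) (fun z => u (z + a)).
Proof.
move=> [mN ui Hu]; have [ui' _] := integrable_shift a mN ui; split => //.
  by rewrite -[X in measurable X]setTI; exact: measurable_shift2.
move=> d y d0 yN.
have [_] := integrable_shift a mN (adj_molE m c r d (y + a) mN ui).1.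
under eq_Rintegral do rewrite adj_mol_shift.
move=> ->; apply: Hu => // z yz.
have := yN (z - a); rewrite /= subrK; apply.
move: yz; rewrite !cboxP /= => -[h1 h2]; split.
  by rewrite (_ : _ - _ = z.1 - (y.1 + a.1))//; ring.
by rewrite (_ : _ - _ = z.2 - (y.2 + a.2))//; ring.
Qed.

End weak_to_dist.

(** * From distributional to viscosity subsolutions *)

Section calculus.
Context {R : realType}.

Lemma lipschitz_of_derive (f f1 : R -> R) (C : R) :
  (forall x : R, is_derive x 1 f (f1 x)) -> (forall x, `|f1 x| <= C) ->
  forall a b, `|f a - f b| <= C * `|a - b|.
Proof.
move=> df fC.
have cf : continuous f.
  by move=> x; apply/differentiable_continuous/derivable1_diffP; case: (df x).
have H a b : a <= b -> `|f a - f b| <= C * `|a - b|.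
  move=> ab; have [c _ E] := @MVT_segment R f f1 a b ab (fun x _ => df x) (continuous_subspaceT cf).
  by rewrite distrC E normrM distrC; exact: ler_wpM2r.
move=> a b; have [ab|/ltW ab] := leP a b; first exact: H.
by rewrite distrC (distrC a); exact: H.
Qed.

Lemma first_derivative_test (f f1 : R -> R) (a e : R) : 0 < e ->
  (forall x : R, is_derive x 1 f (f1 x)) ->
  (forall x, `|x - a| < e -> f x <= f a) -> f1 a = 0.
Proof.
move=> e0 df fa.
have := @derive1_at_max R f (a - e) (a + e) a.
have ae : a - e <= a + e by lra.
move=> /(_ ae (fun t _ => @ex_derive _ _ _ _ _ _ _ (df t))) H.
have [_ <-] := df a.
have /H [|_ ->//] : a \in `]a - e, a + e[ by rewrite in_itv /=; apply/andP; split; lra.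
move=> t; rewrite in_itv /= => /andP[t1 t2]; apply: fa.
by rewrite ltr_norml; apply/andP; split; lra.
Qed.

(** A positive second derivative at a critical point makes [f1] positive just to its right, and the
    mean value theorem then produces a larger value of [f]. *)
Lemma second_derivative_test (f f1 : R -> R) (a e f2 : R) : 0 < e ->
  (forall x : R, is_derive x 1 f (f1 x)) -> is_derive a 1 f1 f2 ->
  (forall x, `|x - a| < e -> f x <= f a) -> f2 <= 0.
Proof.
move=> e0 df df1 fa; have f1a := first_derivative_test e0 df fa.
rewrite leNgt; apply/negP => f20.
have [dv Ev] := df1.
have cv : h^-1 *: (f1 (h + a) - f1 a) @[h --> 0^'] --> f2.
  have := dv; rewrite /derivable => /cvg_ex[l Hl].
  have El : l = f2 by rewrite -Ev; apply/esym/cvg_lim.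
  by move: Hl; rewrite El; under eq_fun do rewrite [_ *: 1]mulr1.
have /cvgr_gt /(_ _ f20) := cv.
move=> -[d /= d0 Hd].
pose h := Num.min (d / 2) (e / 2).
have h0 : 0 < h by rewrite lt_min !divr_gt0.
have hd : h < d by rewrite gt_min; apply/orP; left; lra.
have he : h < e by rewrite gt_min; apply/orP; right; lra.
have cf : continuous f.
  by move=> x; apply/differentiable_continuous/derivable1_diffP; case: (df x).
have ah : a < a + h by rewrite ltrDl.
have [c] := @MVT R f f1 a (a + h) ah (fun x _ => df x) (continuous_subspaceT cf).
rewrite in_itv /= => /andP[ac cah] E.
have f1c : 0 < f1 c.
  have := Hd (c - a); rewrite /ball_ /= sub0r normrN gtr0_norm ?subr_gt0// => H.
  have {H} := H _ _; rewrite subrK f1a subr0 /GRing.scale /= => H.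
  have : 0 < (c - a)^-1 * f1 c.
    by apply: H; [lra|rewrite subr_eq0 gt_eqF].
  by rewrite pmulr_rgt0// invr_gt0 subr_gt0.
have : f (a + h) <= f a by apply: fa; rewrite addrC addKr gtr0_norm.
by rewrite -subr_le0 E addrC addKr leNgt mulr_gt0.
Qed.

End calculus.

(** * Mollified functions and their derivatives *)

Section convolution.
Context {R : realType}.
Local Notation mR := (measurableTypeR R).
Local Notation mR2 := (mR * mR)%type.
Variables (N : set mR2) (w : mR2 -> R).
Hypotheses (mN : measurable N) (wi : (@lebesgue2 R).-integrable N (EFin \o w)).

(** Differentiation under the integral sign, with majorant [C * |w s|]. *)
Lemma is_derive_kernel (k k1 : R -> mR2 -> R) (C : R) (a : R) :
  (forall x, measurable_fun setT (k x)) ->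
  (forall x s, `|k x s| <= C) -> (forall x s, `|k1 x s| <= C) ->
  (forall (x : R) s, is_derive x 1 (k ^~ s) (k1 x s)) ->
  is_derive a 1 (fun x => \int[@lebesgue2 R]_(s in N) (w s * k x s))
    (\int[@lebesgue2 R]_(s in N) (w s * k1 a s)).
Proof.
move=> mk kC k1C dk.
have C0 : 0 <= C by apply: le_trans (kC 0 (0, 0)).
have ik x : (@lebesgue2 R).-integrable N (EFin \o (fun s => w s * k x s)).
  exact: integrable_bounded_mul.
have dwk (x : R) s : is_derive x 1 (fun x => w s * k x s) (w s * k1 x s).
  exact: (is_deriveZ (w s) (dk x s)).
have aI : `]a - 1, a + 1[%classic a by rewrite /= in_itv /=; apply/andP; split; lra.
have dE (x : R) s : partial1of2 (fun x s => w s * k x s) x s = w s * k1 x s.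
  by rewrite partial1of2E; have [_] := dwk x s.
have iG : (@lebesgue2 R).-integrable N (EFin \o (fun s => C * `|w s|)).
  by apply: integrable_scale => //; exact: integrable_norm.
have G0 s : 0 <= C * `|w s| by rewrite mulr_ge0.
have dG x s : `]a - 1, a + 1[%classic x -> N s ->
    `|partial1of2 (fun x s => w s * k x s) x s| <= C * `|w s|.
  by move=> _ _; rewrite dE normrM mulrC ler_wpM2r.
have H := @cvg_differentiation_under_integral R _ mR2 (@lebesgue2 R)
  (fun x s => w s * k x s) N mN a (a - 1) (a + 1) aI (fun x _ => ik x)
  (fun x s _ _ => @ex_derive _ _ _ _ _ _ _ (dwk x s)) _ G0 iG dG.
have HE : \int[@lebesgue2 R]_(y in N) partial1of2 (fun x s => w s * k x s) a y =
    \int[@lebesgue2 R]_(s in N) (w s * k1 a s).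
  by apply: eq_Rintegral => s _; rewrite dE.
rewrite HE in H.
apply: DeriveDef.
  apply/cvg_ex; eexists; under eq_fun do rewrite [_ *: 1]mulr1.
  exact: H.
rewrite /derive; apply: cvg_lim => //.
by under eq_fun do rewrite [_ *: 1]mulr1.
Qed.

(** The kernel is evaluated at s - y rather than y - s: each derivative in y costs a sign, which
    matches the signs of the formal adjoint in [adj_mol]. *)
Definition mconv (f g : R -> R) (y : R * R) : R :=
  \int[@lebesgue2 R]_(s in N) (w s * (f (s.1 - y.1) * g (s.2 - y.2))).

Variables (f f1 g g1 : R -> R).
Hypotheses (df : forall x : R, is_derive x 1 f (f1 x)) (dg : forall x : R, is_derive x 1 g (g1 x)).
Variable (C : R).
Hypotheses (fC : forall x, `|f x| <= C) (f1C : forall x, `|f1 x| <= C).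
Hypotheses (gC : forall x, `|g x| <= C) (g1C : forall x, `|g1 x| <= C).

Let cf : continuous f.
Proof. by move=> x; apply/differentiable_continuous/derivable1_diffP; case: (df x). Qed.
Let cg : continuous g.
Proof. by move=> x; apply/differentiable_continuous/derivable1_diffP; case: (dg x). Qed.
Let C0 : 0 <= C. Proof. exact: le_trans (fC 0). Qed.

Lemma is_derive_reflect (h h1 : R -> R) (s x : R) :
  (forall x : R, is_derive x 1 h (h1 x)) -> is_derive x 1 (fun x => h (s - x)) (- h1 (s - x)).
Proof.
move=> dh; have d1 : is_derive x 1 (fun x : R => s - x) (- 1).
  by have := is_deriveB (is_derive_cst s x 1) (is_derive_id x 1); rewrite add0r.
by have := @is_derive1_comp R h (fun x : R => s - x) x _ _ (dh _) d1; rewrite mulrN1.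
Qed.

Hypotheses (cf1 : continuous f1) (cg1 : continuous g1).

Lemma integrable_conv (a b : R -> R) (y : R * R) : continuous a -> continuous b ->
  (forall x, `|a x| <= C) -> (forall x, `|b x| <= C) ->
  (@lebesgue2 R).-integrable N (EFin \o (fun s => w s * (a (s.1 - y.1) * b (s.2 - y.2)))).
Proof. by move=> ca cb aC bC; apply: integrable_prod_shift => //; exists C. Qed.

Lemma is_derive_conv1 (y : R * R) (x : R) :
  is_derive x 1 (fun x => mconv f g (x, y.2)) (- mconv f1 g (x, y.2)).
Proof.
have -> : - mconv f1 g (x, y.2) =
   \int[@lebesgue2 R]_(s in N) (w s * (- f1 (s.1 - x) * g (s.2 - y.2))).
  rewrite -mulN1r -RintegralZl//; last exact: integrable_conv.
  by apply: eq_Rintegral => s _ /=; ring.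
apply: (@is_derive_kernel (fun x s => f (s.1 - x) * g (s.2 - y.2))
   (fun x s => - f1 (s.1 - x) * g (s.2 - y.2)) (C * C)).
- by move=> z; exact: (measurable_prod_shift (z, y.2) cf cg).
- by move=> z s; rewrite normrM ler_pM.
- by move=> z s; rewrite normrM normrN ler_pM.
- move=> z s; have := is_deriveM (is_derive_reflect s.1 z df) (is_derive_cst (g (s.2 - y.2)) z 1).
  by move=> K; apply: (is_derive_eq K); rewrite /GRing.scale /= mulr0 add0r mulrC.
Qed.

Lemma is_derive_conv2 (y : R * R) (x : R) :
  is_derive x 1 (fun x => mconv f g (y.1, x)) (- mconv f g1 (y.1, x)).
Proof.
have -> : - mconv f g1 (y.1, x) =
   \int[@lebesgue2 R]_(s in N) (w s * (f (s.1 - y.1) * - g1 (s.2 - x))).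
  rewrite -mulN1r -RintegralZl//; last exact: integrable_conv.
  by apply: eq_Rintegral => s _ /=; ring.
apply: (@is_derive_kernel (fun x s => f (s.1 - y.1) * g (s.2 - x))
   (fun x s => f (s.1 - y.1) * - g1 (s.2 - x)) (C * C)).
- by move=> z; exact: (measurable_prod_shift (y.1, z) cf cg).
- by move=> z s; rewrite normrM ler_pM.
- by move=> z s; rewrite normrM normrN ler_pM.
- move=> z s; have := is_deriveM (is_derive_cst (f (s.1 - y.1)) z 1) (is_derive_reflect s.2 z dg).
  by move=> K; apply: (is_derive_eq K); rewrite /GRing.scale /= mulr0 addr0.
Qed.

(** Serves the continuity of the mollified function at a fixed radius, so that a maximum over a
    compact box is attained. *)
Lemma conv_lipschitz (y z : R * R) :
  `|mconv f g y - mconv f g z| <=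
  C * C * (`|y.1 - z.1| + `|y.2 - z.2|) * \int[@lebesgue2 R]_(s in N) `|w s|.
Proof.
rewrite /mconv -RintegralB//; [|exact: integrable_conv..].
have iD := integrableB mN (integrable_conv y cf cg fC gC) (integrable_conv z cf cg fC gC).
have iw := integrable_norm wi.
apply: le_trans (le_normr_Rintegral mN iD) _.
rewrite -RintegralZl//.
apply: le_Rintegral => //; first exact: integrable_norm.
  exact: integrable_scale.
move=> s _ /=; rewrite -mulrBr normrM mulrC ler_wpM2r//.
have -> : f (s.1 - y.1) * g (s.2 - y.2) - f (s.1 - z.1) * g (s.2 - z.2) =
  (f (s.1 - y.1) - f (s.1 - z.1)) * g (s.2 - y.2)
  + f (s.1 - z.1) * (g (s.2 - y.2) - g (s.2 - z.2)) by ring.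
apply: le_trans (ler_normD _ _) _; rewrite !normrM mulrDr; apply: lerD.
  rewrite mulrAC; apply: ler_pM => //.
  apply: le_trans (lipschitz_of_derive df f1C _ _) _.
  by rewrite (_ : _ - _ = - (y.1 - z.1)) ?normrN//; ring.
rewrite -mulrA; apply: ler_pM => //.
apply: le_trans (lipschitz_of_derive dg g1C _ _) _.
by rewrite (_ : _ - _ = - (y.2 - z.2)) ?normrN//; ring.
Qed.

Lemma continuous_conv : continuous (mconv f g : R * R -> R).
Proof.
move=> y; set L := C * C * \int[@lebesgue2 R]_(s in N) `|w s|.
have L0 : 0 <= L by rewrite !mulr_ge0// Rintegral_ge0.
apply/cvgrPdist_le => e e0.
have d0 : 0 < e / (2 * (L + 1)) by rewrite divr_gt0// mulr_gt0// ltr_wpDl.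
near=> z.
apply: le_trans (conv_lipschitz y z) _.
have z1 : `|y.1 - z.1| <= e / (2 * (L + 1)).
  near: z; apply: (@cvgr_dist_le _ _ _ _ _ (fun z : R * R => z.1)) => //.
  exact: cvg_fst.
have z2 : `|y.2 - z.2| <= e / (2 * (L + 1)).
  near: z; apply: (@cvgr_dist_le _ _ _ _ _ (fun z : R * R => z.2)) => //.
  exact: cvg_snd.
rewrite mulrAC -/L; apply: le_trans (ler_wpM2l L0 (lerD z1 z2)) _.
rewrite (_ : _ + _ = e / (L + 1)); last by field; rewrite gt_eqF// ltr_wpDl.
by rewrite mulrCA ler_piMr ?ltW// ltr_pdivrMr ?mul1r ?ltrDl// ltr_wpDl.
Unshelve. all: by end_near. Qed.

End convolution.

Section mollification.
Context {R : realType}.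
Local Notation mR := (measurableTypeR R).
Local Notation mR2 := (mR * mR)%type.
Variables (N : set mR2) (w : mR2 -> R) (d : R).
Hypotheses (mN : measurable N) (wi : (@lebesgue2 R).-integrable N (EFin \o w)).

Lemma mol_bounds : exists2 C, 0 <= C &
  forall x : R, [/\ `|mol d x| <= C, `|mol1 d x| <= C & `|mol2 d x| <= C].
Proof.
have [A A0 HA] := mol_bounded d; have [B B0 HB] := mol1_bounded d.
have [D D0 HD] := mol2_bounded d.
exists (A + B + D) => [|x]; first by rewrite !addr_ge0.
split; [apply: le_trans (HA x) _|apply: le_trans (HB x) _|apply: le_trans (HD x) _]; lra.
Qed.

Lemma conv_mol_derive (y : R * R) :
  [/\ forall x : R, is_derive x 1 (fun x => mconv N w (mol d) (mol d) (x, y.2))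
        (- mconv N w (mol1 d) (mol d) (x, y.2)),
      forall x : R, is_derive x 1 (fun x => - mconv N w (mol1 d) (mol d) (x, y.2))
        (mconv N w (mol2 d) (mol d) (x, y.2)) &
      forall t : R, is_derive t 1 (fun t => mconv N w (mol d) (mol d) (y.1, t))
        (- mconv N w (mol d) (mol1 d) (y.1, t))].
Proof.
have [C C0 HC] := mol_bounds.
have b0 x : `|mol d x| <= C by have [] := HC x.
have b1 x : `|mol1 d x| <= C by have [] := HC x.
have b2 x : `|mol2 d x| <= C by have [] := HC x.
have d0 := @is_derive_mol R d; have d1 := @is_derive_mol1 R d.
have c1 := @continuous_mol1 R d; have c2 := @continuous_mol2 R d.
split=> x.
- exact: (is_derive_conv1 mN wi d0 d0 b0 b1 b0 c1 y x).
- have := is_deriveN (is_derive_conv1 mN wi d1 d0 b1 b2 b0 c2 y x).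
  by rewrite opprK.
- exact: (is_derive_conv2 mN wi d0 d0 b0 b0 b1 c1 y x).
Qed.

(** By [conv_mol_derive] the right-hand side is d/dtau - (m d^2/dx^2 + c d/dx - r) applied to the
    mollified function at [y]: testing [w] at the centre [y] is a pointwise inequality for a smooth
    function. *)
Lemma adj_mol_conv (m c r : R) (y : R * R) :
  \int[@lebesgue2 R]_(z in N) (w z * adj_mol m c r d y z) =
  - mconv N w (mol d) (mol1 d) y - m * mconv N w (mol2 d) (mol d) y
  + c * mconv N w (mol1 d) (mol d) y + r * mconv N w (mol d) (mol d) y.
Proof. exact: (adj_molE m c r d y mN wi).2. Qed.

Lemma continuous_conv_mol : continuous (mconv N w (mol d) (mol d) : R * R -> R).
Proof.
have [C C0 HC] := mol_bounds.
have b0 x : `|mol d x| <= C by have [] := HC x.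
have b1 x : `|mol1 d x| <= C by have [] := HC x.
have d0 := @is_derive_mol R d.
exact: (continuous_conv mN wi d0 d0 b0 b1 b0 b1).
Qed.

End mollification.

Section mass.
Context {R : realType}.
Local Notation mR := (measurableTypeR R).
Local Notation mR2 := (mR * mR)%type.

(** The mollifier is not normalised; its total mass is carried as a positive factor and divided out
    at the end. *)
Definition mass (d : R) : R := mconv (cbox (0, 0) d) (cst 1) (mol d) (mol d) (0, 0).

Lemma lebesgue2_cbox (z : R * R) (d : R) : 0 < d ->
  @lebesgue2 R (cbox z d) = ((2 * d) * (2 * d))%:E.
Proof.
move=> d0; rewrite [LHS]product_measure1E; try exact: measurable_itv.
have E (a : R) : @lebesgue_measure R `[a - d, a + d]%classic = (2 * d)%:E.
  rewrite lebesgue_measure_itv /= lte_fin ltrD2l gtrN// -EFinB; congr (_%:E); ring.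
by rewrite EFinM; congr (_ * _)%E; exact: E.
Qed.

Lemma integrable_cst_cbox (z : R * R) (d a : R) : 0 < d ->
  (@lebesgue2 R).-integrable (cbox z d) (EFin \o cst a).
Proof.
move=> d0; apply: measurable_bounded_integrable; first exact: measurable_cbox.
- by rewrite [X in (X < _)%E](lebesgue2_cbox z d0) ltry.
- exact: measurable_cst.
- by exists `|a|; split => // M aM s _; exact: ltW.
Qed.

Lemma mass_eq (N : set mR2) (d : R) (y : R * R) : measurable N -> 0 < d ->
  cbox y d `<=` N -> mconv N (cst 1) (mol d) (mol d) y = mass d.
Proof.
move=> mN d0 yN; rewrite /mass /mconv.
have out (u z : R * R) : ~ cbox u d z -> cst 1 z * (mol d (z.1 - u.1) * mol d (z.2 - u.2)) = 0.
  by move=> h; rewrite (prod_out _ _ h) ?mulr0//; exact: mol_out.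
rewrite (@Rintegral_supp _ _ _ _ N (cbox y d)) => //; last by move=> z _; exact: out.
have i0 : (@lebesgue2 R).-integrable (cbox y d)
    (EFin \o (fun z => cst 1 z * (mol d (z.1 - y.1) * mol d (z.2 - y.2)))).
  apply: integrable_prod_shift; [exact: measurable_cbox|exact: integrable_cst_cbox|..];
  by [exact: continuous_mol|exact: mol_bounded].
have [_] := integrable_shift y (measurable_cbox y d) i0.
rewrite [X in \int[_]_(_ in X) _](_ : _ = cbox (0, 0) d); last first.
  by rewrite [LHS](shift_cbox y d y) subrr.
move=> <-; apply: eq_Rintegral => z _ /=.
by rewrite !addrK !subr0.
Qed.

(** On the box of half the radius both d + x and d - x are at least d/2, so the kernel is bounded
    below there by a positive constant. *)
Lemma mass_gt0 (d : R) : 0 < d -> 0 < mass d.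
Proof.
move=> d0; pose h := d / 2.
have h0 : 0 < h by rewrite divr_gt0.
have hd : cbox (0, 0) h `<=` cbox (0, 0) d.
  move=> z /cboxP[h1 h2]; apply/cboxP; split; [apply: le_trans h1 _|apply: le_trans h2 _]; rewrite /h; lra.
set kap := flat 1 h * flat 1 h.
have kap0 : 0 < kap by rewrite mulr_gt0// flat_gt0.
have flat_mono (a b : R) : 0 < a -> a <= b -> flat 1 a <= flat 1 b.
  move=> a0 ab; have b0 := lt_le_trans a0 ab.
  by rewrite /flat a0 b0 !hornerC !mul1r ler_expR lerN2 lef_pV2.
have ge (x : R) : `|x| <= h -> kap <= mol d x.
  move=> xh; have [x1 x2] : h <= d + x /\ h <= d - x.
    by move: xh; rewrite ler_norml /h => /andP[? ?]; split; lra.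
  by apply: ler_pM; rewrite ?flat_ge0//; exact: flat_mono.
pose k (z : mR2) : R := cst 1 z * (mol d (z.1 - 0) * mol d (z.2 - 0)).
have k0 z : 0 <= k z by rewrite /k mul1r mulr_ge0// mol_ge0.
have ik : (@lebesgue2 R).-integrable (cbox (0, 0) d) (EFin \o k).
  apply: (integrable_prod_shift (0, 0)); [exact: measurable_cbox|exact: integrable_cst_cbox|..];
  by [exact: continuous_mol|exact: mol_bounded].
have mk : measurable_fun (cbox (0, 0) d : set mR2) (EFin \o k) := measurable_int _ ik.
have mh := @measurable_cbox R (0, 0) h.
have mkh : measurable_fun (cbox (0, 0) h : set mR2) (EFin \o k).
  exact: measurable_funS (measurable_cbox _ _) hd mk.
have L : ((kap * kap)%:E * @lebesgue2 R (cbox (0%R, 0%R) h) <=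
    \int[@lebesgue2 R]_(z in cbox (0%R, 0%R) d) (k z)%:E)%E.
  rewrite -(integral_cst (@lebesgue2 R) mh).
  apply: (@le_trans _ _ (\int[@lebesgue2 R]_(z in cbox (0%R, 0%R) h) (k z)%:E)%E).
    apply: ge0_le_integral => //.
    - by move=> z _; rewrite lee_fin mulr_ge0// ltW.
    - move=> z /cboxP[]; rewrite !subr0 => z1 z2.
      by rewrite lee_fin /k mul1r !subr0 ler_pM ?ge// ltW.
  apply: ge0_subset_integral => //; first exact: measurable_cbox.
  by move=> z _; rewrite lee_fin.
apply: fine_gt0; apply/andP; split.
  apply: lt_le_trans L; rewrite (lebesgue2_cbox _ h0) -EFinM lte_fin.
  have h2 : 0 < 2 * h by rewrite mulr_gt0.
  by rewrite mulr_gt0// mulr_gt0.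
have := integrable_fin_num (measurable_cbox _ _) ik.
by rewrite ge0_fin_numE => //; apply: integral_ge0 => z _; rewrite lee_fin.
Qed.

End mass.

(** * Touching polynomials for distributional subsolutions *)

Section viscosity.
Context {R : realType}.
Local Notation mR := (measurableTypeR R).
Local Notation mR2 := (mR * mR)%type.

Lemma conv_le (N : set mR2) (w : mR2 -> R) (d A : R) (y : R * R) :
  measurable N -> (@lebesgue2 R).-integrable N (EFin \o w) ->
  (@lebesgue2 R).-integrable N (EFin \o cst 1) -> 0 < d ->
  cbox y d `<=` N -> (forall s, cbox y d s -> w s <= A) ->
  mconv N w (mol d) (mol d) y <= A * mass d.
Proof.
move=> mN wi i1 d0 yN wA.
have ik (v : mR2 -> R) : (@lebesgue2 R).-integrable N (EFin \o v) ->
    (@lebesgue2 R).-integrable N (EFin \o (fun z => v z * (mol d (z.1 - y.1) * mol d (z.2 - y.2)))).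
  by move=> vi; apply: integrable_prod_shift => //; by [exact: continuous_mol|exact: mol_bounded].
rewrite -(mass_eq mN d0 yN) /mconv -RintegralZl//; last exact: ik.
apply: le_Rintegral => //; [exact: ik|apply: integrable_scale => //; exact: ik|].
move=> s _; have [sy|sy] := pselect (cbox y d s).
  by rewrite mul1r ler_wpM2r ?wA// mol_prod_ge0.
by rewrite (prod_out _ _ sy) ?mulr0//; exact: mol_out.
Qed.

Lemma conv_ge (N : set mR2) (w : mR2 -> R) (d A : R) (y : R * R) :
  measurable N -> (@lebesgue2 R).-integrable N (EFin \o w) ->
  (@lebesgue2 R).-integrable N (EFin \o cst 1) -> 0 < d ->
  cbox y d `<=` N -> (forall s, cbox y d s -> A <= w s) ->
  A * mass d <= mconv N w (mol d) (mol d) y.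
Proof.
move=> mN wi i1 d0 yN wA.
have ik (v : mR2 -> R) : (@lebesgue2 R).-integrable N (EFin \o v) ->
    (@lebesgue2 R).-integrable N (EFin \o (fun z => v z * (mol d (z.1 - y.1) * mol d (z.2 - y.2)))).
  by move=> vi; apply: integrable_prod_shift => //; by [exact: continuous_mol|exact: mol_bounded].
rewrite -(mass_eq mN d0 yN) /mconv -RintegralZl//; last exact: ik.
apply: le_Rintegral => //; [apply: integrable_scale => //; exact: ik|exact: ik|].
move=> s _; have [sy|sy] := pselect (cbox y d s).
  by rewrite mul1r ler_wpM2r ?wA// mol_prod_ge0.
by rewrite (prod_out _ _ sy) ?mulr0//; exact: mol_out.
Qed.

Lemma is_derive_quadratic (k p q a x : R) :
  is_derive x 1 (fun x => k + p * (x - a) + q * (x - a) ^+ 2) (p + 2 * q * (x - a)).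
Proof.
have d1 : is_derive x 1 (fun x : R => x - a) 1.
  by have := is_deriveB (is_derive_id x 1) (is_derive_cst a x 1); rewrite subr0.
have := is_deriveD (is_deriveD (is_derive_cst k x 1) (is_deriveZ p d1)) (is_deriveZ q (is_deriveX 2 d1)).
by move=> H; apply: (is_derive_eq H); rewrite /GRing.scale /=; ring.
Qed.

Lemma abs_mulr_le (a x e : R) : `|x| <= e -> - (`|a| * e) <= a * x <= `|a| * e.
Proof. by move=> xe; rewrite -ler_norml normrM ler_wpM2l. Qed.

(* A quadratic polynomial touching [w] from above at [z0] satisfies the
   differential inequality of [w] there; no regularity of [w] beyond continuity
   is used, as the mollified functions are smooth subsolutions. *)
Lemma dist_sub_viscosity (m c r : R) (z0 : R * R) (rho0 : R) (w : R * R -> R)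
    (pt C px X : R) : 0 < m -> 0 <= r -> 0 < rho0 ->
  dist_sub m c r (cbox z0 rho0) w -> {for z0, continuous w} ->
  (forall s, cbox z0 rho0 s -> w s <= w z0 + (pt * (s.2 - z0.2) + C * (s.2 - z0.2) ^+ 2
     + px * (s.1 - z0.1) + X * (s.1 - z0.1) ^+ 2)) ->
  pt - 2 * m * X - c * px + r * w z0 <= 0.
Proof.
move=> m0 r0 rho00 [mN wi wsub] cw major; rewrite leNgt; apply/negP.
set N := cbox z0 rho0 in mN wi wsub major *; set w0 := w z0 in major *.
set g := (X in 0 < X) => g0.
have i1 := integrable_cst_cbox z0 1 rho00.
(* The supposed excess [g] is spent in three quarters: the added curvature costs 2 m eps = g/4, the
   displacement of the maximum point at most Kb rho <= g/4, the error in the value at [z0] at most r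
   om <= g/4. What remains is positive. *)
pose eps := g / (8 * m).
have eps0 : 0 < eps by rewrite divr_gt0// mulr_gt0.
have meps : 2 * m * eps = g / 4 by rewrite /eps; field; rewrite gt_eqF.
(* Raising both quadratic coefficients makes the contact strict away from [z0], which will force the
   mollified function to have an interior maximum. *)
pose X' := X + eps; pose C' := C + 1.
pose P (s : R * R) := pt * (s.2 - z0.2) + C' * (s.2 - z0.2) ^+ 2
     + px * (s.1 - z0.1) + X' * (s.1 - z0.1) ^+ 2.
have wP s : N s -> w s <= w0 + P s - eps * (s.1 - z0.1) ^+ 2 - (s.2 - z0.2) ^+ 2.
  by move=> /major; rewrite /P /X' /C'; lra.
(* [K] serves both for P >= - K rho near [z0] and for a change of [P] by at most K d over a kernel
   box, given rho <= 1. [Kb] collects the coefficients with which rho enters the final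
   inequality. *)
pose K := 1 + `|pt| + `|px| + 4 * `|C'| + 4 * `|X'|.
have K1 : 1 <= K by rewrite /K -!addrA lerDl !addr_ge0// mulr_ge0.
pose Kb := 2 * `|C'| + 2 * `|c * X'| + r * K.
have Kb0 : 0 <= Kb by rewrite !addr_ge0// !mulr_ge0//; lra.
pose rho := Num.min 1 (Num.min (rho0 / 2) (g / (4 * (Kb + 1)))).
have Kb1 : 0 < 4 * (Kb + 1) by lra.
have rho_gt0 : 0 < rho by rewrite !lt_min ltr01 !divr_gt0.
have rho1 : rho <= 1 by rewrite ge_min lexx.
have rho2 : rho <= rho0 / 2 by rewrite !ge_min lexx !orbT.
have rhoK : Kb * rho <= g / 4.
  have h : rho <= g / (4 * (Kb + 1)) by rewrite !ge_min lexx !orbT.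
  apply: le_trans (ler_wpM2l Kb0 h) _.
  have -> : Kb * (g / (4 * (Kb + 1))) = g / 4 * (Kb / (Kb + 1)) by field; lra.
  by rewrite ler_piMr ?divr_ge0// ?ltW// ltr_pdivrMr; lra.
(* [theta] is the strictness gained once either coordinate is at distance rho/2 from that of
   [z0]. *)
pose theta := Num.min eps 1 * (rho / 2) ^+ 2.
have mn0 : 0 < Num.min eps 1 by rewrite lt_min eps0 ltr01.
have theta0 : 0 < theta by rewrite mulr_gt0// exprn_gt0// divr_gt0.
have thetaP (x t : R) : rho / 2 <= `|x| \/ rho / 2 <= `|t| -> theta <= eps * x ^+ 2 + t ^+ 2.
  have sq (u : R) : rho / 2 <= `|u| -> (rho / 2) ^+ 2 <= u ^+ 2.
    by move=> h; rewrite -(real_normK (num_real u)) lerXn2r// nnegrE ?divr_ge0 ?ltW.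
  have n1 : Num.min eps 1 <= eps by rewrite ge_min lexx.
  have n2 : Num.min eps 1 <= 1 by rewrite ge_min lexx orbT.
  have x2 := sqr_ge0 x; have t2 := sqr_ge0 t.
  case=> /sq h; rewrite /theta.
    have := ler_pM (ltW mn0) (sqr_ge0 (rho / 2)) n1 h; lra.
  have := ler_pM (ltW mn0) (sqr_ge0 (rho / 2)) n2 h; nra.
pose om := Num.min (theta / 2) (g / (4 * (r + 1))).
have r1 : 0 < 4 * (r + 1) by lra.
have om0 : 0 < om by rewrite lt_min !divr_gt0.
have om1 : om <= theta / 2 by rewrite ge_min lexx.
have rom : r * om <= g / 4.
  have h : om <= g / (4 * (r + 1)) by rewrite !ge_min lexx !orbT.
  apply: le_trans (ler_wpM2l r0 h) _.
  have -> : r * (g / (4 * (r + 1))) = g / 4 * (r / (r + 1)) by field; lra.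
  by rewrite ler_piMr ?divr_ge0// ?ltW// ltr_pdivrMr; lra.
have [d0 d00 wom] : exists2 d0, 0 < d0 & forall s, cbox z0 d0 s -> `|w s - w0| <= om.
  have /cvgrPdist_le /(_ _ om0) := cw.
  move=> /nbhs_ballP[e /= e0 He]; exists (e / 2); first by rewrite divr_gt0.
  move=> s /cboxP[s1 s2]; rewrite distrC; apply: He.
  by split; rewrite /= /ball /= distrC; [apply: le_lt_trans s1 _|apply: le_lt_trans s2 _]; clear -e0; lra.
(* The kernel radius is small enough that om + K d < theta, and that a kernel box centred at
   distance rho in one coordinate stays at distance rho/2 in it. *)
pose d := Num.min (rho / 2) (Num.min d0 (theta / (4 * K))).
have K4 : 0 < 4 * K by lra.
have d_gt0 : 0 < d by rewrite !lt_min d00 !divr_gt0.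
have dr : d <= rho / 2 by rewrite ge_min lexx.
have dd0 : d <= d0 by rewrite !ge_min lexx !orbT.
have Kd : K * d <= theta / 4.
  have h : d <= theta / (4 * K) by rewrite !ge_min lexx !orbT.
  have K0 : 0 <= K by apply: le_trans K1.
  apply: le_trans (ler_wpM2l K0 h) _.
  by rewrite (_ : K * _ = theta / 4)//; field; rewrite gt_eqF// (lt_le_trans _ K1).
have I0 := mass_gt0 d_gt0; set I := mass d in I0.
have boxN y : cbox z0 rho y -> cbox y d `<=` N.
  move=> /cboxP[y1 y2] s sy; have /cboxP[h1 h2] := sub_cbox y1 y2 sy.
  by apply/cboxP; split; [apply: le_trans h1 _|apply: le_trans h2 _]; clear -dr rho2 rho_gt0; lra.
pose W := mconv N w (mol d) (mol d).
have Wz0 : (w0 - om) * I <= W z0.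
  apply: conv_ge => //; first by apply: boxN; apply: cbox_center; exact: ltW.
  move=> s /cboxP[s1 s2]; have : `|w s - w0| <= om.
    by apply: wom; apply/cboxP; split; [apply: le_trans s1 _|apply: le_trans s2 _].
  by rewrite ler_norml => /andP[h _]; clear -h; lra.
have Plip y s : cbox z0 rho y -> cbox y d s -> P s <= P y + K * d.
  move=> /cboxP[y1 y2] /cboxP[s1 s2].
  have E : P s - P y = pt * (s.2 - y.2) + C' * ((s.2 - y.2) * ((s.2 - y.2) + 2 * (y.2 - z0.2)))
     + px * (s.1 - y.1) + X' * ((s.1 - y.1) * ((s.1 - y.1) + 2 * (y.1 - z0.1))).
    by rewrite /P; ring.
  have q (u v : R) : `|u| <= d -> `|v| <= rho -> `|u * (u + 2 * v)| <= 4 * d.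
    move=> ud vr; rewrite normrM mulrC; apply: ler_pM => //.
    clear -ud vr dr rho1; move: ud vr; rewrite !ler_norml => /andP[? ?] /andP[? ?].
    by apply/andP; split; lra.
  have /andP[_ a1] := abs_mulr_le pt s2; have /andP[_ a2] := abs_mulr_le px s1.
  have /andP[_ a3] := abs_mulr_le C' (q _ _ s2 y2).
  have /andP[_ a4] := abs_mulr_le X' (q _ _ s1 y1).
  have Kde : K * d = d + `|pt| * d + `|px| * d + `|C'| * (4 * d) + `|X'| * (4 * d).
    by rewrite /K; ring.
  by move: E a1 a2 a3 a4 Kde; clear -d_gt0; lra.
pose Psi y := W y - I * P y.
have cP : continuous (P : R * R -> R).
  move=> y; have c1 : (fun s : R * R => s.1 - z0.1) s @[s --> y] --> y.1 - z0.1.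
    by apply: cvgB; [exact: cvg_fst|exact: cvg_cst].
  have c2 : (fun s : R * R => s.2 - z0.2) s @[s --> y] --> y.2 - z0.2.
    by apply: cvgB; [exact: cvg_snd|exact: cvg_cst].
  apply: cvgD; [apply: cvgD; [apply: cvgD|]|].
  - by apply: cvgM; [exact: cvg_cst|].
  - by apply: cvgM; [exact: cvg_cst|exact: cvgM].
  - by apply: cvgM; [exact: cvg_cst|].
  - by apply: cvgM; [exact: cvg_cst|exact: cvgM].
have cW : continuous (W : R * R -> R) := @continuous_conv_mol R N w d mN wi.
have cPsi : continuous (Psi : R * R -> R).
  move=> y; apply: cvgB; first exact: cW.
  by apply: cvgM; [exact: cvg_cst|exact: cP].
have zz0 : cbox z0 rho z0 by apply: cbox_center; exact: ltW.
have [y0 y0in ymax] : exists2 y0 : R * R, cbox z0 rho y0 &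
    forall y, cbox z0 rho y -> Psi y <= Psi y0.
  have [y0 /set_mem y0in ymax] := compact_EVT_max (ex_intro _ z0 zz0)
    (@compact_cbox R z0 rho) (continuous_subspaceT cPsi).
  by exists y0 => // y h; apply: ymax; exact: mem_set.
have Pz0 : P z0 = 0 by rewrite /P !subrr; ring.
have Psi_y0 : (w0 - om) * I <= Psi y0.
  by apply: le_trans (ymax _ zz0); rewrite /Psi Pz0 mulr0 subr0.
have [y01 y02] := (cboxP _ _ _).1 y0in.
(* At a far maximum the kernel would see only points where the contact is strict by [theta], so Psi
   y0 <= (w0 + K d - theta) I, below the lower bound (w0 - om) I coming from [z0]. *)
have interior : ~ (rho <= `|y0.1 - z0.1| \/ rho <= `|y0.2 - z0.2|).
  move=> far.
  have : W y0 <= (w0 + P y0 + K * d - theta) * I.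
    apply: conv_le => //; first exact: boxN.
    move=> s sy; have sN := boxN _ y0in _ sy.
    have h1 := wP _ sN; have h2 := Plip _ _ y0in sy.
    have [s1 s2] := (cboxP _ _ _).1 sy.
    have h3 : theta <= eps * (s.1 - z0.1) ^+ 2 + (s.2 - z0.2) ^+ 2.
      apply: thetaP; case: far => far; [left|right].
        have := ler_normD (s.1 - z0.1) (y0.1 - s.1); rewrite distrC in s1.
        have -> : s.1 - z0.1 + (y0.1 - s.1) = y0.1 - z0.1 by clear; ring.
        by move=> h; clear -far s1 dr h; lra.
      have := ler_normD (s.2 - z0.2) (y0.2 - s.2); rewrite distrC in s2.
      have -> : s.2 - z0.2 + (y0.2 - s.2) = y0.2 - z0.2 by clear; ring.
        by move=> h; clear -far s2 dr h; lra.
    by clear -h1 h2 h3; lra.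
  move: Psi_y0; rewrite /Psi => h1 h2.
  have : (w0 - om) * I <= (w0 + K * d - theta) * I by clear -h1 h2; lra.
  by rewrite (ler_pM2r I0); clear -Kd om1 theta0; lra.
have in1 : `|y0.1 - z0.1| < rho by rewrite ltNge; apply/negP => h; apply: interior; left.
have in2 : `|y0.2 - z0.2| < rho by rewrite ltNge; apply/negP => h; apply: interior; right.
have [Dx Dxx Dt] := @conv_mol_derive R N w d mN wi y0.
have e1 : 0 < rho - `|y0.1 - z0.1| by rewrite subr_gt0.
have e2 : 0 < rho - `|y0.2 - z0.2| by rewrite subr_gt0.
pose fx x := Psi (x, y0.2).
pose fx1 x := - mconv N w (mol1 d) (mol d) (x, y0.2) - I * (px + 2 * X' * (x - z0.1)).
have dfx (x : R) : is_derive x 1 fx (fx1 x).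
  have H := is_deriveB (Dx x) (is_deriveZ I (is_derive_quadratic
     (pt * (y0.2 - z0.2) + C' * (y0.2 - z0.2) ^+ 2) px X' z0.1 x)).
  exact: H.
have dfx1 : is_derive y0.1 1 fx1 (mconv N w (mol2 d) (mol d) y0 - I * (2 * X')).
  have H := is_deriveB (Dxx y0.1) (is_deriveZ I (is_derive_quadratic px (2 * X') 0 z0.1 y0.1)).
  have -> : fx1 = (fun x => - mconv N w (mol1 d) (mol d) (x, y0.2) -
      I *: (px + 2 * X' * (x - z0.1) + 0 * (x - z0.1) ^+ 2)).
    by apply/funext => x; rewrite /fx1 /GRing.scale /= mul0r addr0.
  apply: (is_derive_eq H); rewrite /GRing.scale /= -surjective_pairing; ring.
have fxmax x : `|x - y0.1| < rho - `|y0.1 - z0.1| -> fx x <= fx y0.1.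
  move=> xy; rewrite /fx -surjective_pairing; apply: ymax; apply/cboxP; split => //=.
  rewrite (_ : x - z0.1 = (x - y0.1) + (y0.1 - z0.1)); last by ring.
  by apply: le_trans (ler_normD _ _) _; move: xy; clear; lra.
pose ft t := Psi (y0.1, t).
pose ft1 t := - mconv N w (mol d) (mol1 d) (y0.1, t) - I * (pt + 2 * C' * (t - z0.2)).
have dft (t : R) : is_derive t 1 ft (ft1 t).
  have H := is_deriveB (Dt t) (is_deriveZ I (is_derive_quadratic
     (px * (y0.1 - z0.1) + X' * (y0.1 - z0.1) ^+ 2) pt C' z0.2 t)).
  have -> : ft = (fun t => W (y0.1, t) - I *: (px * (y0.1 - z0.1) +
      X' * (y0.1 - z0.1) ^+ 2 + pt * (t - z0.2) + C' * (t - z0.2) ^+ 2)).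
    by apply/funext => u; rewrite /ft /Psi /P /GRing.scale /=; ring.
  exact: H.
have ftmax t : `|t - y0.2| < rho - `|y0.2 - z0.2| -> ft t <= ft y0.2.
  move=> ty; rewrite /ft -surjective_pairing; apply: ymax; apply/cboxP; split => //=.
  rewrite (_ : t - z0.2 = (t - y0.2) + (y0.2 - z0.2)); last by ring.
  by apply: le_trans (ler_normD _ _) _; move: ty; clear; lra.
have := first_derivative_test e1 dfx fxmax; rewrite /fx1 -surjective_pairing => S1.
have := second_derivative_test e1 dfx dfx1 fxmax => S2.
have := first_derivative_test e2 dft ftmax; rewrite /ft1 -surjective_pairing => S3.
have := wsub d y0 d_gt0 (boxN _ y0in); rewrite (@adj_mol_conv R N w d mN wi) => Hsub.
set c01 := mconv N w (mol d) (mol1 d) y0 in S3 Hsub.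
set c1 := mconv N w (mol1 d) (mol d) y0 in S1 Hsub.
set c2 := mconv N w (mol2 d) (mol d) y0 in S2 Hsub.
have PyK : - (K * rho) <= P y0.
  have rr (u : R) : `|u| <= rho -> `|u ^+ 2| <= rho.
    by move=> h; rewrite normrX expr2; apply: le_trans (_ : 1 * rho <= _);
      [apply: ler_pM => //; exact: le_trans h rho1|rewrite mul1r].
  have /andP[a1 _] := abs_mulr_le pt y02; have /andP[a2 _] := abs_mulr_le px y01.
  have /andP[a3 _] := abs_mulr_le C' (rr _ y02).
  have /andP[a4 _] := abs_mulr_le X' (rr _ y01).
  have KE : K * rho = rho + `|pt| * rho + `|px| * rho + 4 * (`|C'| * rho) + 4 * (`|X'| * rho).
    by rewrite /K; ring.
  have n3 : 0 <= `|C'| * rho by rewrite mulr_ge0// ltW.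
  have n4 : 0 <= `|X'| * rho by rewrite mulr_ge0// ltW.
  by move: a1 a2 a3 a4 KE n3 n4; rewrite /P; clear -rho_gt0; lra.
have Wy0 : I * (w0 - om + P y0) <= W y0.
  by move: Psi_y0; rewrite /Psi; clear; lra.
(* At the maximum W_t = I P_t, W_x = I P_x and W_xx <= I P_xx, while W is bounded below through the
   value at [z0]; every term carries the mass [I]. *)
have br : I * (pt + 2 * C' * (y0.2 - z0.2) - m * (2 * X')
    - c * (px + 2 * X' * (y0.1 - z0.1)) + r * (w0 - om + P y0)) <= 0.
  have h1 := ler_wpM2l r0 Wy0; have h2 : m * c2 <= m * (I * (2 * X')).
    by rewrite ler_pM2l//; clear -S2; lra.
  have h3 : c * c1 = - (c * (I * (px + 2 * X' * (y0.1 - z0.1)))).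
    have -> : c1 = - (I * (px + 2 * X' * (y0.1 - z0.1))) by clear -S1; lra.
    by rewrite mulrN.
  move: h1 h2 h3 Hsub S3; rewrite /W; clear.
  set A := mconv _ _ _ _ _; move=> h1 h2 h3 Hsub S3; nra.
have {br} : pt + 2 * C' * (y0.2 - z0.2) - m * (2 * X')
    - c * (px + 2 * X' * (y0.1 - z0.1)) + r * (w0 - om + P y0) <= 0.
  by rewrite (pmulr_rle0 _ I0) in br.
have b1 : - (2 * `|C'| * rho) <= 2 * C' * (y0.2 - z0.2).
  by have /andP[h _] := abs_mulr_le C' y02; move: h; clear; lra.
have b2 : 2 * (c * X' * (y0.1 - z0.1)) <= 2 * `|c * X'| * rho.
  by have /andP[_ h] := abs_mulr_le (c * X') y01; move: h; clear; lra.
have b3 : - (r * K * rho) <= r * P y0.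
  by have h := ler_wpM2l r0 PyK; move: h; clear; lra.
have rhoK' : 2 * `|C'| * rho + 2 * `|c * X'| * rho + r * K * rho <= g / 4.
  by move: rhoK; rewrite /Kb; clear; lra.
have X'E : m * (2 * X') = 2 * m * X + g / 4.
  by rewrite -meps /X'; ring.
move: b1 b2 b3 rhoK' X'E rom; rewrite mulrDr.
have gE : g = pt - 2 * m * X - c * px + r * w0 by [].
move: gE g0; clearbody g; clear; move=> *; nra.
Qed.

End viscosity.

(** * Maximum principle *)

Section box_continuity.
Context {R : realType}.

(** An epsilon-delta form of continuity within a set, convenient for restricting to smaller strips,
    shifting in time and reading off plain continuity at interior points. *)
Definition box_continuous (A : set (R * R)) (w : R * R -> R) : Prop :=
  forall z, A z -> forall e, 0 < e -> exists2 d, 0 < d &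
    forall s, A s -> cbox z d s -> `|w s - w z| <= e.

Lemma nbhs_cboxP (z : R * R) (P : set (R * R)) :
  nbhs z P <-> exists2 d : R, 0 < d & cbox z d `<=` P.
Proof.
split.
  move=> /nbhs_ballP[e /= e0 He]; exists (e / 2); first by rewrite divr_gt0.
  move=> s /cboxP[s1 s2]; apply: He.
  by split; rewrite /= /ball /= distrC; [apply: le_lt_trans s1 _|apply: le_lt_trans s2 _]; lra.
move=> [d d0 Hd]; apply/nbhs_ballP; exists d => //= s [s1 s2]; apply: Hd; apply/cboxP.
by rewrite /= /ball /= distrC in s1; rewrite /= /ball /= distrC in s2; split; exact: ltW.
Qed.

Lemma within_box_continuous (A : set (R * R)) (w : R * R -> R) :
  {within A, continuous w} <-> box_continuous A w.
Proof.
split.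
  move=> cw z Az e e0.
  have /cvgrPdist_le /(_ _ e0) H := cw z.
  have {H} : nbhs_subspace (z : subspace A) [set s | `|w z - w s| <= e] := H.
  rewrite -nbhs_subspace_in// => /nbhs_cboxP[d d0 Hd]; exists d => // s As zs.
  by rewrite distrC; apply: Hd.
move=> H; rewrite continuous_subspace_in => z /set_mem Az.
apply/cvgrPdist_le => e e0; have [d d0 Hd] := H z Az e e0.
suff : nbhs_subspace (z : subspace A) [set s | `|w z - w s| <= e] by [].
rewrite -nbhs_subspace_in//; apply/nbhs_cboxP; exists d => // s zs As.
by rewrite /= distrC; apply: Hd.
Qed.

Lemma box_continuousB (A : set (R * R)) (u v : R * R -> R) :
  box_continuous A u -> box_continuous A v -> box_continuous A (fun z => u z - v z).
Proof.
move=> cu cv z Az e e0; have e2 : 0 < e / 2 by rewrite divr_gt0.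
have [d d0 Hd] := cu z Az _ e2; have [d' d'0 Hd'] := cv z Az _ e2.
exists (Num.min d d'); first by rewrite lt_min d0.
move=> s As /cboxP[s1 s2]; rewrite !le_min in s1 s2.
have /andP[s11 s12] := s1; have /andP[s21 s22] := s2.
have h1 : `|u s - u z| <= e / 2 by apply: Hd => //; exact/cboxP.
have h2 : `|v s - v z| <= e / 2 by apply: Hd' => //; exact/cboxP.
rewrite (_ : _ - _ - _ = (u s - u z) - (v s - v z)); last by ring.
by apply: le_trans (ler_normB _ _) _; lra.
Qed.

Lemma box_continuousW (A B : set (R * R)) (w : R * R -> R) : B `<=` A ->
  box_continuous A w -> box_continuous B w.
Proof.
move=> BA cw z Bz e e0; have [d d0 Hd] := cw z (BA _ Bz) e e0.
by exists d => // s Bs; apply: Hd; exact: BA.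
Qed.

Lemma box_continuous_in (A : set (R * R)) (w : R * R -> R) :
  {in A, continuous w} -> box_continuous A w.
Proof. by move=> cw; apply/within_box_continuous; exact: continuous_in_subspaceT. Qed.

Lemma box_continuous_interior (A : set (R * R)) (w : R * R -> R) (z : R * R) (d : R) :
  0 < d -> cbox z d `<=` A -> box_continuous A w -> {for z, continuous w}.
Proof.
move=> d0 dA cw; apply/cvgrPdist_le => e e0.
have Az : A z by apply: dA; apply: cbox_center; exact: ltW.
have [d' d'0 Hd'] := cw z Az e e0.
apply/nbhs_cboxP; exists (Num.min d d'); first by rewrite lt_min d0.
move=> s /cboxP[]; rewrite !le_min => /andP[s11 s12] /andP[s21 s22].
by rewrite distrC; apply: Hd'; [apply: dA|]; apply/cboxP.
Qed.

End box_continuity.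

Section maximum_principle.
Context {R : realType}.

(* The second-order term in time is immaterial to the notion, but lets touching
   polynomials bound the penalty 1/(T - t). *)
Definition visc_sub (m c r : R) (w : R * R -> R) (z : R * R) : Prop :=
  forall (rho pt C px X : R), 0 < rho ->
  (forall s, cbox z rho s -> w s <= w z + (pt * (s.2 - z.2) + C * (s.2 - z.2) ^+ 2
     + px * (s.1 - z.1) + X * (s.1 - z.1) ^+ 2)) ->
  pt - 2 * m * X - c * px + r * w z <= 0.

Definition strip (x0 T : R) : set (R * R) := [set z | z.1 <= x0 /\ 0 <= z.2 <= T].

(** The exact remainder is dt^2 / (t^2 (t - dt)), and t - dt >= t/2. With t the time left to the
    horizon, this gives the polynomial touching the penalty. *)
Lemma inv_taylor_le (t dt : R) : 0 < t -> `|dt| <= t / 2 ->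
  (t - dt)^-1 <= t^-1 + dt / t ^+ 2 + 2 / t ^+ 3 * dt ^+ 2.
Proof.
move=> t0; rewrite ler_norml => /andP[d1 d2].
have td : 0 < t - dt by lra.
have t1 : t != 0 by rewrite gt_eqF. have td1 : t - dt != 0 by rewrite gt_eqF.
have -> : (t - dt)^-1 = t^-1 + dt / t ^+ 2 + (t ^+ 2 * (t - dt))^-1 * dt ^+ 2.
  by field; rewrite t1 td1.
rewrite lerD2l; apply: ler_wpM2r; first exact: sqr_ge0.
have -> : 2 / t ^+ 3 = (t ^+ 2 * (t / 2))^-1 by field; rewrite t1.
rewrite lef_pV2 ?posrE ?mulr_gt0 ?exprn_gt0 ?divr_gt0//.
by rewrite ler_pM2l ?exprn_gt0//; lra.
Qed.

(* The penalty x^2 + 1/(T - t) makes the maximum interior, and the resulting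
   error terms are absorbed by the zeroth-order term [r w]. *)
Lemma maximum_principle (m c r x0 T : R) (w : R * R -> R) (M : R) :
  0 < m -> 0 < r ->
  box_continuous (strip x0 T) w -> (forall z, strip x0 T z -> w z <= M) ->
  (forall x, x <= x0 -> w (x, 0) <= 0) ->
  (forall t, 0 <= t <= T -> w (x0, t) <= 0) ->
  (forall z, z.1 < x0 -> 0 < z.2 < T -> 0 < w z -> visc_sub m c r w z) ->
  forall z, strip x0 T z -> w z <= 0.
Proof.
move=> m0 r0 cw wM w_init w_lat w_sub.
(* Times before [T] come first, since the penalty is singular at [T]; the final slice follows by
   continuity. *)
have main (z1 : R * R) : z1.1 <= x0 -> 0 <= z1.2 < T -> w z1 <= 0.
  move=> z11 z12; rewrite leNgt; apply/negP => eta0; set eta := w z1 in eta0.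
  have /andP[z120 z12T] := z12.
  have z1s : strip x0 T z1 by split => //; rewrite z120 ltW.
  have M0 : 0 < M by apply: lt_le_trans eta0 _; exact: wM.
  (* [B] exceeds the unscaled penalty at [z1], so eps B <= eta/2 leaves at least eta/2 of the value
     of [w] there. *)
  pose B := z1.1 ^+ 2 + (T - z1.2)^-1 + 1.
  have B0 : 0 < B.
    have h1 := sqr_ge0 z1.1; have h2 : 0 < (T - z1.2)^-1 by rewrite invr_gt0; lra.
    by rewrite /B; lra.
  (* At the touching point the penalty in x contributes eps (2 m + 2 c x), and 2 c x <= r x^2 +
     c^2/r. The part r x^2 is paid for by the penalty inside r w; the rest is at most eps E. *)
  pose E := 2 * m + c ^+ 2 / r + 1.
  have E0 : 0 < E.
    have q0 : 0 <= c ^+ 2 / r by apply: divr_ge0; [exact: sqr_ge0|exact: ltW].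
    by rewrite /E; move: q0; set q := c ^+ 2 / r; move: m0; clear => *; lra.
  pose eps := Num.min (eta / (2 * B)) (r * eta / (4 * E)).
  have eps0 : 0 < eps by rewrite lt_min !divr_gt0// ?mulr_gt0.
  have epsB : eps * B <= eta / 2.
    have h : eps <= eta / (2 * B) by rewrite ge_min lexx.
    apply: le_trans (ler_wpM2r (ltW B0) h) _.
    by have -> : eta / (2 * B) * B = eta / 2 by field; rewrite gt_eqF.
  have epsE : eps * E <= r * eta / 4.
    have h : eps <= r * eta / (4 * E) by rewrite ge_min lexx orbT.
    apply: le_trans (ler_wpM2r (ltW E0) h) _.
    by have -> : r * eta / (4 * E) * E = r * eta / 4 by field; rewrite gt_eqF.
  pose h (z : R * R) := eps * (z.1 ^+ 2 + (T - z.2)^-1).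
  pose Phi z := w z - h z.
  (* On x = - L, and on t = T - tau below, the penalty alone reaches [M], so the maximum over [D]
     avoids these two sides; the other two are excluded by the boundary data. *)
  pose L := `|z1.1| + `|x0| + M / eps + 1.
  have Me0 : 0 < M / eps by rewrite divr_gt0.
  have L1 : 1 <= L by rewrite /L; have := normr_ge0 z1.1; have := normr_ge0 x0; lra.
  have LM : M <= eps * L ^+ 2.
    have h1 : M / eps <= L by rewrite /L; have := normr_ge0 z1.1; have := normr_ge0 x0; lra.
    have h2 : M / eps <= L ^+ 2 by apply: le_trans h1 _; rewrite expr2 ler_peMl//; lra.
    by rewrite mulrC -ler_pdivrMr.
  pose tau := Num.min (T - z1.2) (eps / M).
  have tau0 : 0 < tau by rewrite lt_min subr_gt0 z12T divr_gt0.
  have tau1 : tau <= T - z1.2 by rewrite ge_min lexx.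
  have tauM : M <= eps * tau^-1.
    have h1 : tau <= eps / M by rewrite ge_min lexx orbT.
    by rewrite ler_pdivlMr// mulrC -ler_pdivlMr.
  pose D := [set` `[- L, x0]] `*` [set` `[0, T - tau]] : set (R * R).
  have DP z : D z <-> (- L <= z.1 <= x0 /\ 0 <= z.2 <= T - tau).
    by rewrite /D /setX /= !in_itv.
  have cD : compact D by apply: compact_setX; exact: segment_compact.
  have Dstrip : D `<=` strip x0 T.
    by move=> z /DP[/andP[_ zx] /andP[z0 zT]]; split => //; rewrite z0; lra.
  have z1L : - L <= z1.1.
    have := ler_norm (- z1.1); rewrite normrN; have := normr_ge0 x0; rewrite /L; lra.
  have Dz1 : D z1 by apply/DP; split; [rewrite z1L z11|rewrite z120; lra].
  have ch : {in D, continuous (h : R * R -> R)}.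
    move=> z /set_mem /DP[_ /andP[_ zT]].
    have c1 : s.1 @[s --> z] --> z.1 by exact: cvg_fst.
    have c2 : (T - s.2) @[s --> z] --> T - z.2 by apply: cvgB; [exact: cvg_cst|exact: cvg_snd].
    apply: cvgM; first exact: cvg_cst.
    apply: cvgD; first exact: cvgM.
    by apply: cvgV => //; rewrite gt_eqF//; lra.
  have cPhi : {within D, continuous Phi}.
    apply/within_box_continuous; apply: box_continuousB; last exact: box_continuous_in.
    exact: box_continuousW Dstrip cw.
  have [zs Dzs zmax] : exists2 zs : R * R, D zs & forall y, D y -> Phi y <= Phi zs.
    have [y /set_mem yin ymax] := compact_EVT_max (ex_intro _ z1 Dz1) cD cPhi.
    by exists y => // s hs; apply: ymax; exact: mem_set.
  have Phizs : eta / 2 <= Phi zs.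
    apply: le_trans (zmax _ Dz1); rewrite /Phi /h -/eta.
    move: epsB; rewrite /B; clear -eps0; lra.
  have [/andP[zs1 zs2] /andP[zs3 zs4]] := (DP _).1 Dzs.
  have hs1 : 0 <= eps * zs.1 ^+ 2 by rewrite mulr_ge0 ?sqr_ge0// ltW.
  have Tz : tau <= T - zs.2 by clear -zs4; lra.
  have Tz0 : 0 < T - zs.2 by apply: lt_le_trans Tz.
  have hs2 : 0 < eps * (T - zs.2)^-1 by rewrite mulr_gt0// invr_gt0.
  have hE : h zs = eps * zs.1 ^+ 2 + eps * (T - zs.2)^-1 by rewrite /h mulrDr.
  have wzs : eta / 2 + eps * zs.1 ^+ 2 <= w zs.
    by move: Phizs; rewrite /Phi hE; clear -hs2; lra.
  have wzs0 : 0 < w zs by clear -wzs hs1 eta0; lra.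
  have n1 : zs.1 < x0.
    rewrite lt_neqAle zs2 andbT; apply/eqP => e.
    have : w (x0, zs.2) <= 0 by apply: w_lat; rewrite zs3; clear -Tz0; lra.
    by rewrite -e -surjective_pairing leNgt wzs0.
  have n2 : - L < zs.1.
    rewrite lt_neqAle zs1 andbT; apply/eqP => e.
    have := wM _ (Dstrip _ Dzs); move: Phizs; rewrite /Phi hE -e sqrrN.
    by clear -LM hs2 eta0; lra.
  have n3 : 0 < zs.2.
    rewrite lt_neqAle zs3 andbT; apply/eqP => e.
    have : w (zs.1, 0) <= 0 by apply: w_init; exact: ltW.
    have -> : (zs.1, 0) = zs by rewrite [RHS]surjective_pairing -e.
    by rewrite leNgt wzs0.
  have n4 : zs.2 < T - tau.
    rewrite lt_neqAle zs4 andbT; apply/eqP => e.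
    have := wM _ (Dstrip _ Dzs); move: Phizs; rewrite /Phi hE.
    rewrite (_ : T - zs.2 = tau); last by rewrite e; clear; ring.
    by clear -tauM hs1 eta0; lra.
  (* The last bound is the range of validity of [inv_taylor_le]; the others keep the box inside
     [D]. *)
  pose rho := Num.min (Num.min (x0 - zs.1) (zs.1 + L)) (Num.min (Num.min zs.2 (T - tau - zs.2)) ((T - zs.2) / 2)).
  have rho0 : 0 < rho by rewrite !lt_min; clear -n1 n2 n3 n4 tau0; do ?(apply/andP; split); lra.
  have rho_le : [/\ rho <= x0 - zs.1, rho <= zs.1 + L, rho <= zs.2, rho <= T - tau - zs.2 &
      rho <= (T - zs.2) / 2].
    by split; rewrite !ge_min lexx ?orbT.
  have [q1 q2 q3 q4 q5] := rho_le.
  have zsT : 0 < zs.2 < T by rewrite n3; clear -Tz0; lra.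
  have := w_sub zs n1 zsT wzs0 rho (eps / (T - zs.2) ^+ 2) (eps * (2 / (T - zs.2) ^+ 3))
     (2 * eps * zs.1) eps rho0.
  have maj : forall s, cbox zs rho s -> w s <= w zs + (eps / (T - zs.2) ^+ 2 * (s.2 - zs.2)
     + eps * (2 / (T - zs.2) ^+ 3) * (s.2 - zs.2) ^+ 2
     + 2 * eps * zs.1 * (s.1 - zs.1) + eps * (s.1 - zs.1) ^+ 2).
    move=> s /cboxP[s1 s2].
    have Ds : D s.
      move: (s1) (s2); rewrite !ler_norml => /andP[h1 h2] /andP[h3 h4].
      apply/DP; clear -h1 h2 h3 h4 q1 q2 q3 q4; by split; apply/andP; split; lra.
    have := zmax _ Ds; rewrite /Phi /h => H.
    have := @inv_taylor_le (T - zs.2) (s.2 - zs.2) Tz0 (le_trans s2 q5).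
    rewrite (_ : T - zs.2 - (s.2 - zs.2) = T - s.2); last by clear; ring.
    move=> /(ler_wpM2l (ltW eps0)).
    move: H; set a := (T - s.2)^-1; set b := (T - zs.2)^-1.
    set b2 := (T - zs.2) ^- 2; set b3 := (T - zs.2) ^- 3; clear.
    lra.
  move=> /(_ maj) F.
  have pt0 : 0 < eps / (T - zs.2) ^+ 2 by rewrite divr_gt0// exprn_gt0.
  have sq : 0 <= r * zs.1 ^+ 2 - 2 * c * zs.1 + c ^+ 2 / r.
    have -> : r * zs.1 ^+ 2 - 2 * c * zs.1 + c ^+ 2 / r = r * (zs.1 - c / r) ^+ 2.
      by field; rewrite gt_eqF.
    by rewrite mulr_ge0 ?sqr_ge0// ltW.
  have := ler_wpM2l (ltW eps0) sq; have := ler_wpM2l (ltW r0) wzs.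
  have re : 0 < r * eta by rewrite mulr_gt0.
  move: F pt0 epsE re; rewrite /E; set cc := c ^+ 2 / r; set p := eps / _; clear -eps0.
  by move=> *; nra.
move=> z [z1 /andP[z2 z3]].
have [zT|zT] := ltP z.2 T; first by apply: main => //; rewrite z2.
(* If T > 0, the value at [T] is a limit of values at earlier times; if T <= 0, the slice is the
   initial one. *)
have {}zT : z.2 = T by apply/eqP; rewrite eq_le z3.
rewrite leNgt; apply/negP => wz.
have w2 : 0 < w z / 2 by rewrite divr_gt0.
have zs : strip x0 T z by split => //; rewrite z2.
have [d d0 Hd] := cw z zs _ w2.
have [T0|T0] := leP T 0.
  have : w (z.1, 0) <= 0 by exact: w_init.
  have e : 0 = z.2 by lra.
  have -> : (z.1, 0) = z by rewrite [RHS]surjective_pairing -e.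
  by rewrite leNgt wz.
pose t := Num.max 0 (T - d).
have t1 : 0 <= t by rewrite le_max lexx.
have t2 : t < T by rewrite gt_max T0; lra.
have t3 : T - d <= t by rewrite le_max lexx orbT.
have : `|w (z.1, t) - w z| <= w z / 2.
  apply: Hd; first by split => //=; rewrite t1 ltW.
  apply/cboxP => /=; split; first by rewrite subrr normr0 ltW.
  by rewrite zT ler0_norm; lra.
have : w (z.1, t) <= 0 by apply: main => //=; rewrite t1.
by rewrite ler_norml => ? /andP[? _]; lra.
Qed.

End maximum_principle.

Lemma ae_imp d (T : measurableType d) (R : realType) (mu : {measure set T -> \bar R})
  (P Q : T -> Prop) : (forall x, P x -> Q x) ->
  {ae mu, forall x, P x} -> {ae mu, forall x, Q x}.
Proof. by move=> PQ; apply: filterS. Qed.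

Section distributional_to_viscosity.
Context {R : realType}.
Local Notation mR := (measurableTypeR R).
Local Notation mR2 := (mR * mR)%type.

Lemma dist_sub_subset (m c r : R) (N N' : set mR2) (u : mR2 -> R) :
  measurable N' -> N' `<=` N -> dist_sub m c r N u -> dist_sub m c r N' u.
Proof.
move=> mN' sN [mN ui Hu]; split => //; first exact: integrableS ui.
move=> d y d0 yN'; have := Hu d y d0 (subset_trans yN' sN).
rewrite (@Rintegral_supp _ _ _ _ N N') => // s _ sN'.
have sy : ~ cbox y d s by apply: contra_not sN'; exact: yN'.
rewrite /adj_mol !(prod_out _ _ sy); [ring|..];
  by [exact: mol_out|exact: mol1_out|exact: mol2_out].
Qed.

Lemma dist_sub_visc_sub (m c r : R) (z : R * R) (rho0 : R) (w : R * R -> R) :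
  0 < m -> 0 < r -> 0 < rho0 ->
  dist_sub m c r (cbox z rho0) w -> {for z, continuous w} -> visc_sub m c r w z.
Proof.
move=> m0 r0 rho00 dw cw rho pt C px X rho_gt0 maj.
have e0 : 0 < Num.min rho0 rho by rewrite lt_min rho00.
have sub e : Num.min rho0 rho <= e -> cbox z (Num.min rho0 rho) `<=` cbox z e.
  by move=> h s /cboxP[s1 s2]; apply/cboxP; split; exact: le_trans h.
apply: (@dist_sub_viscosity R m c r z (Num.min rho0 rho) w pt C px X) => //.
- exact: ltW.
- apply: dist_sub_subset dw; first exact: measurable_cbox.
  by apply: sub; rewrite ge_min lexx.
- by move=> s hs; apply: maj; apply: sub hs; rewrite ge_min lexx orbT.
Qed.

End distributional_to_viscosity.

(** * Comparison of strong solutions with different horizons *)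

Section strong_solutions.
Context {R : realType}.
Local Notation mR := (measurableTypeR R).
Local Notation mR2 := (mR * mR)%type.
Variables (K1 k1 K2 sigma r q : R).
Let m := sigma ^+ 2 / 2.
Let c := r - q - sigma ^+ 2 / 2.

(** PY >= 0 holds on every box, but PY <= 0 is obtained only on boxes avoiding the contact set;
    hence comparison always starts at a point where [Y] exceeds something lying above the
    obstacle. *)
Lemma strong_solution_dist (p T : R) (Y : R * R -> R) (z : R * R) (rho : R) :
  strong_solution K1 k1 K2 sigma r q p T Y -> cbox z rho `<=` Qint k1 T ->
  dist_super m c r (cbox z rho) Y /\
  ((forall s, cbox z rho s -> psi1 K1 k1 K2 s.1 < Y s) -> dist_sub m c r (cbox z rho) Y).
Proof.
move=> [Yx [Yxx [Yt [[_ wx wxx wt _] _ ge0 eq0 _]]]] zQ.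
have cN := @compact_cbox R z rho; have mN := measurable_cbox z rho.
have QQ s : cbox z rho s -> Qdom k1 T s.
  by move=> /zQ[s1 /andP[s2 s3]]; split => //; rewrite s2 ltW.
split.
  apply: (weak_dist_super wx wxx wt cN mN zQ).
  by apply: ae_imp ge0 => s H /QQ; exact: H.
move=> gt; apply: (weak_dist_sub wx wxx wt cN mN zQ).
by apply: ae_imp eq0 => s H Ns; rewrite [X in X <= _](H (QQ _ Ns) (gt _ Ns)).
Qed.

Lemma Qint_cbox (T : R) (z : R * R) : z.1 < ln k1 -> 0 < z.2 < T ->
  exists2 rho : R, 0 < rho & cbox z rho `<=` Qint k1 T.
Proof.
move=> z1 /andP[z2 z3].
exists (Num.min ((ln k1 - z.1) / 2) (Num.min (z.2 / 2) ((T - z.2) / 2))).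
  by rewrite !lt_min !divr_gt0// subr_gt0.
move=> s /cboxP[]; rewrite !le_min !ler_norml => /and3P[/andP[a1 a2] _ _] /and3P[_ /andP[b1 b2] /andP[c1 c2]].
by split; [|apply/andP; split]; lra.
Qed.

Lemma Qint_strip (T : R) : Qint k1 T `<=` strip (ln k1) T.
Proof. by move=> z [z1 /andP[z2 z3]]; split; [exact: ltW|rewrite !ltW]. Qed.

Lemma continuous_psi1 : continuous (psi1 K1 k1 K2).
Proof.
have -> : psi1 K1 k1 K2 = fun x => (expR x - K1 + `|expR x - K1|) / 2 + K2 - k1.
  by apply/funext => x; rewrite /psi1 maxr_absE addr0 subr0.
have ce (x : R) : (fun y => expR y - K1) y @[y --> x] --> expR x - K1.
  by apply: cvgB; [exact: continuous_expR|exact: cvg_cst].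
move=> x; apply: cvgB; last exact: cvg_cst.
apply: cvgD; last exact: cvg_cst.
apply: cvgM; last exact: cvg_cst.
by apply: cvgD; [exact: ce|exact: (cvg_norm (ce x))].
Qed.

Lemma gt_psi1_near (z : R * R) (u : R * R -> R) : {for z, continuous u} ->
  psi1 K1 k1 K2 z.1 < u z ->
  exists2 rho : R, 0 < rho & forall s, cbox z rho s -> psi1 K1 k1 K2 s.1 < u s.
Proof.
move=> cu zu.
have cd : (fun s => u s - psi1 K1 k1 K2 s.1) s @[s --> z] --> u z - psi1 K1 k1 K2 z.1.
  apply: cvgB; first exact: cu.
  apply: (@cvg_comp _ _ _ fst (psi1 K1 k1 K2)); last exact: continuous_psi1.
  exact: cvg_fst.
have /cvgr_gt /(_ 0) := cd; rewrite subr_gt0 => /(_ zu) /nbhs_cboxP[d d0 Hd].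
by exists d => // s /Hd; rewrite /= subr_gt0.
Qed.

Section two_solutions.
Variables (p p' T T' : R) (Y Y' : R * R -> R).
Hypotheses (sigma0 : 0 < sigma) (r0 : 0 < r).
Hypothesis hY : bounded_strong_solution K1 k1 K2 sigma r q p T Y.
Hypothesis hY' : bounded_strong_solution K1 k1 K2 sigma r q p' T' Y'.

Lemma strong_comparison (S h : R) : 0 <= h -> S <= T -> S + h <= T' ->
  forall x t, x <= ln k1 -> 0 <= t <= S -> Y (x, t) <= Y' (x, t + h).
Proof.
move=> h0 ST ShT' x t xk tS.
have [sY [M HM]] := hY; have [sY' [M' HM']] := hY'.
have [Yx [Yxx [Yt [[cY _ _ _ _] geY _ _ [Yinit Ylat]]]]] := sY.
have [Y'x [Y'xx [Y't [[cY' _ _ _ _] geY' _ _ [Y'init Y'lat]]]]] := sY'.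
have {}cY : box_continuous (strip (ln k1) T) Y by apply/within_box_continuous.
have {}cY' : box_continuous (strip (ln k1) T') Y' by apply/within_box_continuous.
pose a : R * R := (0, h).
pose w z := Y z - Y' (z + a).
have aE u s : (u, s) + a = (u, s + h).
  by apply: injective_projections; rewrite /= ?addr0.
have wE u s : w (u, s) = Y (u, s) - Y' (u, s + h) by rewrite /w aE.
have sS : strip (ln k1) S `<=` strip (ln k1) T.
  by move=> z [z1 /andP[z2 z3]]; split => //; rewrite z2; lra.
have sS' z : strip (ln k1) S z -> strip (ln k1) T' (z + a).
  by move=> [z1 /andP[z2 z3]]; split => /=; [lra|apply/andP; split; lra].
have m0 : 0 < m by rewrite /m divr_gt0// exprn_gt0.
have cw : box_continuous (strip (ln k1) S) w.
  apply: box_continuousB; first exact: box_continuousW cY.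
  move=> z zS e e0; have [d d0 Hd] := cY' _ (sS' _ zS) e e0.
  exists d => // s sSs /cboxP[s1 s2]; apply: Hd; first exact: sS'.
  by apply/cboxP; split; rewrite /= opprD addrACA subrr addr0.
have : w (x, t) <= 0.
  apply: (@maximum_principle R m c r (ln k1) S w (M + M')) => //.
  - move=> z zS; have h1 := HM z (sS _ zS); have h2 := HM' _ (sS' _ zS).
    have := ler_norm (Y z); have := ler_norm (- Y' (z + a)); rewrite normrN /w; lra.
  - move=> u uk; have S0 : 0 <= S by lra.
    rewrite wE subr_le0 add0r.
    have [uk1|uk1] := ltP u (ln k1); last first.
      have -> : u = ln k1 by apply/eqP; rewrite eq_le uk.
      by rewrite Ylat ?Y'lat//; apply/andP; split; lra.
    (* For h > 0 the shifted solution dominates [psi1] by the obstacle constraint; for h = 0 the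
       initial data coincide. *)
    rewrite Yinit//; have [h1|h1] := ltP 0 h; last first.
      have -> : h = 0 by apply/eqP; rewrite eq_le h1.
      by rewrite Y'init.
    by apply: (geY' (u, h)); split => //=; rewrite h1; lra.
  - move=> s /andP[s1 s2]; rewrite wE Ylat ?Y'lat ?subrr//; apply/andP; split; lra.
  - move=> z z1 z2; rewrite subr_gt0 => wz.
    have zT : 0 < z.2 < T by move: z2 => /andP[? ?]; apply/andP; split; lra.
    have zT' : 0 < (z + a).2 < T' by move: z2 => /andP[? ?] /=; apply/andP; split; lra.
    have z1' : (z + a).1 < ln k1 by rewrite /= addr0.
    have [e1 e10 He1] := Qint_cbox z1 zT.
    have [e2 e20 He2] := Qint_cbox z1' zT'.
    (* Exceeding the other solution, [Y] exceeds the obstacle, so it is a subsolution near [z]. *)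
    have psiY : psi1 K1 k1 K2 z.1 < Y z.
      apply: le_lt_trans wz; have := geY' (z + a); rewrite /= addr0; apply.
      by split => //=; move: zT' => /= /andP[? ?]; apply/andP; split; lra.
    have cYz := box_continuous_interior e10 (subset_trans He1 (@Qint_strip T)) cY.
    have cYz' := box_continuous_interior e20 (subset_trans He2 (@Qint_strip T')) cY'.
    have [e3 e30 He3] := gt_psi1_near cYz psiY.
    pose e := Num.min e1 (Num.min e2 e3).
    have e0 : 0 < e by rewrite !lt_min e10 e20.
    have sub (y : R * R) e' : e <= e' -> cbox y e `<=` cbox y e'.
      by move=> le s /cboxP[s1 s2]; apply/cboxP; split; exact: le_trans le.
    have ee1 : e <= e1 by rewrite ge_min lexx.
    have ee2 : e <= e2 by rewrite !ge_min lexx orbT.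
    have ee3 : e <= e3 by rewrite !ge_min lexx !orbT.
    have [_ /(_ (fun s hs => He3 s (sub _ _ ee3 _ hs))) D1] :=
      strong_solution_dist sY (subset_trans (sub z _ ee1) He1).
    have [D2 _] := strong_solution_dist sY' (subset_trans (sub (z + a) _ ee2) He2).
    have D2' : dist_super m c r (cbox z e) (fun s => Y' (s + a)).
      have := dist_sub_shift a D2.
      by rewrite [X in dist_sub _ _ _ X](shift_cbox (z + a) e a) addrK.
    apply: (dist_sub_visc_sub m0 r0 e0 (dist_subB D1 D2')).
    (* Continuity of [w] is available only up to time [S], so the box must not reach beyond it. *)
    apply: (@box_continuous_interior R (strip (ln k1) S) w z (Num.min e1 ((S - z.2)))) => //.
      by rewrite lt_min e10 subr_gt0; case/andP: z2.
    move=> s /cboxP[]; rewrite !le_min => /andP[s1 _] /andP[s2 s3].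
    have [Q1 /andP[Q2 Q3]] := He1 s ((cboxP _ _ _).2 (conj s1 s2)).
    split; first exact: ltW.
    by rewrite ltW//=; move: s3; rewrite ler_norml => /andP[? ?]; lra.
by rewrite wE subr_le0.
Qed.

End two_solutions.

End strong_solutions.

(** * Product integrals and time-independent supersolutions *)

Section product_integrals.
Context {R : realType}.
Local Notation mR := (measurableTypeR R).
Local Notation mR2 := (mR * mR)%type.
Local Notation mu := (@lebesgue_measure R).

Lemma integral_prodT (f g : mR -> R) :
  mu.-integrable setT (EFin \o f) -> mu.-integrable setT (EFin \o g) ->
  (@lebesgue2 R).-integrable setT (EFin \o (fun z : mR2 => f z.1 * g z.2)) /\
  \int[@lebesgue2 R]_z (f z.1 * g z.2) = \int[mu]_x f x * \int[mu]_x g x.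
Proof.
move=> fi gi.
have mf : measurable_fun setT f by apply/measurable_EFinP; exact: measurable_int fi.
have mg : measurable_fun setT g by apply/measurable_EFinP; exact: measurable_int gi.
pose F : mR2 -> \bar R := EFin \o (fun z : mR2 => f z.1 * g z.2).
have mF : measurable_fun setT F.
  apply/measurable_EFinP; apply: measurable_funM.
    by apply: (measurableT_comp mf); exact: measurable_fst.
  by apply: (measurableT_comp mg); exact: measurable_snd.
have Fi : (@lebesgue2 R).-integrable setT F.
  apply/(@integrable12ltyP _ _ _ _ R mu mu F mF).
  have /integrableP[_ foo] := fi; have /integrableP[_ goo] := gi.
  have g0 : (0 <= \int[mu]_y `|(g y)%:E|)%E by apply: integral_ge0.
  have gfin : (\int[mu]_y `|(g y)%:E|)%E \is a fin_num by rewrite ge0_fin_numE.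
  under eq_integral do (under eq_integral do rewrite /F /= normrM EFinM).
  under eq_integral => x _.
    rewrite ge0_integralZl//; last exact/measurable_EFinP/measurableT_comp.
    over.
  rewrite /=; have := gfin; move=> /fineK <-.
  rewrite ge0_integralZr; [|by []|exact/measurable_EFinP/measurableT_comp|by []|by rewrite lee_fin fine_ge0].
  have f0 : (0 <= \int[mu]_x `|(f x)%:E|)%E by apply: integral_ge0.
  by apply: lte_mul_pinfty; [exact: f0|rewrite ge0_fin_numE|rewrite ltry].
split => //.
have E := @integral12_prod_meas1 _ _ _ _ R mu mu F Fi.
rewrite /Rintegral -[X in fine X]E.
have ffin := integrable_fin_num measurableT fi.
have gfin := integrable_fin_num measurableT gi.
rewrite /fubini_F /F /=.
under eq_integral => x _.
  under eq_integral do rewrite EFinM.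
  rewrite integralZl//.
  rewrite -(fineK gfin).
  over.
rewrite /= integralZr//.
by rewrite -[X in fine (X * _)](fineK ffin) -EFinM.
Qed.

Lemma integral_prod (J J' : set mR) (f g : mR -> R) : measurable J -> measurable J' ->
  mu.-integrable J (EFin \o f) -> mu.-integrable J' (EFin \o g) ->
  (@lebesgue2 R).-integrable (J `*` J') (EFin \o (fun z : mR2 => f z.1 * g z.2)) /\
  \int[@lebesgue2 R]_(z in J `*` J') (f z.1 * g z.2) =
  \int[mu]_(x in J) f x * \int[mu]_(x in J') g x.
Proof.
move=> mJ mJ' fi gi.
have res (I : set mR) (h : mR -> R) : (EFin \o h) \_ I = EFin \o (h \_ I).
  by apply/funext => x; rewrite /patch /=; case: ifP.
have fi' : mu.-integrable setT (EFin \o (f \_ J)) by rewrite -res; exact/(integrable_mkcond _ mJ).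
have gi' : mu.-integrable setT (EFin \o (g \_ J')) by rewrite -res; exact/(integrable_mkcond _ mJ').
have [H1 H2] := integral_prodT fi' gi'.
have E : (fun z : mR2 => (f \_ J) z.1 * (g \_ J') z.2) = (fun z : mR2 => f z.1 * g z.2) \_ (J `*` J').
  apply/funext => -[x y] /=; rewrite /patch /=.
  have -> : ((x, y) \in J `*` J') = (x \in J) && (y \in J').
    by apply/idP/andP; rewrite !inE /=.
  by case: (x \in J) => /=; case: (y \in J'); rewrite ?mul0r ?mulr0.
rewrite E in H1 H2; split.
  apply/(integrable_mkcond _ (measurableX mJ mJ')).
  rewrite [X in _.-integrable _ X](_ : _ = EFin \o ((fun z : mR2 => f z.1 * g z.2) \_ (J `*` J')))//.
  by apply/funext => x; rewrite /patch /=; case: ifP.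
by rewrite Rintegral_mkcond H2 -!Rintegral_mkcond.
Qed.

End product_integrals.

Section stationary_super.
Context {R : realType}.
Local Notation mR := (measurableTypeR R).
Local Notation mR2 := (mR * mR)%type.
Local Notation mu := (@lebesgue_measure R).
Variables (m c r x0 : R) (V V1 V2 : R -> R).
Let I : set R := [set x | x < x0].
Hypotheses (w1 : weak_derivative1 I V V1) (w2 : weak_derivative1 I V1 V2).
Hypothesis V0 : {ae mu, forall x, I x -> 0 <= - (m * V2 x + c * V1 x - r * V x)}.

Lemma mol_shift_derive (d y x : R) :
  is_derive x 1 (fun x => mol d (x - y)) (mol1 d (x - y)) /\
  is_derive x 1 (fun x => mol1 d (x - y)) (mol2 d (x - y)).
Proof.
have s : is_derive x 1 (fun x : R => x - y) 1.
  by have := is_deriveB (is_derive_id x 1) (is_derive_cst y x 1); rewrite subr0.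
split.
  have := @is_derive1_comp R (mol d) (fun x : R => x - y) x _ _ (is_derive_mol d (x - y)) s.
  by rewrite mulr1.
have := @is_derive1_comp R (mol1 d) (fun x : R => x - y) x _ _ (is_derive_mol1 d (x - y)) s.
by rewrite mulr1.
Qed.

Lemma mol_shift_test_function (d y : R) : y + d < x0 ->
  test_function I (fun x => mol d (x - y)) /\ test_function I (fun x => mol1 d (x - y)).
Proof.
move=> yd.
have D1 : 'D_1 (fun x => mol d (x - y)) = fun x => mol1 d (x - y).
  by apply/funext => x; have [[_ ->] _] := mol_shift_derive d y x.
have sub : `[y - d, y + d]%classic `<=` I.
  by move=> x; rewrite /= in_itv /= => /andP[_ h]; rewrite /I /=; lra.
have out (x : R) : ~ `[y - d, y + d]%classic x -> d <= `|x - y|.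
  move=> h; rewrite leNgt; apply/negP; rewrite ltr_norml => /andP[h1 h2]; apply: h.
  by rewrite /= in_itv /=; apply/andP; split; lra.
split; split; [exact: smooth_mol1| |rewrite -D1; exact/smooth_derive/smooth_mol1|];
  exists `[y - d, y + d]%classic; split => //; try exact: segment_compact.
- by move=> x /out; exact: mol_out.
- by move=> x /out; exact: mol1_out.
Qed.

(** [mol1] is the derivative of [mol], which vanishes at both ends. This removes the time derivative
    when the tested function does not depend on time. *)
Lemma integral_mol1 (d y a b : R) : a < b -> d <= y - a -> d <= b - y ->
  \int[mu]_(t in `[a, b]) mol1 d (t - y) = 0.
Proof.
move=> ab ya by_.
have cm1 : continuous (fun t => mol1 d (t - y)).
  by move=> t; apply/differentiable_continuous/derivable1_diffP; case: (mol_shift_derive d y t) => _ [].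
have cm : continuous (fun t => mol d (t - y)).
  by move=> t; apply/differentiable_continuous/derivable1_diffP; case: (mol_shift_derive d y t) => -[].
have := @continuous_FTC2 R (fun t => mol1 d (t - y)) (fun t => mol d (t - y)) a b ab
  (continuous_subspaceT cm1).
rewrite /Rintegral => ->.
- rewrite -EFinB /= !mol_out ?subrr//.
    by have := ler_norm (- (a - y)); rewrite normrN; lra.
  by have := ler_norm (b - y); lra.
- split.
  + by move=> t _; case: (mol_shift_derive d y t) => -[].
  + by apply: cvg_at_right_filter; exact: cm.
  + by apply: cvg_at_left_filter; exact: cm.
- by move=> t _; rewrite derive1E; have [[_ ->] _] := mol_shift_derive d y t.
Qed.

(** By Fubini each test integral splits into an integral in x and one in t. The time-derivative term
    has t-factor zero, the other three share the nonnegative factor [beta], and their x-part is the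
    weak stationary inequality tested with a nonnegative kernel. *)
Lemma stationary_dist_super (z : R * R) (rho : R) : 0 < rho -> z.1 + rho < x0 ->
  dist_super m c r (cbox z rho) (fun s => V s.1).
Proof.
move=> rho0 zr.
have mN := @measurable_cbox R z rho.
pose J : set mR := `[z.1 - rho, z.1 + rho]%classic.
pose J' : set mR := `[z.2 - rho, z.2 + rho]%classic.
have mJ : measurable J by exact: measurable_itv.
have mJ' : measurable J' by exact: measurable_itv.
have cJ : compact J by exact: segment_compact.
have JI : J `<=` I by move=> x; rewrite /J /I /= in_itv /= => /andP[_ h]; lra.
have [l0 l1 W1] := w1; have [_ l2 W2] := w2.
have i0 := l0 J cJ JI; have i1 := l1 J cJ JI; have i2 := l2 J cJ JI.
have J'fin : (mu J' < +oo)%E by rewrite /J' lebesgue_measure_itv /=; case: ifP => _; rewrite -?EFinB ltry.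
have iC (g : R -> R) : continuous g -> (exists2 C, 0 <= C & forall x, `|g x| <= C) ->
    mu.-integrable J' (EFin \o g).
  move=> cg [C C0 gC]; apply: measurable_bounded_integrable => //.
    by apply: measurable_funTS; exact: continuous_measurable_fun.
  exists C; split; first exact: num_real.
  by move=> M CM x _ /=; apply: le_trans (gC x) (ltW CM).
have iV : (@lebesgue2 R).-integrable (cbox z rho) (EFin \o (fun s => V s.1)).
  have one : mu.-integrable J' (EFin \o (fun=> 1)).
    by apply: iC => [x|]; [exact: cvg_cst|exists 1 => // x; rewrite normr1].
  have [H _] := integral_prod mJ mJ' i0 one.
  by move: H; under eq_fun do rewrite mulr1.
have nE : (fun s : mR2 => - V s.1) = (fun s => (-1) * V s.1).
  by apply/funext => s; rewrite mulN1r.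
split => //; first by rewrite nE; exact: integrable_scale.
move=> d y d0 yN.
have [y1a y1b y2a y2b] : [/\ z.1 - rho <= y.1 - d, y.1 + d <= z.1 + rho,
    z.2 - rho <= y.2 - d & y.2 + d <= z.2 + rho].
  have p1 : cbox y d (y.1 - d, y.2 - d).
    have e (u : R) : u - d - u = - d by ring.
    by apply/cboxP; rewrite /= !e normrN gtr0_norm.
  have p2 : cbox y d (y.1 + d, y.2 + d).
    have e (u : R) : u + d - u = d by ring.
    by apply/cboxP; rewrite /= !e gtr0_norm.
  have /cboxP[/=] := yN _ p1; have /cboxP[/=] := yN _ p2.
  rewrite !ler_norml => /andP[a1 a2] /andP[a3 a4] /andP[a5 a6] /andP[a7 a8].
  by split; lra.
have yx0 : y.1 + d < x0 by lra.
have shift_cont (f : R -> R) (u : R) : continuous f -> continuous (fun x => f (x - u)).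
  move=> cf x; apply: (@continuous_comp _ _ _ (fun x => x - u) f); last exact: cf.
  by apply: cvgB; [exact: cvg_id|exact: cvg_cst].
have iK (U f : R -> R) : mu.-integrable J (EFin \o U) -> continuous f ->
    (exists2 C, 0 <= C & forall x, `|f x| <= C) ->
    mu.-integrable J (EFin \o (fun x => U x * f (x - y.1))).
  move=> Ui cf [C C0 fC]; apply: (@integrable_bounded_mul _ _ _ _ _ _ _ C) => //.
  by apply: continuous_measurable_fun => x; exact: (shift_cont f y.1 cf x).
have prod (f g : R -> R) : continuous f -> continuous g ->
    (exists2 C, 0 <= C & forall x, `|f x| <= C) -> (exists2 C, 0 <= C & forall x, `|g x| <= C) ->
    \int[@lebesgue2 R]_(s in cbox z rho) (V s.1 * (f (s.1 - y.1) * g (s.2 - y.2))) =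
    \int[mu]_(x in J) (V x * f (x - y.1)) * \int[mu]_(t in J') g (t - y.2).
  move=> cf cg bf bg.
  have gi : mu.-integrable J' (EFin \o (fun t => g (t - y.2))).
    apply: iC; first exact: shift_cont.
    by have [C C0 gC] := bg; exists C.
  have [_ <-] := integral_prod mJ mJ' (iK V f i0 cf bf) gi.
  by apply: eq_Rintegral => s _; rewrite mulrA.
have c0 := @continuous_mol R d; have c1 := @continuous_mol1 R d; have c2 := @continuous_mol2 R d.
have b0 := @mol_bounded R d; have b1 := @mol1_bounded R d; have b2 := @mol2_bounded R d.
have toJ (U f : R -> R) : (forall x, d <= `|x| -> f x = 0) ->
    \int[mu]_(x in I) (U x * f (x - y.1)) = \int[mu]_(x in J) (U x * f (x - y.1)).
  move=> f0; apply: Rintegral_supp => // x _ xJ; rewrite f0 ?mulr0//.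
  rewrite leNgt; apply/negP; rewrite ltr_norml => /andP[h1 h2]; apply: xJ.
  by rewrite /J /= in_itv /=; apply/andP; split; lra.
have [t1 t2] := mol_shift_test_function yx0.
have D1 : 'D_1 (fun x => mol d (x - y.1)) = fun x => mol1 d (x - y.1).
  by apply/funext => x; have [[_ ->] _] := mol_shift_derive d y.1 x.
have D2 : 'D_1 (fun x => mol1 d (x - y.1)) = fun x => mol2 d (x - y.1).
  by apply/funext => x; have [_ [_ ->]] := mol_shift_derive d y.1 x.
have chg (v f g : R -> R) : f = g ->
    \int[mu]_(x in I) (v x * f x) = \int[mu]_(x in I) (v x * g x) by move=> ->.
have m0 := @mol_out R d; have m1 := @mol1_out R d; have m2 := @mol2_out R d.
have := W1 _ t1; rewrite (chg _ _ _ D1) (toJ _ _ m1) (toJ _ _ m0) => E1.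
have := W1 _ t2; rewrite (chg _ _ _ D2) (toJ _ _ m2) (toJ _ _ m1) => E2.
have := W2 _ t1; rewrite (chg _ _ _ D1) (toJ _ _ m1) (toJ _ _ m0) => E3.
have -> : (fun s : mR2 => - V s.1 * adj_mol m c r d y s) =
    (fun s => (-1) * (V s.1 * adj_mol m c r d y s)).
  by apply/funext => s; ring.
rewrite RintegralZl//; last exact: (adj_molE _ _ _ _ _ mN iV).1.
rewrite (adj_molE _ _ _ _ _ mN iV).2 !prod// E2 E1 E3.
rewrite (@integral_mol1 d y.2 (z.2 - rho) (z.2 + rho)); [|lra..].
set beta := \int[mu]_(t in J') mol d (t - y.2).
have beta0 : 0 <= beta by apply: Rintegral_ge0 => t _; exact: mol_ge0.
have k0 := iK V _ i0 c0 b0; have k1 := iK V1 _ i1 c0 b0; have k2 := iK V2 _ i2 c0 b0.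
(* Only three terms are present; the fourth slot is filled with coefficient 0. *)
have [H1 H2] := Rintegral_lin4 m c (- r) 0 mJ k2 k1 k0 k0.
have : \int[mu]_(x in J) (m * (V2 x * mol d (x - y.1)) + (c * (V1 x * mol d (x - y.1))
    + (- r * (V x * mol d (x - y.1)) + 0 * (V x * mol d (x - y.1))))) <= 0.
  apply: Rintegral_ae_le0 => //; apply: ae_imp V0 => x Hx /JI /Hx h.
  have -> : m * (V2 x * mol d (x - y.1)) + (c * (V1 x * mol d (x - y.1))
    + (- r * (V x * mol d (x - y.1)) + 0 * (V x * mol d (x - y.1)))) =
    - ((- (m * V2 x + c * V1 x - r * V x)) * mol d (x - y.1)) by ring.
  by rewrite oppr_le0 mulr_ge0// mol_ge0.
rewrite H2.
set A0 := \int[mu]_(x in J) (V x * _); set A1 := \int[mu]_(x in J) (V1 x * _).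
set A2 := \int[mu]_(x in J) (V2 x * _) => h.
have := ler_wpM2l beta0 h; clear; lra.
Qed.

End stationary_super.

(** * Stationary solution and barrier *)

Section comparison_with_stationary.
Context {R : realType}.
Variables (K1 k1 K2 sigma r q : R).
Hypotheses (sigma0 : 0 < sigma) (r0 : 0 < r).
Let m := sigma ^+ 2 / 2.
Let c := r - q - sigma ^+ 2 / 2.

Lemma half_sqr_gt0 : 0 < m.
Proof. by rewrite /m divr_gt0// exprn_gt0. Qed.

Lemma sub_cboxS (z : R * R) (e e' : R) : e <= e' -> cbox z e `<=` cbox z e'.
Proof. by move=> le s /cboxP[s1 s2]; apply/cboxP; split; exact: le_trans le. Qed.

Lemma box_continuous_fst (x0 T : R) (U : R -> R) :
  {within [set x | x <= x0], continuous U} ->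
  box_continuous (strip x0 T) (fun z => U z.1).
Proof.
move=> cU z [z1 _] e e0.
have /cvgrPdist_le /(_ _ e0) H := cU z.1.
have {H} : nbhs_subspace (z.1 : subspace [set x | x <= x0]) [set s | `|U z.1 - U s| <= e] := H.
rewrite -(@nbhs_subspace_in _ [set x | x <= x0] z.1 z1) => /nbhs_ballP[d /= d0 Hd]; exists (d / 2); first by rewrite divr_gt0.
move=> s [s1 _] /cboxP[zs _]; rewrite distrC; apply: Hd => //.
by rewrite /ball /= distrC; lra.
Qed.

Section with_solution.
Variables (p T : R) (Y : R * R -> R).
Hypothesis hY : bounded_strong_solution K1 k1 K2 sigma r q p T Y.

Lemma strong_box_continuous : box_continuous (strip (ln k1) T) Y.
Proof. by have [[? [? [? [[cY _ _ _ _] _ _ _ _]]]] _] := hY; apply/within_box_continuous. Qed.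

Lemma strong_continuous_at (z : R * R) : z.1 < ln k1 -> 0 < z.2 < T -> {for z, continuous Y}.
Proof.
move=> z1 z2; have [e e0 He] := Qint_cbox z1 z2.
exact: (box_continuous_interior e0 (subset_trans He (@Qint_strip R k1 T)) strong_box_continuous).
Qed.

(** The constraint is given for x < ln k1 and positive times; on the lateral boundary the prescribed
    value K2 - K1 equals psi_1(ln k1), and at time 0 the data are psi_1 itself. *)
Lemma strong_ge_psi1 (z : R * R) : 0 < k1 -> K1 < k1 -> strip (ln k1) T z -> psi1 K1 k1 K2 z.1 <= Y z.
Proof.
move=> k10 K1k1 [z1 /andP[z2 z3]].
have [[? [? [? [_ geY _ _ [Yinit Ylat]]]]] _] := hY.
have [x1|x1] := ltP z.1 (ln k1); last first.
  have e : z.1 = ln k1 by apply/eqP; rewrite eq_le z1.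
  rewrite [X in Y X]surjective_pairing e Ylat ?z2// /psi1 lnK ?posrE//.
  by rewrite max_l; lra.
have [t0|t0] := ltP 0 z.2; first by apply: geY; split => //; rewrite t0.
have e : z.2 = 0 by apply/eqP; rewrite eq_le t0.
by rewrite [X in Y X]surjective_pairing e Yinit.
Qed.

Lemma strong_visc_sub (z : R * R) : z.1 < ln k1 -> 0 < z.2 < T ->
  psi1 K1 k1 K2 z.1 < Y z -> visc_sub m c r Y z.
Proof.
move=> z1 z2 zpsi; have [e1 e10 He1] := Qint_cbox z1 z2.
have cY := strong_continuous_at z1 z2.
have [e3 e30 He3] := gt_psi1_near cY zpsi.
have e0 : 0 < Num.min e1 e3 by rewrite lt_min e10.
have ee1 : Num.min e1 e3 <= e1 by rewrite ge_min lexx.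
have ee3 : Num.min e1 e3 <= e3 by rewrite ge_min lexx orbT.
have [_ H] := strong_solution_dist hY.1 (subset_trans (sub_cboxS ee1) He1).
have D := H (fun s hs => He3 s (sub_cboxS ee3 hs)).
exact: (dist_sub_visc_sub half_sqr_gt0 r0 e0 D cY).
Qed.

(** Unlike the subsolution property, this one is available at contact points, where it restricts
    their location. *)
Lemma strong_visc_super (z : R * R) : z.1 < ln k1 -> 0 < z.2 < T ->
  visc_sub m c r (fun s => - Y s) z.
Proof.
move=> z1 z2; have [e1 e10 He1] := Qint_cbox z1 z2.
have cY := strong_continuous_at z1 z2.
have [D _] := strong_solution_dist hY.1 He1.
apply: (dist_sub_visc_sub half_sqr_gt0 r0 e10 D).
by apply: cvgN; exact: cY.
Qed.

Lemma strong_le_stationary (p' : R) (V : R -> R) :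
  0 < k1 -> K1 < k1 -> stationary_strong_solution K1 k1 K2 sigma r q p' V ->
  forall x t, x <= ln k1 -> 0 <= t <= T -> Y (x, t) <= V x.
Proof.
move=> k10 K1k1 [[M' HM'] [cV [V1 [V2 [[w1 w2] _ geV [V0 _] Vlat]]]]] x t xk tT.
have [sY [M HM]] := hY.
have [? [? [? [_ geY _ _ [Yinit Ylat]]]]] := sY.
have cW := box_continuousB strong_box_continuous (box_continuous_fst (T := T) cV).
suff : Y (x, t) - V x <= 0 by rewrite subr_le0.
apply: (@maximum_principle R m c r (ln k1) T (fun z => Y z - V z.1) (M + M')
  half_sqr_gt0 r0 cW _ _ _ _ (x, t)) => //.
- move=> z zS; have h1 := HM z zS; have h2 := HM' z.1 (zS.1).
  have := ler_norm (Y z); have := ler_norm (- V z.1); rewrite normrN; lra.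
- move=> u uk; rewrite subr_le0 /=.
  have [uk1|uk1] := ltP u (ln k1); first by rewrite Yinit// geV.
  have -> : u = ln k1 by apply/eqP; rewrite eq_le uk.
  by rewrite Ylat ?Vlat//; move: tT => /andP[? ?]; apply/andP; split; lra.
- by move=> s sT; rewrite /= Ylat// Vlat subrr.
- move=> z z1 z2; rewrite subr_gt0 => wz.
  have [e1 e10 He1] := Qint_cbox z1 z2.
  have cY := strong_continuous_at z1 z2.
  have zpsi : psi1 K1 k1 K2 z.1 < Y z by apply: le_lt_trans wz; exact: geV.
  have [e3 e30 He3] := gt_psi1_near cY zpsi.
  pose e := Num.min (Num.min e1 e3) ((ln k1 - z.1) / 2).
  have e0 : 0 < e by rewrite !lt_min e10 e30 divr_gt0// subr_gt0.
  have ee1 : e <= e1 by rewrite !ge_min lexx.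
  have ee3 : e <= e3 by rewrite !ge_min lexx orbT.
  have ez : z.1 + e < ln k1.
    have : e <= (ln k1 - z.1) / 2 by rewrite !ge_min lexx !orbT.
    by move=> ?; lra.
  have [_ H] := strong_solution_dist sY (subset_trans (sub_cboxS ee1) He1).
  have D := H (fun s hs => He3 s (sub_cboxS ee3 hs)).
  have D' := stationary_dist_super w1 w2 V0 e0 ez.
  apply: (dist_sub_visc_sub half_sqr_gt0 r0 e0 (dist_subB D D')).
  exact: (box_continuous_interior e10 (subset_trans He1 (@Qint_strip R k1 T)) cW).
Qed.

(* [U] may have convex kinks smoothed from above: at each point only a one-point
   second-order upper expansion with the supersolution inequality is required. *)
Lemma strong_le_barrier (U : R -> R) : 0 < k1 -> continuous U ->
  (forall x, x <= ln k1 -> psi1 K1 k1 K2 x <= U x) -> K2 - K1 <= U (ln k1) -> 0 <= K2 - k1 ->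
  (forall x, x < ln k1 -> exists h1 h2 : R, 2 * m * h2 + c * h1 - r * U x <= 0 /\
     forall eps, 0 < eps -> exists2 rho, 0 < rho & forall y, `|y - x| <= rho ->
       U y <= U x + h1 * (y - x) + (h2 + eps) * (y - x) ^+ 2) ->
  forall x t, x <= ln k1 -> 0 <= t <= T -> Y (x, t) <= U x.
Proof.
move=> k10 cU geU Ulat K2k1 HU x t xk tT.
have [sY [M HM]] := hY.
have [? [? [? [_ geY _ _ [Yinit Ylat]]]]] := sY.
have cW := box_continuousB strong_box_continuous
  (box_continuous_fst (T := T) (continuous_subspaceT (A := [set x | x <= ln k1]) cU)).
suff : Y (x, t) - U x <= 0 by rewrite subr_le0.
have m0 := half_sqr_gt0.
apply: (@maximum_principle R m c r (ln k1) T (fun z => Y z - U z.1) M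
  m0 r0 cW _ _ _ _ (x, t)) => //.
(* As K2 - k1 >= 0, the obstacle and hence [U] is nonnegative, so the bound of [Y] also bounds Y - U
   from above. *)
- move=> z zS; have h1 := HM z zS; have h2 := geU z.1 (zS.1).
  have h3 : 0 <= Num.max (expR z.1 - K1) 0 by rewrite le_max lexx orbT.
  by have := ler_norm (Y z); move: h2; rewrite /psi1; lra.
- move=> u uk; rewrite subr_le0 /=.
  have [uk1|uk1] := ltP u (ln k1); first by rewrite Yinit// geU.
  have -> : u = ln k1 by apply/eqP; rewrite eq_le uk.
  by rewrite Ylat//; move: tT => /andP[? ?]; apply/andP; split; lra.
- by move=> s sT; rewrite /= Ylat// subr_le0.
- move=> z z1 z2; rewrite subr_gt0 => wz rho pt C px X rho0 maj.
  have zpsi : psi1 K1 k1 K2 z.1 < Y z by apply: le_lt_trans wz; exact: geU (ltW z1).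
  have vs := strong_visc_sub z1 z2 zpsi.
  have [h1 [h2 [Lh Hh]]] := HU z.1 z1.
  (* Adding the upper expansion of [U] to the polynomial touching Y - U gives one touching [Y], for
     which the inequality is known. *)
  have key eps : 0 < eps -> pt - 2 * m * (X + h2 + eps) - c * (px + h1) + r * Y z <= 0.
    move=> eps0; have [rho' rho'0 Hrho'] := Hh eps eps0.
    have e0 : 0 < Num.min rho rho' by rewrite lt_min rho0.
    apply: (vs (Num.min rho rho') pt C (px + h1) (X + h2 + eps) e0) => s hs.
    have hs1 : cbox z rho s by apply: sub_cboxS hs; rewrite ge_min lexx.
    have /cboxP[hs2 _] : cbox z rho' s by apply: sub_cboxS hs; rewrite ge_min lexx orbT.
    by have := maj s hs1; have := Hrho' _ hs2; lra.
  rewrite leNgt; apply/negP; set g := (X in 0 < X) => g0.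
  (* This choice costs 2 m eps = g/2, half of the supposed excess. *)
  have := key (g / (4 * m)); rewrite divr_gt0 ?mulr_gt0// => /(_ isT).
  have -> : 2 * m * (X + h2 + g / (4 * m)) = 2 * m * X + 2 * m * h2 + g / 2.
    by field; rewrite gt_eqF.
  have gE : g = pt - 2 * m * X - c * px + r * (Y z - U z.1) by [].
  move: gE g0 Lh; clearbody g; move: m c => m' c'; clear; move=> *; lra.
Qed.

End with_solution.

End comparison_with_stationary.

(** * Second-order expansions of exponentials *)

Section exponential_expansion.
Context {R : realType}.

(** From 1 + x <= e^x <= 1/(1 - x), the derivative e^x - 1 - x is at most 2 x^2 for |x| <= 1/2; the
    mean value theorem turns this into the cubic bound. *)
Lemma expR_taylor2 (s : R) : `|s| <= 2^-1 -> `|expR s - 1 - s - s ^+ 2 / 2| <= 2 * `|s| ^+ 3.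
Proof.
move=> s2.
pose f (x : R) := expR x - 1 - x - x ^+ 2 / 2.
pose f1 (x : R) := expR x - 1 - x.
have df (x : R) : is_derive x 1 f (f1 x).
  have := is_deriveB (is_deriveB (is_deriveB (is_derive_expR x) (is_derive_cst (1 : R) x 1))
    (is_derive_id x 1)) (is_deriveZ 2^-1 (is_deriveX 2 (is_derive_id x 1))).
  move=> H; have -> : f = (fun x => expR x - 1 - x - 2^-1 *: (x ^+ 2)).
    by apply/funext => y; rewrite /f /GRing.scale /= mulrC.
  by apply: (is_derive_eq H); rewrite /f1 /GRing.scale /=; field.
have f1b (x : R) : `|x| <= 2^-1 -> `|f1 x| <= 2 * `|x| ^+ 2.
  rewrite ler_norml => /andP[x1 x2].
  have h1 := expR_ge1Dx x.
  have h2 : expR x <= (1 - x)^-1.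
    have := expR_ge1Dx (- x); rewrite expRN => h.
    have x3 : 0 < 1 - x by lra.
    by rewrite -[expR x]invrK lef_pV2 ?posrE ?invr_gt0 ?expR_gt0.
  have x3 : 0 < 1 - x by lra.
  have h3 : (1 - x)^-1 <= 1 + x + 2 * x ^+ 2.
    rewrite -[leLHS]mul1r ler_pdivrMr//.
    have : 0 <= x ^+ 2 * (1 - 2 * x) by rewrite mulr_ge0 ?sqr_ge0//; lra.
    by lra.
  rewrite real_normK ?num_real// /f1 ger0_norm; lra.
have f0 : f 0 = 0 by rewrite /f expR0; ring.
have cf : continuous f.
  by move=> x; apply/differentiable_continuous/derivable1_diffP; case: (df x).
rewrite -/(f s) -[f s]subr0 -f0.
have bound (u : R) : `|u| <= `|s| -> `|f1 u| <= 2 * `|s| ^+ 2.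
  move=> us; apply: le_trans (f1b _ (le_trans us s2)) _.
  by rewrite ler_pM2l// lerXn2r// nnegrE.
have [s0|s0] := leP 0 s.
  have [u] := @MVT_segment R f f1 0 s s0 (fun x _ => df x) (continuous_subspaceT cf).
  rewrite in_itv /= => /andP[u1 u2] ->.
  rewrite normrM subr0 exprSr mulrA ler_wpM2r//; apply: bound.
  by rewrite !ger0_norm.
have [u] := @MVT_segment R f f1 s 0 (ltW s0) (fun x _ => df x) (continuous_subspaceT cf).
rewrite in_itv /= => /andP[u1 u2]; rewrite distrC => ->.
rewrite normrM sub0r normrN exprSr mulrA ler_wpM2r//; apply: bound.
by rewrite !ler0_norm ?lerN2// ltW.
Qed.

(** General amplitude and rate cover both exponentials of G as well as e^x. The two-sided form
    serves upper expansions for the barrier and lower ones at contact points with the payoff. *)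
Lemma expR_jet (A n x eps : R) : (0 : R) < eps -> exists2 rho, 0 < rho & forall y, `|y - x| <= rho ->
  `|A * expR (n * y) - A * expR (n * x) * (1 + n * (y - x) + n ^+ 2 / 2 * (y - x) ^+ 2)|
  <= eps * (y - x) ^+ 2.
Proof.
move=> eps0; pose B : R := `|A * expR (n * x)|.
pose S : R := 1 + `|n|; have S1 : 1 <= S by rewrite lerDl.
(* The cubic remainder is at most Q |d| d^2, whence the radius eps / Q; the other radius keeps |n d|
   within 1/2. *)
pose Q : R := 2 * (B + 1) * S ^+ 3.
have B0 : 0 <= B by exact: normr_ge0.
have S3 : 1 <= S ^+ 3 by rewrite exprn_ege1.
have Q0 : 0 < Q by rewrite /Q mulr_gt0 ?exprn_gt0//; lra.
exists (Num.min ((2 * S)^-1) (eps / Q)).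
  by rewrite lt_min divr_gt0// invr_gt0; lra.
move=> y; rewrite le_min => /andP[y1 y2].
set d := y - x in y1 y2 *.
have nS : `|n| <= S by rewrite lerDr.
have nd : `|n * d| <= S * `|d| by rewrite normrM ler_wpM2r.
have -> : A * expR (n * y) = A * expR (n * x) * expR (n * d).
  by rewrite -mulrA -expRD; congr (_ * expR _); rewrite /d; ring.
have -> : A * expR (n * x) * expR (n * d) - A * expR (n * x) * (1 + n * d + n ^+ 2 / 2 * d ^+ 2)
  = A * expR (n * x) * (expR (n * d) - 1 - n * d - (n * d) ^+ 2 / 2) by ring.
have hd : `|n * d| <= 2^-1.
  apply: le_trans nd _; have S0 : 0 <= S by lra.
  apply: le_trans (ler_wpM2l S0 y1) _.
  by have -> : S * (2 * S)^-1 = 2^-1 by field; lra.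
rewrite normrM -/B; apply: le_trans (ler_wpM2l B0 (expR_taylor2 hd)) _.
have h3 : `|n * d| ^+ 3 <= S ^+ 3 * (`|d| * d ^+ 2).
  have -> : `|d| * d ^+ 2 = `|d| ^+ 3 by rewrite -[d ^+ 2]real_normK ?num_real// -exprS.
  by rewrite -exprMn lerXn2r// nnegrE// (le_trans _ nd).
have dd : 0 <= d ^+ 2 := sqr_ge0 d.
have Qd : Q * `|d| <= eps by rewrite mulrC -ler_pdivlMr.
apply: (@le_trans _ _ (Q * `|d| * d ^+ 2)); last exact: ler_wpM2r.
have -> : Q * `|d| * d ^+ 2 = 2 * (B + 1) * (S ^+ 3 * (`|d| * d ^+ 2)) by rewrite /Q; ring.
have e0 : 0 <= S ^+ 3 * (`|d| * d ^+ 2).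
  by apply: mulr_ge0; [exact: le_trans S3|exact: mulr_ge0].
have := ler_wpM2l B0 h3; lra.
Qed.

End exponential_expansion.

(** * The explicit stationary profile as a barrier *)

Section stationary_barrier.
Context {R : realType}.
Variables (K1 k1 K2 sigma r q n1 n2 : R).
Hypotheses (hK1 : 0 < K1) (K1k1 : K1 < k1) (k1K2 : k1 < K2) (sigma0 : 0 < sigma)
  (r0 : 0 < r) (q0 : 0 <= q) (n10 : n1 < 0) (n20 : 0 < n2)
  (root1 : characteristic_root sigma r q n1) (root2 : characteristic_root sigma r q n2).
Let m := sigma ^+ 2 / 2.
Let c := r - q - sigma ^+ 2 / 2.
Let D := (K2 - k1) / (n2 - n1).
Let kap := K2 - k1 - K1.

Let m0 : 0 < m. Proof. by rewrite /m divr_gt0// exprn_gt0. Qed.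
Let D0 : 0 < D. Proof. by rewrite /D divr_gt0 ?subr_gt0// (lt_trans n10). Qed.

(** The characteristic polynomial takes the value -q at 1. Correspondingly (n - 1)(m n + r) equals n
    q plus that polynomial, which vanishes at [n2]. *)
Lemma n2_ge1 : 1 <= n2.
Proof.
have H : 0 <= (n2 - 1) * (m * n2 + r).
  have -> : (n2 - 1) * (m * n2 + r) = n2 * q + (m * n2 ^+ 2 + c * n2 - r).
    by rewrite /m /c; field.
  by have -> : m * n2 ^+ 2 + c * n2 - r = 0; [exact: root2|rewrite addr0 mulr_ge0// ltW].
by move: H; rewrite pmulr_lge0 ?subr_ge0// addr_gt0// mulr_gt0.
Qed.

Lemma n2_eq1 : q = 0 -> n2 = 1.
Proof.
move=> q00; have H : (n2 - 1) * (m * n2 + r) = 0.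
  have -> : (n2 - 1) * (m * n2 + r) = n2 * q + (m * n2 ^+ 2 + c * n2 - r).
    by rewrite /m /c; field.
  by have -> : m * n2 ^+ 2 + c * n2 - r = 0; [exact: root2|rewrite q00 mulr0 addr0].
have P : m * n2 + r != 0 by rewrite gt_eqF// addr_gt0// mulr_gt0.
by move/eqP: H; rewrite mulf_eq0 (negPf P) orbF subr_eq0 => /eqP.
Qed.

(* [Gfun] is the G of the stationary problem, and [tangency] the defect of smooth
   contact with the payoff e^x + kap. *)
Definition Gfun (u : R) : R := D * (n2 * expR (n1 * u) - n1 * expR (n2 * u)).
Definition Gfun1 (u : R) : R := D * n1 * n2 * (expR (n1 * u) - expR (n2 * u)).
Definition Gfun2 (u : R) : R := D * n1 * n2 * (n1 * expR (n1 * u) - n2 * expR (n2 * u)).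
Definition tangency (u : R) : R := Gfun u - Gfun1 u - kap.

Lemma Gfun_ode u : m * Gfun2 u + c * Gfun1 u - r * Gfun u = 0.
Proof.
have E1 : m * n1 ^+ 2 + c * n1 - r = 0 by exact: root1.
have E2 : m * n2 ^+ 2 + c * n2 - r = 0 by exact: root2.
have -> : m * Gfun2 u + c * Gfun1 u - r * Gfun u =
  D * n2 * expR (n1 * u) * (m * n1 ^+ 2 + c * n1 - r)
  - D * n1 * expR (n2 * u) * (m * n2 ^+ 2 + c * n2 - r).
  by rewrite /Gfun /Gfun1 /Gfun2; ring.
by rewrite E1 E2 !mulr0 subr0.
Qed.

Lemma Gfun0 : Gfun 0 = K2 - k1.
Proof.
rewrite /Gfun !mulr0 expR0 !mulr1 /D divfK// gt_eqF// subr_gt0.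
exact: lt_trans n20.
Qed.

(** Apply e^s >= 1 + s to both exponentials, with weights n2 and - n1: the linear terms cancel. *)
Lemma Gfun_ge u : K2 - k1 <= Gfun u.
Proof.
rewrite -Gfun0 /Gfun !mulr0 expR0 !mulr1 ler_pM2l//.
have h1 := ler_wpM2l (ltW n20) (expR_ge1Dx (n1 * u)).
have nn : 0 <= - n1 by rewrite oppr_ge0 ltW.
have h2 := ler_wpM2l nn (expR_ge1Dx (n2 * u)).
by move: h1 h2; lra.
Qed.

(** At smooth contact with the payoff, m (G'' - G') equals q e^x + r kap, so this sign makes the
    payoff a supersolution from the contact point on. *)
Lemma Gfun_convexity u : 0 <= Gfun2 u - Gfun1 u.
Proof.
have -> : Gfun2 u - Gfun1 u =
  D * (- n1 * n2) * ((1 - n1) * expR (n1 * u) + (n2 - 1) * expR (n2 * u)).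
  by rewrite /Gfun1 /Gfun2; ring.
have h := n2_ge1.
apply: mulr_ge0.
  by rewrite mulr_ge0 ?(ltW D0)// mulr_ge0 ?(ltW n20)// oppr_ge0 ltW.
apply: addr_ge0; apply: mulr_ge0; rewrite ?expR_ge0// subr_ge0//.
by rewrite ltW// (lt_trans n10).
Qed.

(** In [tangency] the decreasing exponential has the positive coefficient n2 (1 - n1), and the
    increasing one has n1 (n2 - 1) <= 0 by [n2_ge1]. *)
Lemma tangency_nonincr u v : u <= v -> tangency v <= tangency u.
Proof.
move=> uv.
have E w : tangency w = D * (n2 * (1 - n1) * expR (n1 * w) - (- n1 * (n2 - 1)) * expR (n2 * w)) - kap.
  by rewrite /tangency /Gfun /Gfun1; ring.
rewrite !E lerD2r ler_pM2l//; have h := n2_ge1; apply: lerB.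
  rewrite ler_wpM2l//; first by rewrite mulr_ge0 ?ltW// subr_gt0; exact: lt_trans ltr01.
  by rewrite ler_expR ler_wnM2l// ltW.
rewrite ler_wpM2l//; first by rewrite mulr_ge0 ?subr_ge0// oppr_ge0 ltW.
by rewrite ler_expR ler_wpM2l// ltW.
Qed.

Lemma is_derive_expM (n u : R) : is_derive u 1 (fun u => expR (n * u)) (n * expR (n * u)).
Proof.
have d1 : is_derive u 1 (fun u : R => n * u) n.
  by have := is_deriveZ n (is_derive_id u 1); rewrite [n *: 1]mulr1.
by have := @is_derive1_comp R expR (fun u : R => n * u) u _ _ (is_derive_expR _) d1; rewrite mulrC.
Qed.

Lemma is_derive_Gfun (u : R) : is_derive u 1 Gfun (Gfun1 u).
Proof.
have := is_deriveZ D (is_deriveB (is_deriveZ n2 (is_derive_expM n1 u)) (is_deriveZ n1 (is_derive_expM n2 u))).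
by move=> H; apply: (is_derive_eq H); rewrite /GRing.scale /Gfun1 /=; ring.
Qed.

Section levels.
Variables (a b : R).
Hypotheses (ab : a < b) (bk1 : b <= ln k1) (Gb : Gfun (b - a) = expR b + kap)
  (tb : 0 <= tangency (b - a)) (tb0 : b < ln k1 -> tangency (b - a) = 0).

(* (e^(-x) (G(x - a) - kap) - 1)' = - e^(-x) (G - G' - kap)(x - a) *)
Let phi x := expR (- 1 * x) * (Gfun (x - a) - kap) - 1.
Let dphi (x : R) : is_derive x 1 phi (- (expR (- 1 * x) * tangency (x - a))).
Proof.
have s : is_derive x 1 (fun x : R => x - a) 1.
  by have := is_deriveB (is_derive_id x 1) (is_derive_cst a x 1); rewrite subr0.
have dG := @is_derive1_comp R Gfun (fun x : R => x - a) x _ _ (is_derive_Gfun (x - a)) s.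
have := is_deriveB (is_deriveM (is_derive_expM (- 1) x) (is_deriveB dG (is_derive_cst kap x 1)))
  (is_derive_cst (1 : R) x 1).
move=> H; apply: (is_derive_eq H).
rewrite [X in _ + X *: _](_ : _ = Gfun (x - a) - kap)//.
by rewrite /GRing.scale /tangency /=; ring.
Qed.
Let cphi : continuous phi.
Proof. by move=> x; apply/differentiable_continuous/derivable1_diffP; case: (dphi x). Qed.

Let phi_ge0 x : (0 <= phi x) = (expR x + kap <= Gfun (x - a)).
Proof.
rewrite /phi subr_ge0 mulN1r expRN -[leLHS](@mulVf _ (expR x)) ?gt_eqF ?expR_gt0//.
by rewrite ler_pM2l ?invr_gt0 ?expR_gt0// lerBrDr.
Qed.

Let phib : phi b = 0.
Proof. by rewrite /phi Gb addrK mulN1r expRN mulVf ?subrr// gt_eqF// expR_gt0. Qed.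

(** [phi] vanishes at [b] and is nonincreasing to its left, because [tangency] is nonnegative
    there. *)
Lemma Gfun_above_left x : x <= b -> expR x + kap <= Gfun (x - a).
Proof.
move=> xb; rewrite -phi_ge0 -phib.
have [u] := @MVT_segment R phi _ x b xb (fun y _ => dphi y) (continuous_subspaceT cphi).
rewrite in_itv /= => /andP[u1 u2] E.
rewrite -subr_le0 E mulr_le0_ge0 ?subr_ge0// oppr_le0 mulr_ge0 ?expR_ge0//.
by apply: le_trans tb _; apply: tangency_nonincr; rewrite lerD2r.
Qed.

(** Under smooth contact [tangency] passes at [b] from nonnegative to nonpositive, so [b] minimises
    [phi]: the graph of G touches the payoff from above on both sides. *)
Lemma Gfun_above x : b < ln k1 -> expR x + kap <= Gfun (x - a).
Proof.
move=> bk; have [xb|/ltW xb] := leP x b; first exact: Gfun_above_left.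
rewrite -phi_ge0 -phib.
have [u] := @MVT_segment R phi _ b x xb (fun y _ => dphi y) (continuous_subspaceT cphi).
rewrite in_itv /= => /andP[u1 u2] E.
rewrite -subr_ge0 E mulr_ge0 ?subr_ge0// oppr_ge0 mulr_ge0_le0 ?expR_ge0//.
by rewrite -(tb0 bk); apply: tangency_nonincr; rewrite lerD2r.
Qed.

(** At [b] values and slopes of G and of the payoff agree, so the equation for G turns q e^b + r kap
    into m (G'' - G'); the expression does not decrease with x. *)
Lemma payoff_super x : b < ln k1 -> b <= x -> 0 <= q * expR x + r * kap.
Proof.
move=> bk bx; have t0 := tb0 bk.
have h1 : Gfun1 (b - a) = expR b.
  by move: t0; rewrite /tangency Gb; lra.
have h2 := Gfun_convexity (b - a); have h3 := Gfun_ode (b - a).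
have h4 : q * expR b + r * kap = m * (Gfun2 (b - a) - Gfun1 (b - a)).
  move: h3; rewrite h1 Gb /m /c; set s := sigma ^+ 2 / 2; set A := Gfun2 _.
  by move: kap => kp; lra.
apply: (@le_trans _ _ (q * expR b + r * kap)).
  by rewrite h4 mulr_ge0// ltW.
by rewrite lerD2r ler_wpM2l// ler_expR.
Qed.

(* One formula for the three pieces K2 - k1, G(x - a), e^x + kap, which makes
   continuity immediate. *)
Definition barrier (x : R) : R :=
  Gfun (Num.max a (Num.min x b) - a) + (expR (Num.max x b) - expR b).

Lemma barrier_left x : x <= a -> barrier x = K2 - k1.
Proof.
move=> xa; have xb := le_trans xa (ltW ab).
by rewrite /barrier (min_l xb) (max_l xa) (max_r xb) !subrr Gfun0 addr0.
Qed.

Lemma barrier_mid x : a <= x -> x <= b -> barrier x = Gfun (x - a).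
Proof. by move=> ax xb; rewrite /barrier (min_l xb) (max_r ax) (max_r xb) subrr addr0. Qed.

Lemma barrier_right x : b <= x -> barrier x = expR x + kap.
Proof.
by move=> bx; rewrite /barrier (min_r bx) (max_r (ltW ab)) (max_l bx) Gb; ring.
Qed.

Lemma expRa_le : expR a <= K1.
Proof. by have := Gfun_above_left (ltW ab); rewrite subrr Gfun0 /kap; lra. Qed.

Lemma expRb_ge : K1 <= expR b.
Proof. by have := Gfun_ge (b - a); rewrite Gb /kap; lra. Qed.

Lemma barrier_ge_psi1 x : psi1 K1 k1 K2 x <= barrier x.
Proof.
suff [H1 H2] : K2 - k1 <= barrier x /\ expR x + kap <= barrier x.
  have : Num.max (expR x - K1) 0 <= barrier x - (K2 - k1).
    by rewrite ge_max subr_ge0 H1 andbT; move: H2; rewrite /kap; lra.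
  by rewrite /psi1; lra.
have [xa|/ltW ax] := leP x a.
  rewrite barrier_left//; split => //.
  have := expRa_le; have : expR x <= expR a by rewrite ler_expR.
  by rewrite /kap; lra.
have [xb|/ltW bx] := leP x b.
  by rewrite barrier_mid//; split; [exact: Gfun_ge|exact: Gfun_above_left].
rewrite barrier_right//; split => //.
have := expRb_ge; have : expR b <= expR x by rewrite ler_expR.
by rewrite /kap; lra.
Qed.

Lemma continuous_barrier : continuous barrier.
Proof.
have cG : continuous Gfun.
  by move=> u; apply/differentiable_continuous/derivable1_diffP; case: (is_derive_Gfun u).
have cid (x : R) : (fun y : R => y) y @[y --> x] --> x by exact: cvg_id.
have cmax (k : R) (f : R -> R) : continuous f -> continuous (fun x => Num.max k (f x)).
  move=> cf; have -> : (fun x => Num.max k (f x)) = fun x => (k + f x + `|k - f x|) / 2.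
    by apply/funext => x; rewrite maxr_absE.
  move=> x; apply: cvgM; last exact: cvg_cst.
  apply: cvgD; first by apply: cvgD; [exact: cvg_cst|exact: cf].
  have h : (fun y => k - f y) y @[y --> x] --> k - f x by apply: cvgB; [exact: cvg_cst|exact: cf].
  exact: (cvg_norm h).
have cmin : continuous (fun x => Num.min x b).
  have -> : (fun x => Num.min x b) = fun x => x + b - Num.max b x.
    by apply/funext => x; rewrite -(addr_max_min x b) maxC addrC addKr.
  move=> x; apply: cvgB; first by apply: cvgD; [exact: cid|exact: cvg_cst].
  exact: (cmax b id).
have caff : continuous (fun x => Num.max a (Num.min x b) - a).
  by move=> x; apply: cvgB; [exact: (cmax a _ cmin)|exact: cvg_cst].
have cexp : continuous (fun x => expR (Num.max x b)).
  move=> x; apply: (@continuous_comp _ _ _ (fun x => Num.max x b) expR); last exact: continuous_expR.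
  have -> : (fun x => Num.max x b) = (fun x => Num.max b x).
    by apply/funext => y; rewrite maxC.
  exact: (cmax b id).
move=> x; apply: cvgD.
  exact: (@continuous_comp _ _ _ (fun x => Num.max a (Num.min x b) - a) Gfun x (caff x) (cG _)).
by apply: cvgB; [exact: cexp|exact: cvg_cst].
Qed.

Lemma Gfun_jet (u eps : R) : 0 < eps -> exists2 rho, 0 < rho & forall v, `|v - u| <= rho ->
  Gfun v <= Gfun u + Gfun1 u * (v - u) + (Gfun2 u / 2 + eps) * (v - u) ^+ 2.
Proof.
move=> eps0; have e2 : 0 < eps / 2 by rewrite divr_gt0.
have [r1 r10 H1] := expR_jet (D * n2) n1 u e2.
have [r2 r20 H2] := expR_jet (- D * n1) n2 u e2.
exists (Num.min r1 r2); first by rewrite lt_min r10.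
move=> v; rewrite le_min => /andP[v1 v2].
have := H1 v v1; have := H2 v v2; rewrite !ler_norml => /andP[_ h2] /andP[_ h1].
move: h1 h2; rewrite /Gfun /Gfun1 /Gfun2; move: D => D'.
set e1v := expR (n1 * v); set e1u := expR (n1 * u).
set e2v := expR (n2 * v); set e2u := expR (n2 * u).
by move=> h1 h2; lra.
Qed.

(** The expansion of G serves on all of [a, b], junctions included: the constant piece and, under
    smooth contact, the payoff piece lie below the continuation of G. Elsewhere the constant has
    zero derivatives and the payoff satisfies [payoff_super]. *)
Lemma barrier_supersolution x : x < ln k1 ->
  exists h1 h2 : R, 2 * m * h2 + c * h1 - r * barrier x <= 0 /\
  forall eps, 0 < eps -> exists2 rho, 0 < rho & forall y, `|y - x| <= rho ->
    barrier y <= barrier x + h1 * (y - x) + (h2 + eps) * (y - x) ^+ 2.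
Proof.
move=> xk.
have [xa|ax] := ltP x a.
  exists 0, 0; split.
    rewrite !mulr0 add0r sub0r oppr_le0 (barrier_left (ltW xa)).
    by apply: mulr_ge0; [exact: ltW|rewrite subr_ge0 ltW].
  move=> eps eps0; exists (a - x) => [|y]; first by rewrite subr_gt0.
  rewrite ler_norml => /andP[_ yx]; rewrite (barrier_left (ltW xa)) barrier_left; last by lra.
  by rewrite mul0r addr0 add0r lerDl mulr_ge0 ?sqr_ge0// ltW.
have [xb|bx] := leP x b.
  have [rho0 rho00 Hrho0] : exists2 rho, 0 < rho & forall y, `|y - x| <= rho ->
      barrier y <= Gfun (y - a).
    have left y : y <= b -> barrier y <= Gfun (y - a).
      move=> yb; have [ya|/ltW ay] := leP y a; first by rewrite barrier_left// Gfun_ge.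
      by rewrite barrier_mid.
    (* If the cap binds, b = ln k1 and a small neighbourhood of x < ln k1 stays to the left of [b];
       otherwise smooth contact gives the bound on both sides. *)
    have [bk|kb] := ltP b (ln k1).
      exists 1 => // y _; have [|/ltW yb] := leP y b; first exact: left.
      by rewrite barrier_right// Gfun_above.
    exists (b - x) => [|y]; first by rewrite subr_gt0 (lt_le_trans xk).
    by rewrite ler_norml => /andP[_ yx]; apply: left; lra.
  exists (Gfun1 (x - a)), (Gfun2 (x - a) / 2); rewrite barrier_mid//; split.
    have := Gfun_ode (x - a).
    have -> : 2 * m * (Gfun2 (x - a) / 2) = m * Gfun2 (x - a) by field.
    by move=> ->.
  move=> eps eps0; have [rho rho0' Hrho] := Gfun_jet (x - a) eps0.
  exists (Num.min rho0 rho); first by rewrite lt_min rho00.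
  move=> y; rewrite le_min => /andP[y1 y2].
  apply: le_trans (Hrho0 y y1) _.
  have E : y - a - (x - a) = y - x by ring.
  by have := Hrho (y - a); rewrite E; apply.
have bk : b < ln k1 by apply: lt_trans xk.
exists (expR x), (expR x / 2); split.
  have := payoff_super bk (ltW bx); rewrite (barrier_right (ltW bx)).
  rewrite /m /c; set s := sigma ^+ 2 / 2; move: kap => kp; set e := expR x.
  by lra.
move=> eps eps0; have [rho rho0 Hrho] := expR_jet 1 1 x eps0.
exists (Num.min rho (x - b)); first by rewrite lt_min rho0 subr_gt0.
move=> y; rewrite le_min => /andP[/Hrho + yb].
have {}yb : b <= y by move: yb; rewrite ler_norml => /andP[yb _]; lra.
rewrite (barrier_right yb) (barrier_right (ltW bx)) !mul1r ler_norml => /andP[_ h].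
move: h; move: kap => kp; set ey := expR y; set ex := expR x; lra.
Qed.

End levels.

Lemma Gfun_nondecr u v : 0 <= u -> u <= v -> Gfun u <= Gfun v.
Proof.
move=> u0 uv.
have cG : continuous Gfun.
  by move=> x; apply/differentiable_continuous/derivable1_diffP; case: (is_derive_Gfun x).
have [w] := @MVT_segment R Gfun Gfun1 u v uv (fun x _ => is_derive_Gfun x) (continuous_subspaceT cG).
rewrite in_itv /= => /andP[uw _] E; rewrite -subr_ge0 E mulr_ge0 ?subr_ge0//.
have -> : Gfun1 w = D * (- n1 * n2) * (expR (n2 * w) - expR (n1 * w)) by rewrite /Gfun1; ring.
apply: mulr_ge0.
  by rewrite mulr_ge0 ?(ltW D0)// mulr_ge0 ?(ltW n20)// oppr_ge0 ltW.
by rewrite subr_ge0 ler_expR ler_wpM2r ?(le_trans u0)// ltW// (lt_trans n10).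
Qed.

Lemma powR_ln (z n : R) : 0 < z -> z `^ n = expR (n * ln z).
Proof. by move=> z0; rewrite -{1}(@lnK _ z) ?posrE// -expRM mulrC. Qed.

(** Under z = e^u a root of f is a point of smooth contact; likewise a root of g is a point where G
    takes the cap value K2 - K1. *)
Lemma f_stat_tangency (z : R) : 0 < z -> f_stat K1 k1 K2 n1 n2 z = tangency (ln z).
Proof.
by move=> z0; rewrite /f_stat !powR_ln// /tangency /Gfun /Gfun1 /D /kap; ring.
Qed.

Lemma g_stat_Gfun (z : R) : 0 < z -> g_stat K1 k1 K2 n1 n2 z = Gfun (ln z) - (K2 - K1).
Proof. by move=> z0; rewrite /g_stat !powR_ln. Qed.

Lemma expR_quotient (a w z : R) : 0 < z -> expR a = expR w / z -> a = w - ln z.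
Proof.
by move=> z0 H; apply: expR_inj; rewrite H expRB lnK// posrE.
Qed.

(** Value matching holds in every case. The cap affects only the slopes: contact is smooth when the
    uncapped level is admissible, and otherwise only the sign of [tangency] survives. *)
Lemma capped_levelsP (a b : R) : capped_levels K1 k1 K2 q n1 n2 a b ->
  [/\ a < b, b <= ln k1, Gfun (b - a) = expR b + kap, 0 <= tangency (b - a) &
      b < ln k1 -> tangency (b - a) = 0].
Proof.
have k10 : 0 < k1 by apply: lt_trans K1k1.
move=> [y [e [He Hcase]]].
have fin (b0 : R) : 1 < y -> f_stat K1 k1 K2 n1 n2 y = 0 ->
    expR b0 = (K2 - k1) * n1 * n2 / (n2 - n1) * (y `^ n1 - y `^ n2) ->
    [/\ 0 < ln y, tangency (ln y) = 0 & Gfun (ln y) = expR b0 + kap].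
  move=> y1 fy Eb; have y0 : 0 < y by apply: lt_trans y1.
  have t0 : tangency (ln y) = 0 by rewrite -f_stat_tangency.
  split=> //; first exact: ln_gt0.
  (* The formula for e^b is slope matching, G' = e^b; with [tangency] zero, value matching
     follows. *)
  have -> : expR b0 = Gfun1 (ln y) by rewrite Eb !powR_ln// /Gfun1 /D; ring.
  by move: t0; rewrite /tangency; lra.
have [le|nle] := boolP (e <= (ln k1)%:E)%E; rewrite ?le ?(negPf nle) in Hcase.
  move: He; rewrite /uncapped_level; case: ifP => _; last by move=> e1; rewrite e1 in le.
  move=> [y1 fy [b0 e1 Eb]]; move: Hcase le; rewrite e1 /= lee_fin => -[Ea ->] le.
  have [ly t0 G0] := fin b0 y1 fy Eb.
  have y0 : 0 < y by apply: lt_trans y1.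
  have aE : a = b0 - ln y by apply: expR_quotient.
  have uE : b0 - a = ln y by rewrite aE; ring.
  rewrite uE; split => //; last by rewrite t0.
  by rewrite aE; lra.
move: Hcase => [z [z1 gz Ea ->]].
have z0 : 0 < z by apply: lt_trans z1.
have aE : a = ln k1 - ln z by apply: expR_quotient => //; rewrite lnK ?posrE.
have uE : ln k1 - a = ln z by rewrite aE; ring.
have lz := ln_gt0 z1.
have Gz : Gfun (ln z) = k1 + kap by move: gz; rewrite g_stat_Gfun// /kap; lra.
rewrite uE lnK ?posrE// Gz; split => //; [by rewrite aE; lra| |by rewrite ltxx].
move: He; rewrite /uncapped_level; case: ifPn => cond.
  move=> [y1 fy [b0 e1 Eb]]; have [ly t0 G0] := fin b0 y1 fy Eb.
  (* Were the uncapped ratio [y] smaller than [z], monotonicity of G would put the uncapped level at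
     or below ln k1. Hence z <= y, and [tangency] at ln z is at least its value 0 at ln y. *)
  rewrite -t0; apply: tangency_nonincr; rewrite leNgt; apply/negP => yz.
  have := Gfun_nondecr (ltW ly) (ltW yz); rewrite Gz G0 lerD2r.
  move: nle; rewrite e1 lee_fin -ltNge => kb.
  by rewrite -[X in _ <= X](@lnK _ k1) ?posrE// ler_expR leNgt kb.
move=> _; move: cond; rewrite negb_or -!leNgt => /andP[qle KK].
(* Here b = +oo: q = 0 forces n2 = 1, the growing exponential drops out of [tangency], and both
   remaining terms are nonnegative. *)
have n21 := n2_eq1 (le_anti (introT andP (conj qle q0))).
have -> : tangency (ln z) = D * ((1 - n1) * expR (n1 * ln z)) + (K1 + k1 - K2).
  by rewrite /tangency /Gfun /Gfun1 /kap n21; ring.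
apply: addr_ge0; last by rewrite subr_ge0.
rewrite mulr_ge0 ?(ltW D0)// mulr_ge0 ?expR_ge0// subr_ge0 ltW//.
exact: lt_trans n10 ltr01.
Qed.

End stationary_barrier.

(** * Free boundaries *)

Section contact_set.
Context {R : realType}.
Variables (K1 k1 K2 sigma r q : R).
Hypotheses (hK1 : 0 < K1) (K1k1 : K1 < k1) (k1K2 : k1 < K2) (sigma0 : 0 < sigma) (r0 : 0 < r).
Let m := sigma ^+ 2 / 2.
Let c := r - q - sigma ^+ 2 / 2.
Variables (p T : R) (Y : R * R -> R).
Hypothesis hY : bounded_strong_solution K1 k1 K2 sigma r q p T Y.

Let k10 : 0 < k1. Proof. exact: lt_trans K1k1. Qed.

Lemma psi1_ge x : K2 - k1 <= psi1 K1 k1 K2 x /\ expR x - K1 + K2 - k1 <= psi1 K1 k1 K2 x.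
Proof.
have h1 : 0 <= Num.max (expR x - K1) 0 by rewrite le_max lexx orbT.
have h2 : expR x - K1 <= Num.max (expR x - K1) 0 by rewrite le_max lexx.
by rewrite /psi1; split; lra.
Qed.

(* The kink of the obstacle is convex, so a contact there would be touched from
   below by parabolas of arbitrarily large curvature [N]. *)
Lemma strong_above_kink t : 0 < t < T -> K2 - k1 < Y (ln K1, t).
Proof.
move=> tT; have lnKk : ln K1 < ln k1 by rewrite ltr_ln ?posrE.
have tT' : 0 <= t <= T by case/andP: tT => ? ?; rewrite !ltW.
have Yge z : z.1 < ln k1 -> 0 < z.2 < T -> psi1 K1 k1 K2 z.1 <= Y z.
  move=> z1 /andP[z2 z3]; apply: (strong_ge_psi1 hY k10 K1k1).
  by split; [exact: ltW|rewrite !ltW].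
rewrite lt_neqAle; apply/andP; split; last first.
  by apply: le_trans (Yge (ln K1, t) lnKk tT); have [] := psi1_ge (ln K1).
apply/eqP => e.
have m0 : 0 < m by exact: half_sqr_gt0.
(* Chosen so that 2 m N exceeds the lower-order terms of the inequality by at least 1. *)
pose N := (`|c| * K1 + r * (K2 - k1) + 1) / (2 * m).
have N0 : 0 < N.
  have n1 : 0 <= `|c| * K1 by apply: mulr_ge0 => //; exact: ltW.
  have n2 : 0 <= r * (K2 - k1) by apply: mulr_ge0; [exact: ltW|rewrite subr_ge0 ltW].
  by rewrite divr_gt0 ?mulr_gt0// ltr_wpDl// addr_ge0.
have [e1 e10 He1] := @Qint_cbox R k1 T (ln K1, t) lnKk tT.
(* The slope K1/2 lies halfway between the slopes 0 and K1 of the two branches at ln K1; within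
   distance K1/(2N) the margin K1/2 on either side dominates N |d|. *)
have e0 : 0 < Num.min e1 (K1 / (2 * N)) by rewrite lt_min e10 divr_gt0// mulr_gt0.
have vs := @strong_visc_super R K1 k1 K2 sigma r q sigma0 r0 p T Y hY (ln K1, t) lnKk tT.
have := vs _ 0 0 (- (K1 / 2)) (- N) e0.
have maj s : cbox (ln K1, t) (Num.min e1 (K1 / (2 * N))) s -> - Y s <= - Y (ln K1, t) +
    (0 * (s.2 - t) + 0 * (s.2 - t) ^+ 2 + - (K1 / 2) * (s.1 - ln K1) + - N * (s.1 - ln K1) ^+ 2).
  move=> hs; have hs1 : cbox (ln K1, t) e1 s by apply: sub_cboxS hs; rewrite ge_min lexx.
  have [q1 q2] := He1 _ hs1.
  have /cboxP[/= hs2 _] : cbox (ln K1, t) (K1 / (2 * N)) s.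
    by apply: sub_cboxS hs; rewrite ge_min lexx orbT.
  have [g1 g2] := psi1_ge s.1; have g3 := Yge s q1 q2.
  rewrite -e; set d := s.1 - ln K1 in hs2 *.
  have g4 : K1 * (1 + d) <= expR s.1.
    have -> : expR s.1 = K1 * expR d by rewrite /d expRB (@lnK _ K1) ?posrE// mulrC divfK// gt_eqF.
    by rewrite ler_pM2l// expR_ge1Dx.
  have Nd : N * `|d| <= K1 / 2.
    have := ler_wpM2l (ltW N0) hs2.
    by have -> : N * (K1 / (2 * N)) = K1 / 2 by field; rewrite gt_eqF.
  have dd : N * d ^+ 2 = N * `|d| * `|d| by rewrite -mulrA -expr2 real_normK ?num_real.
  have h := ler_wpM2r (normr_ge0 d) Nd.
  suff : K1 / 2 * d + N * d ^+ 2 + (K2 - k1) <= Y s by lra.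
  rewrite dd; have [d0|d0] := leP 0 d.
    by move: h; rewrite (ger0_norm d0); lra.
  by move: h; rewrite (ltr0_norm d0); lra.
move=> /(_ maj) /=; rewrite -e.
have E : 2 * m * N = `|c| * K1 + r * (K2 - k1) + 1.
  by rewrite /N; field; rewrite gt_eqF.
have h : - (`|c| * K1) <= c * (K1 / 2).
  have h1 : - `|c| <= c by rewrite lerNl -normrN ler_norm.
  have K20 : 0 <= K1 / 2 by rewrite divr_ge0 ?ltW.
  have := ler_wpM2r K20 h1; have := mulr_ge0 (normr_ge0 c) K20; lra.
move: E h; set nc := `|c| * K1; set cc := c * (K1 / 2) => E h.
by rewrite -/m -/c !mulrN opprK -/cc; lra.
Qed.

Lemma strong_contact_payoff x t : 0 < t < T -> x < ln k1 ->
  Y (x, t) = expR x - K1 + K2 - k1 -> 0 <= q * expR x - r * (K1 + k1 - K2).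
Proof.
move=> tT xk e.
have Yge z : z.1 < ln k1 -> 0 < z.2 < T -> psi1 K1 k1 K2 z.1 <= Y z.
  move=> z1 /andP[z2 z3]; apply: (strong_ge_psi1 hY k10 K1k1).
  by split; [exact: ltW|rewrite !ltW].
have m0 : 0 < m by exact: half_sqr_gt0.
have [e1 e10 He1] := @Qint_cbox R k1 T (x, t) xk tT.
have vs := @strong_visc_super R K1 k1 K2 sigma r q sigma0 r0 p T Y hY (x, t) xk tT.
(* The polynomial touching [Y] from below is the second-order expansion of the payoff, lowered by
   eps (y - x)^2 to absorb the remainder. *)
have key eps : 0 < eps -> 2 * m * (expR x / 2 - eps) + c * expR x - r * (expR x - K1 + K2 - k1) <= 0.
  move=> eps0; have [rho rho0 Hrho] := expR_jet 1 1 x eps0.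
  have e0 : 0 < Num.min e1 rho by rewrite lt_min e10.
  have maj s : cbox (x, t) (Num.min e1 rho) s -> - Y s <= - Y (x, t) +
    (0 * (s.2 - t) + 0 * (s.2 - t) ^+ 2 + - expR x * (s.1 - x) + (- (expR x / 2) + eps) * (s.1 - x) ^+ 2).
    move=> hs; have hs1 : cbox (x, t) e1 s by apply: sub_cboxS hs; rewrite ge_min lexx.
    have [q1 q2] := He1 _ hs1.
    have /cboxP[/= hs2 _] : cbox (x, t) rho s.
      by apply: sub_cboxS hs; rewrite ge_min lexx orbT.
    have [_ g2] := psi1_ge s.1; have g3 := Yge s q1 q2.
    have := Hrho _ hs2; rewrite !mul1r ler_norml => /andP[h _].
    by rewrite e; move: g2 g3 h; set es := expR s.1; set ex := expR x; lra.
  have := vs _ 0 0 (- expR x) (- (expR x / 2) + eps) e0 maj; rewrite /= e.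
  by rewrite /m /c; set ex := expR x; set s2 := sigma ^+ 2 / 2; lra.
rewrite leNgt; apply/negP => neg.
set g := q * expR x - r * (K1 + k1 - K2) in neg.
have g0 : 0 < - g by rewrite oppr_gt0.
have := key (- g / (4 * m)); rewrite divr_gt0 ?mulr_gt0// => /(_ isT).
have -> : 2 * m * (expR x / 2 - - g / (4 * m)) = m * expR x + g / 2 by field; rewrite gt_eqF.
have gE : g = q * expR x - r * (K1 + k1 - K2) by [].
move: gE g0; rewrite /m /c; set s2 := sigma ^+ 2 / 2; set ex := expR x; clearbody g.
by move=> gE g0; lra.
Qed.

End contact_set.

(** * Limits of monotone functions *)

Section monotone_limits.
Context {R : realType}.

(** The limit is the infimum over (0, T), at least f T by monotonicity. The last hypothesis supplies
    the reverse inequality; for a free boundary it holds because limits of contact points are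
    contact points. *)
Lemma nonincreasing_left_limit (f : R -> R) (T : R) : 0 < T ->
  (forall s t, 0 < s -> s <= t -> t <= T -> f t <= f s) ->
  (forall l, (forall d, 0 < d -> exists2 s, 0 < s < T /\ T - s <= d & `|f s - l| <= d) -> l <= f T) ->
  f tau @[tau --> T^'-] --> f T.
Proof.
move=> T0 fT fl.
pose S := [set f s | s in [set s | 0 < s < T]].
have infS : has_inf S.
  split; first by exists (f (T / 2)), (T / 2) => //=; apply/andP; split; lra.
  by exists (f T) => _ [s /= /andP[s0 sT] <-]; apply: fT => //; exact: ltW.
have lb s : 0 < s < T -> inf S <= f s by move=> sT; apply: (ge_inf infS.2); exists s.
have inf_le : inf S <= f T.
  apply: fl => d d0.
  have [_ [s0 /= s0T <-] s0d] := inf_adherent d0 infS.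
  have /andP[s00 s0T'] := s0T.
  (* By monotonicity a near-minimiser stays one when moved closer to [T]. *)
  pose s := Num.max s0 (T - d).
  have s1 : s0 <= s by rewrite le_max lexx.
  have s2 : T - d <= s by rewrite le_max lexx orbT.
  have s3 : s < T by rewrite gt_max s0T'; lra.
  have s4 : 0 < s by apply: lt_le_trans s1.
  have h1 := fT _ _ s00 s1 (ltW s3); have h2 := lb s; rewrite s4 s3 in h2.
  exists s; first by split; [rewrite s4|lra].
  by rewrite ger0_norm ?subr_ge0 ?h2//; have := h2 isT; lra.
apply/cvgrPdist_le => e e0.
have [_ [s0 /= s0T <-] s0e] := inf_adherent e0 infS.
have /andP[s00 s0T'] := s0T.
near=> t.
have t1 : s0 <= t by apply: ltW; near: t; exact: nbhs_left_gt.
have t2 : t <= T by near: t; exact: nbhs_left_le.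
have h1 := fT _ _ s00 t1 t2; have h2 := fT _ _ (lt_le_trans s00 t1) t2 (lexx T).
by rewrite distrC ger0_norm ?subr_ge0//; lra.
Unshelve. all: by end_near. Qed.

Lemma nonincreasing_pinfty_limit (f : R -> R) (l : R) :
  (forall s t, 0 < s -> s <= t -> f t <= f s) -> (forall t, 0 < t -> l <= f t) ->
  exists L : R, f t @[t --> +oo] --> L.
Proof.
move=> fm fl; pose S := [set f s | s in [set s | 0 < s]].
have infS : has_inf S.
  split; first by exists (f 1), 1 => //=.
  by exists l => _ [s /= s0 <-]; exact: fl.
exists (inf S); apply/cvgrPdist_le => e e0.
have [_ [s0 /= s00 <-] s0e] := inf_adherent e0 infS.
near=> t.
have t1 : s0 <= t by near: t; apply: nbhs_pinfty_ge; exact: num_real.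
have h1 := fm _ _ s00 t1.
have h2 : inf S <= f t by apply: (ge_inf infS.2); exists t => //=; exact: lt_le_trans t1.
by rewrite distrC ger0_norm ?subr_ge0//; lra.
Unshelve. all: by end_near. Qed.

End monotone_limits.

(** * Monotonicity, bounds and limits of the free boundaries *)

Section free_boundaries.
Context {R : realType}.
Variables (K1 k1 K2 sigma r q : R).
Hypotheses (hK1 : 0 < K1) (K1k1 : K1 < k1) (k1K2 : k1 < K2) (sigma0 : 0 < sigma) (r0 : 0 < r).
Variables (p T T' : R) (Y Y' : R * R -> R) (A A' B B' : R -> R).
Hypothesis hY : bounded_strong_solution K1 k1 K2 sigma r q p T Y.
Hypothesis hY' : bounded_strong_solution K1 k1 K2 sigma r q p T' Y'.
Hypotheses (hA : lower_free_boundary K1 k1 K2 T Y A) (hB : upper_free_boundary K1 k1 K2 T Y B).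
Hypotheses (hA' : lower_free_boundary K1 k1 K2 T' Y' A') (hB' : upper_free_boundary K1 k1 K2 T' Y' B').

Let k10 : 0 < k1. Proof. exact: lt_trans K1k1. Qed.
Let lnK1k1 : ln K1 < ln k1. Proof. by rewrite ltr_ln ?posrE. Qed.

Lemma strong_ge_obstacle x t : x <= ln k1 -> 0 < t <= T ->
  K2 - k1 <= Y (x, t) /\ expR x - K1 + K2 - k1 <= Y (x, t).
Proof.
move=> xk /andP[t0 tT]; have := @strong_ge_psi1 _ _ _ _ _ _ _ _ _ _ hY (x, t) k10 K1k1.
have S : strip (ln k1) T (x, t) by split => //=; rewrite ltW.
by move=> /(_ S) h; have [h1 h2] := psi1_ge K1 k1 K2 x; split; [exact: le_trans h1 h|exact: le_trans h2 h].
Qed.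

(* The free boundaries are compared across solutions with different horizons,
   which covers both monotonicity in time and independence of the horizon. *)
Lemma free_boundaries_monotone s t : 0 < s -> s <= T -> s <= t -> t <= T' ->
  A' t <= A s /\ B s <= B' t.
Proof.
move=> s0 sT st tT'.
have ts : 0 <= t - s by rewrite subr_ge0.
have sts : s + (t - s) <= T' by rewrite subrKC.
have ss : 0 <= s <= s by rewrite lexx ltW.
(* At a contact point of [Y'] at time t, [Y] at time s is enclosed between the obstacle and [Y'], so
   it is in contact there too. *)
have cmp x : x <= ln k1 -> Y (x, s) <= Y' (x, t).
  by move=> xk; have := strong_comparison sigma0 r0 hY hY' ts sT sts xk ss; rewrite subrKC.
have sT0 : 0 < s <= T by rewrite s0.
have tT0 : 0 < t <= T' by rewrite (lt_le_trans s0 st).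
have [[a1 a2] _] := hA' tT0; have [_ a3] := hA sT0.
have [[b1 b2] _] := hB' tT0; have [_ b3] := hB sT0.
split.
  apply: a3; split => //; have xk := le_trans a1 (ltW lnK1k1).
  apply/eqP; rewrite eq_le; apply/andP; split; last by have [] := strong_ge_obstacle xk sT0.
  by rewrite -a2; exact: cmp.
apply: b3; split => //; have /andP[_ xk] := b1.
apply/eqP; rewrite eq_le; apply/andP; split; last by have [] := strong_ge_obstacle xk sT0.
by rewrite -b2; exact: cmp.
Qed.

End free_boundaries.

Section bounds.
Context {R : realType}.
Variables (K1 k1 K2 sigma r q n1 n2 a b : R).
Hypotheses (hK1 : 0 < K1) (K1k1 : K1 < k1) (k1K2 : k1 < K2) (sigma0 : 0 < sigma) (r0 : 0 < r)
  (q0 : 0 <= q) (n10 : n1 < 0) (n20 : 0 < n2)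
  (root1 : characteristic_root sigma r q n1) (root2 : characteristic_root sigma r q n2)
  (hab : capped_levels K1 k1 K2 q n1 n2 a b).
Variables (p T : R) (Y : R * R -> R) (A B : R -> R).
Hypotheses (T0 : 0 < T) (hY : bounded_strong_solution K1 k1 K2 sigma r q p T Y).
Hypotheses (hA : lower_free_boundary K1 k1 K2 T Y A) (hB : upper_free_boundary K1 k1 K2 T Y B).

Let k10 : 0 < k1. Proof. exact: lt_trans K1k1. Qed.
Let lnK1k1 : ln K1 < ln k1. Proof. by rewrite ltr_ln ?posrE. Qed.

Let AB_mono s t : 0 < s -> s <= t -> t <= T -> A t <= A s /\ B s <= B t.
Proof.
move=> s0 st tT.
exact: (free_boundaries_monotone hK1 K1k1 sigma0 r0 hY hY hA hB hA hB s0 (le_trans st tT) st tT).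
Qed.

(** At [a] and [b] the barrier coincides with a piece of the obstacle, so [Y], enclosed between
    them, is in contact there; maximality of A and minimality of B conclude. *)
Lemma capped_levels_bounds t : 0 < t <= T -> a <= A t /\ B t <= b.
Proof.
move=> tT; have [ab bk Gb tb tb0] := capped_levelsP hK1 K1k1 k1K2 sigma0 r0 q0 n10 n20 root2 hab.
have tT' : 0 <= t <= T by case/andP: tT => t0 ->; rewrite ltW.
have Ka := expRa_le k1K2 sigma0 r0 q0 n10 n20 root2 ab Gb tb.
have Kb := expRb_ge k1K2 n10 n20 Gb.
pose U := barrier k1 K2 n1 n2 a b.
have YU x : x <= ln k1 -> Y (x, t) <= U x.
  move=> xk; apply: (strong_le_barrier sigma0 r0 hY k10 (U := U)) => //.
  - exact: continuous_barrier.
  - move=> y _; exact: (barrier_ge_psi1 k1K2 sigma0 r0 q0 n10 n20 root2 ab Gb tb).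
  - by rewrite /U (barrier_right ab Gb bk) lnK ?posrE//; lra.
  - by rewrite subr_ge0 ltW.
  - move=> y yk; exact: (barrier_supersolution k1K2 sigma0 r0 q0 n10 n20 root1 root2 ab Gb tb tb0 yk).
have alnK : a <= ln K1 by rewrite -ler_expR lnK ?posrE.
have blnK : ln K1 <= b by rewrite -ler_expR lnK ?posrE.
have ak : a <= ln k1 := le_trans alnK (ltW lnK1k1).
split.
  have [_] := hA tT; apply; split => //.
  apply/eqP; rewrite eq_le; apply/andP; split.
    by apply: le_trans (YU a ak) _; rewrite /U (barrier_left k1 K2 n10 n20 ab (lexx a)).
  by have [] := strong_ge_obstacle hK1 K1k1 hY ak tT.
have [_] := hB tT; apply; split; first by rewrite blnK.
apply/eqP; rewrite eq_le; apply/andP; split.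
  by apply: le_trans (YU b bk) _; rewrite /U (barrier_right ab Gb (lexx b)); lra.
by have [] := strong_ge_obstacle hK1 K1k1 hY bk tT.
Qed.

(* The differential inequalities only hold at interior times; t / 2 is one, and
   monotonicity in time brings the bound back to t. *)
Lemma lower_lt_kink t : 0 < t <= T -> A t < ln K1.
Proof.
move=> /andP[t0 tT].
have h0 : 0 < t / 2 by rewrite divr_gt0.
have hT : 0 < t / 2 < T by rewrite h0; lra.
have hT' : 0 < t / 2 <= T by rewrite h0; lra.
have ht : t / 2 <= t by lra.
have [le _] := AB_mono h0 ht tT; apply: le_lt_trans le _.
have [[a1 a2] _] := hA hT'.
rewrite lt_neqAle a1 andbT; apply/eqP => e.
have := strong_above_kink hK1 K1k1 k1K2 sigma0 r0 hY hT.
by rewrite -e a2 ltxx.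
Qed.

Lemma upper_ge_xi t : 0 < t <= T -> Num.min (xi_level K1 k1 K2 r q) (ln k1) <= B t.
Proof.
move=> /andP[t0 tT].
have h0 : 0 < t / 2 by rewrite divr_gt0.
have hT : 0 < t / 2 < T by rewrite h0; lra.
have hT' : 0 < t / 2 <= T by rewrite h0; lra.
have ht : t / 2 <= t by lra.
have [_ le] := AB_mono h0 ht tT; apply: le_trans le.
have [[/andP[b1 b2] b3] _] := hB hT'.
(* The contact inequality requires x < ln k1; at the cap the bound holds through the other term of
   the minimum. *)
have [kB|Bk] := leP (ln k1) (B (t / 2)); first by rewrite ge_min kB orbT.
rewrite ge_min; apply/orP; left; rewrite /xi_level; case: ifPn => [/andP[qpos KK]|//].
rewrite ge_max b1 /=.
have h := strong_contact_payoff hK1 K1k1 sigma0 r0 hY hT Bk b3.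
have z0 : 0 < r * (K1 + k1 - K2) / q by rewrite divr_gt0// mulr_gt0// subr_gt0.
rewrite -ler_expR lnK ?posrE// ler_pdivrMr// mulrC; lra.
Qed.

Lemma free_boundary_limits : A tau @[tau --> T^'-] --> A T /\ B tau @[tau --> T^'-] --> B T.
Proof.
have TT : 0 < T <= T by rewrite T0 lexx.
have cY := strong_box_continuous hY.
(* Joint continuity of [Y] carries the contact equation to limits of contact points as time tends to
   [T]; [phi] is the constant K2 - k1 for A and the payoff for B. *)
have closure (g : R -> R) x (phi : R -> R) : continuous phi -> x <= ln k1 ->
    (forall s, 0 < s < T -> g s <= ln k1 /\ Y (g s, s) = phi (g s)) ->
    (forall d, 0 < d -> exists2 s, 0 < s < T /\ T - s <= d & `|g s - x| <= d) ->
    Y (x, T) = phi x.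
  move=> cphi xk gY gx.
  have xT : strip (ln k1) T (x, T) by split => //=; rewrite lexx ltW.
  apply/eqP; rewrite -subr_eq0 -normr_le0; apply/ler_addgt0Pr => e e0; rewrite add0r.
  have e2 : 0 < e / 2 by rewrite divr_gt0.
  have [d d0 Hd] := cY _ xT _ e2.
  have /cvgrPdist_le /(_ _ e2) /nbhs_ballP[d' /= d'0 Hd'] := cphi x.
  have dd : 0 < Num.min d (d' / 2) by rewrite lt_min d0 divr_gt0.
  have [s [sT s1] s2] := gx _ dd; have [g1 g2] := gY s sT.
  move: s1 s2; rewrite !le_min => /andP[s1 _] /andP[s2 s3].
  have /andP[s0 sT'] := sT.
  have gS : strip (ln k1) T (g s, s) by split => //=; rewrite !ltW.
  have h1 : `|Y (g s, s) - Y (x, T)| <= e / 2.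
    apply: Hd => //; apply/cboxP; split => //=.
    by rewrite distrC ger0_norm// subr_ge0 ltW.
  have h2 : `|phi x - phi (g s)| <= e / 2.
    by apply: Hd'; rewrite /ball /= distrC; lra.
  rewrite g2 in h1; have -> : Y (x, T) - phi x = - ((phi x - phi (g s)) + (phi (g s) - Y (x, T))) by ring.
  rewrite normrN; apply: le_trans (ler_normD _ _) _; lra.
have hB' s : 0 < s < T -> 0 < s <= T by move=> /andP[-> /ltW ->].
split.
  apply: nonincreasing_left_limit => // [s t s0 st tT|l hl]; first by have [] := AB_mono s0 st tT.
  have [_] := hA TT; apply; have lK : l <= ln K1.
    apply/ler_addgt0Pr => d d0; have [s [/hB' sT _] sd] := hl d d0.
    have [[a1 _] _] := hA sT; move: sd; rewrite ler_norml => /andP[]; lra.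
  split => //; apply: (closure A l (cst (K2 - k1))) => //.
  - by move=> x; exact: cvg_cst.
  - exact: le_trans (ltW lnK1k1).
  - move=> s /hB' sT; have [[a1 a2] _] := hA sT; split => //.
    exact: le_trans (ltW lnK1k1).
(* The sign change makes the boundary nonincreasing; its limit being a contact point at [T],
   minimality of B T gives the missing inequality. *)
have H : (fun t => - B t) tau @[tau --> T^'-] --> - B T.
  apply: nonincreasing_left_limit => // [s t s0 st tT|l hl].
    by rewrite lerN2; have [] := AB_mono s0 st tT.
  have hl' d : 0 < d -> exists2 s, 0 < s < T /\ T - s <= d & `|B s - - l| <= d.
    move=> d0; have [s sT sd] := hl d d0; exists s => //.
    by rewrite -normrN opprD opprK.
  rewrite lerNr; have [_] := hB TT; apply.
  have lK : ln K1 <= - l <= ln k1.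
    apply/andP; split; apply/ler_addgt0Pr => d d0; have [s [/hB' sT _] sd] := hl' d d0;
      have [[/andP[b1 b2] _] _] := hB sT; move: sd; rewrite ler_norml => /andP[]; lra.
  split => //; apply: (closure B (- l) (fun x => expR x - K1 + K2 - k1)) => //.
  - move=> x; apply: cvgB; last exact: cvg_cst.
    apply: cvgD; last exact: cvg_cst.
    by apply: cvgB; [exact: continuous_expR|exact: cvg_cst].
  - by case/andP: lK.
  - by move=> s /hB' sT; have [[/andP[b1 b2] b3] _] := hB sT; split.
have -> : B = (fun t => - - B t) by apply/funext => t; rewrite opprK.
exact: cvgN H.
Qed.

End bounds.

Unset Implicit Arguments.
Set Strict Implicit.

Theorem proposition5p5 (R : realType) (K1 k1 k2 K2 sigma r q n1 n2 : R)
    (p p' a bk1 : R) (V : R -> R)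
    (hK1 : 0 < K1) (hK1k1 : K1 < k1) (hk1k2 : k1 < k2) (hk2K2 : k2 < K2)
    (hsigma : 0 < sigma) (hr : 0 < r) (hq : 0 <= q)
    (hn1 : n1 < 0) (hn2 : 0 < n2)
    (hn1root : characteristic_root sigma r q n1)
    (hn2root : characteristic_root sigma r q n2)
    (hp : 1 < p) (hp' : 1 < p')
    (hV : stationary_strong_solution K1 k1 K2 sigma r q p' V)
    (hab : capped_levels K1 k1 K2 q n1 n2 a bk1) :
  (forall (T : R) (Y : R * R -> R) (A B : R -> R),
    0 < T ->
    bounded_strong_solution K1 k1 K2 sigma r q p T Y ->
    lower_free_boundary K1 k1 K2 T Y A ->
    upper_free_boundary K1 k1 K2 T Y B ->
    [/\ (forall x tau, x <= ln k1 -> 0 <= tau <= T -> Y (x, tau) <= V x),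
        (forall tau, 0 < tau <= T -> a <= A tau /\ A tau < ln K1),
        (forall tau, 0 < tau <= T ->
          Num.min (xi_level K1 k1 K2 r q) (ln k1) <= B tau /\ B tau <= bk1),
        [/\ (forall s t, 0 < s -> s <= t -> t <= T -> A t <= A s),
            A tau @[tau --> T^'-] --> A T & a <= A T] &
        [/\ (forall s t, 0 < s -> s <= t -> t <= T -> B s <= B t),
            B tau @[tau --> T^'-] --> B T & B T <= bk1]]) /\
  (forall (Y : R -> R * R -> R) (A B : R -> R -> R),
    (forall T, 0 < T ->
      [/\ bounded_strong_solution K1 k1 K2 sigma r q p T (Y T),
          lower_free_boundary K1 k1 K2 T (Y T) (A T) &
          upper_free_boundary K1 k1 K2 T (Y T) (B T)]) ->
    (exists lA : R, A T T @[T --> +oo] --> lA) /\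
    (exists lB : R, B T T @[T --> +oo] --> lB)).
Proof.
have k1K2 : k1 < K2 by exact: lt_trans hk2K2.
have bounds T Y A B := @capped_levels_bounds R K1 k1 K2 sigma r q n1 n2 a bk1 hK1 hK1k1 k1K2
  hsigma hr hq hn1 hn2 hn1root hn2root hab p T Y A B.
split=> [T Y A B T0 hY hA hB|Y A B sol].
  have mono s t : 0 < s -> s <= t -> t <= T -> A t <= A s /\ B s <= B t.
    move=> s0 st tT; exact: (free_boundaries_monotone hK1 hK1k1 hsigma hr hY hY hA hB hA hB s0 (le_trans st tT) st tT).
  have [limA limB] := free_boundary_limits hK1 hK1k1 hsigma hr T0 hY hA hB.
  have bnd := bounds T Y A B hY hA hB.
  have TT : 0 < T <= T by rewrite T0 lexx.
  split.
  - exact: (strong_le_stationary hsigma hr hY (lt_trans hK1 hK1k1) hK1k1 hV).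
  - move=> t tT; split; first by have [] := bnd t tT.
    exact: (lower_lt_kink hK1 hK1k1 k1K2 hsigma hr hY hA hB).
  - move=> t tT; split; last by have [] := bnd t tT.
    exact: (upper_ge_xi hK1 hK1k1 hsigma hr hY hA hB).
  - split => //; last by have [] := bnd T TT.
    by move=> s t s0 st tT; have [] := mono s t s0 st tT.
  - split => //; last by have [] := bnd T TT.
    by move=> s t s0 st tT; have [] := mono s t s0 st tT.
(* The two solutions have horizons s and t, and each boundary is read at its own final time. *)
have mono s t : 0 < s -> s <= t -> A t t <= A s s /\ B s s <= B t t.
  move=> s0 st; have t0 := lt_le_trans s0 st.
  have [Ys As Bs] := sol s s0; have [Yt At Bt] := sol t t0.
  exact: (free_boundaries_monotone hK1 hK1k1 hsigma hr Ys Yt As Bs At Bt s0 (lexx s) st (lexx t)).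
have bnd t : 0 < t -> a <= A t t /\ B t t <= bk1.
  move=> t0; have [Yt At Bt] := sol t t0; apply: (bounds t (Y t)) => //.
  by rewrite t0 lexx.
split.
  apply: (@nonincreasing_pinfty_limit _ (fun T => A T T) a) => [s t s0 st|t t0].
    by have [] := mono s t s0 st.
  by have [] := bnd t t0.
have [s t s0 st|t t0|l hl] := @nonincreasing_pinfty_limit _ (fun T => - B T T) (- bk1).
- by rewrite lerN2; have [] := mono s t s0 st.
- by rewrite lerN2; have [] := bnd t t0.
- exists (- l); have -> : (fun T => B T T) = (fun T => - - B T T) by apply/funext => t; rewrite opprK.
  exact: cvgN hl.
Qed.
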